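(* Let $\chi$ be a Dirichlet character modulo $m$ with associated Dirichlet $L$-function $L_\chi$. For every integer $n\ge0$, $$\hat S_{n,0}(\chi)=-L_\chi'(-n)+(-1)^{n+1}n!\,m^n\left(\sum_{a=1}^{m}\chi(a)\,b_n\!\left(\frac am\right)\right)H_n+\frac{B_{\chi,n+1}}{n+1}\log m.$$
   Context: $H_n$ is the $n$-th harmonic number ($H_0=0$). $L_\chi(s)=\sum_{k\ge1}\chi(k)k^{-s}$ for $\Re s>1$, continued meromorphically to $\mathbb{C}$. $\hat S_{n,0}(\chi)$ is the constant term (coefficient of $s^0$) in the asymptotic expansion, as the integer $s\to+\infty$, of $\sum_{k=1}^{ms}\chi(k)\,k^n\log k$ in the family of functions $s^j\log s$ ($j\ge0$) and $s^j$ ($j\in\mathbb{Z}$); this expansion exists and is unique. The modified Bernoulli polynomials $b_k(w)$ are defined by $\frac{e^{-wt}}{1-e^{-t}}=\frac1t+\sum_{k\ge0}b_k(w)t^k$. The $\chi$-Bernoulli numbers $B_{\chi,k}$ are defined by $\sum_{a=1}^{m}\frac{\chi(a)\,t\,e^{at}}{e^{mt}-1}=\sum_{k\ge0}B_{\chi,k}\frac{t^k}{k!}$. *)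

(* Defs.v *)
From Stdlib Require Export Reals ZArith ClassicalEpsilon.
From Coquelicot Require Export Coquelicot.
Open Scope R_scope.

(* Functions on Z factoring through Z/mZ.  [chi 1 = 1] follows from the last
   two clauses; for [m = 1] the only character is the constant 1. *)
Definition dirichlet_character (m : nat) (chi : Z -> C) : Prop :=
  (0 < m)%nat
  /\ (forall a : Z, chi (a + Z.of_nat m)%Z = chi a)
  /\ (forall a b : Z, chi (a * b)%Z = (chi a * chi b)%C)
  /\ (forall a : Z, chi a <> 0%C <-> Z.gcd a (Z.of_nat m) = 1%Z).

Definition Cexp (z : C) : C := (exp (Re z) * cos (Im z), exp (Re z) * sin (Im z)).

(* x^z for x > 0, with the real logarithm of x. *)
Definition Rpos_Cpower (x : R) (z : C) : C := Cexp (z * RtoC (ln x))%C.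

Definition analytic_at (f : C -> C) (z0 : C) : Prop :=
  exists (a : nat -> C) (r : R), 0 < r /\
    forall z : C, Cmod (z - z0)%C < r ->
      is_pseries (K := C_AbsRing) (V := C_NormedModule) a (z - z0)%C (f z).

Definition pole_at (f : C -> C) (z0 : C) : Prop :=
  exists (k : nat) (g : C -> C) (r : R),
    (0 < k)%nat /\ analytic_at g z0 /\ g z0 <> 0%C /\ 0 < r /\
    forall z : C, 0 < Cmod (z - z0)%C < r -> f z = (g z / (z - z0) ^ k)%C.

(* Removable singularities are not allowed to carry a wrong value, so a
   meromorphic function is only arbitrary at its poles. *)
Definition meromorphic (f : C -> C) : Prop :=
  forall z0 : C, analytic_at f z0 \/ pole_at f z0.

Definition is_L_function (chi : Z -> C) (L : C -> C) : Prop :=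
  meromorphic L /\
  forall s : C, 1 < Re s ->
    is_series (K := C_AbsRing) (V := C_NormedModule)
      (fun k : nat => chi (Z.of_nat (S k)) * Rpos_Cpower (INR (S k)) (- s))%C
      (L s).

(* Determined by the identity theorem, except for the values at the poles. *)
Definition L_function (chi : Z -> C) : C -> C :=
  epsilon (inhabits (fun _ : C => RtoC 0)) (is_L_function chi).

(* As the integer s tends to +oo,
     f s ~ sum_(0 <= j <= J) a_j s^j log s + sum_(j <= J) c_j s^j,
   where the second sum is over j in Z and is truncated at j = - N with an
   error o(s^(-N)), for every N; it is indexed by j = J - k. *)
Definition asymptotic_expansion
    (f : nat -> C) (J : nat) (a : nat -> C) (c : Z -> C) : Prop :=
  forall N : nat,
    is_lim_seq
      (fun s : nat =>
         INR s ^ N *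
         Cmod (f s
               - sum_n (fun j : nat => a j * RtoC (INR s ^ j * ln (INR s))) J
               - sum_n (fun k : nat =>
                          let j := (Z.of_nat J - Z.of_nat k)%Z in
                          c j * RtoC (powerRZ (INR s) j)) (J + N))%C)
      0.

Definition is_constant_term (f : nat -> C) (v : C) : Prop :=
  exists (J : nat) (a : nat -> C) (c : Z -> C),
    asymptotic_expansion f J a c /\ c 0%Z = v.

Definition constant_term (f : nat -> C) : C :=
  epsilon (inhabits (RtoC 0)) (is_constant_term f).

Definition S_hat (m : nat) (chi : Z -> C) (n : nat) : C :=
  constant_term
    (fun s : nat =>
       sum_n_m (fun k : nat =>
                  chi (Z.of_nat k) * RtoC (INR k ^ n * ln (INR k)))%C
               1 (m * s)).

(* Generating function identities are taken for real t in a punctured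
   neighbourhood of 0, which determines the coefficients. *)
Definition is_modified_bernoulli (w : R) (b : nat -> R) : Prop :=
  exists r : R, 0 < r /\
    forall t : R, 0 < Rabs t < r ->
      is_pseries b t (exp (- w * t) / (1 - exp (- t)) - 1 / t).

Definition modified_bernoulli (w : R) : nat -> R :=
  epsilon (inhabits (fun _ : nat => 0)) (is_modified_bernoulli w).

Definition is_chi_bernoulli (m : nat) (chi : Z -> C) (B : nat -> C) : Prop :=
  exists r : R, 0 < r /\
    forall t : R, 0 < Rabs t < r ->
      is_pseries (K := C_AbsRing) (V := C_NormedModule)
        (fun k : nat => B k / RtoC (INR (fact k)))%C (RtoC t)
        (sum_n_m (fun a : nat =>
           chi (Z.of_nat a)
           * RtoC (t * exp (INR a * t) / (exp (INR m * t) - 1)))%C 1 m).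

Definition chi_bernoulli (m : nat) (chi : Z -> C) : nat -> C :=
  epsilon (inhabits (fun _ : nat => RtoC 0)) (is_chi_bernoulli m chi).

Definition harmonic (n : nat) : R := sum_n_m (fun k : nat => / INR k) 1 n.

(* Main.v *)
Require Import Defs.
From Stdlib Require Import Lra Lia Psatz.

(* Euler-Maclaurin with a complex exponent, in steps of h = m.  Let
   sum_k b_k t^k = t e^(-at) / (1 - e^(-ht)).  The remainder
     sum_(k < N) b_(k+1) (z)_k (X^(-z-k) - (X+h)^(-z-k)) - (X+a)^(-z)
       + (X^(1-z) - (X+h)^(1-z)) / (h (z-1))
   has a binomial expansion in the functions (z)_j X^(-z-j) whose coefficients
   with j < N vanish, by the recursion for b.  Summing it over X = h l gives
     sum_(l < s) (h l + a)^(-z) = zeta_a(z) - sum_(k < N) b_(k+1) (z)_k (h s)^(-z-k)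
       - (h s)^(1-z) / (h (z-1)) + (small),
   where zeta_a is meromorphic on C; this continues L = sum_a chi(a) zeta_a.
   Differentiating at z = -n gives the expansion of sum_k chi(k) k^n log k, whose
   constant term comes from zeta_a'(-n) and from k = n, where (z)_n and its
   derivative take the values (-1)^n n! and (-1)^(n+1) n! H_n.
   Analyticity is tracked by absolutely convergent power series on closed discs:
   a majorant makes infinite sums and derivatives harmless without Cauchy's
   integral. *)

(** * Finite sums and complex limits *)

(** What shapes the proof is the derivative in z: the error of the expansion must be small together
    with its derivative at z = -n. So every remainder is carried as a majorized power series on a
    disc, whose linear coefficient is at most M / r. The functions (z)_j X^(-z-j) keep their rising
    factorial so that the coefficients do not depend on z; cancellation is then an identity between
    numbers, uniform in z. The binomial series in h / X needs a margin, so X starts at 2 h and the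
    terms l = 0, 1 are kept apart. The objects of the statement are chosen by [epsilon], so each
    needs uniqueness as well as existence: the constant term by independence of the s^j log s and
    s^j, the Bernoulli numbers by uniqueness of power series, L_chi by the identity theorem. Put T =
    sum_a chi(a) b_(n+1), where b depends on a. Rescaling t gives m^n sum_a chi(a) b_n(a/m) = T for
    the modified polynomials, and t -> -t gives B_(chi,n+1) / (n+1) = (-1)^(n+1) n! T. Both
    corrections are thus multiples of T, and log m comes from log X = log m + log s. *)

Fixpoint csum (f : nat -> C) (n : nat) : C :=
  match n with O => RtoC 0 | S k => (csum f k + f k)%C end.

Fixpoint rsum (f : nat -> R) (n : nat) : R :=
  match n with O => 0 | S k => rsum f k + f k end.

Lemma csum_ext f g n :
  (forall i, (i < n)%nat -> f i = g i) -> csum f n = csum g n.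
Proof.
  induction n as [|n IH]; intros E; [easy|].
  cbn. rewrite IH by (intros; apply E; lia). now rewrite E by lia.
Qed.

Lemma rsum_ext f g n :
  (forall i, (i < n)%nat -> f i = g i) -> rsum f n = rsum g n.
Proof.
  induction n as [|n IH]; intros E; [easy|].
  cbn. rewrite IH by (intros; apply E; lia). now rewrite E by lia.
Qed.

Lemma csum_plus f g n : csum (fun i => f i + g i)%C n = (csum f n + csum g n)%C.
Proof. induction n as [|n IH]; cbn; [|rewrite IH]; ring. Qed.

Lemma csum_minus f g n : csum (fun i => f i - g i)%C n = (csum f n - csum g n)%C.
Proof. induction n as [|n IH]; cbn; [|rewrite IH]; ring. Qed.

Lemma csum_scal c f n : csum (fun i => c * f i)%C n = (c * csum f n)%C.
Proof. induction n as [|n IH]; cbn; [|rewrite IH]; ring. Qed.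

Lemma rsum_scal c f n : rsum (fun i => c * f i) n = c * rsum f n.
Proof. induction n as [|n IH]; cbn; [|rewrite IH]; ring. Qed.

Lemma rsum_plus f g n : rsum (fun i => f i + g i) n = rsum f n + rsum g n.
Proof. induction n as [|n IH]; cbn; [|rewrite IH]; ring. Qed.

Lemma csum_zero (f : nat -> C) n : (forall i, (i < n)%nat -> f i = 0%C) -> csum f n = 0%C.
Proof.
  induction n as [|n IH]; intros E; [easy|].
  cbn. rewrite IH by (intros; apply E; lia). rewrite E by lia. ring.
Qed.

Lemma rsum_zero f n : (forall i, (i < n)%nat -> f i = 0) -> rsum f n = 0.
Proof.
  induction n as [|n IH]; intros E; [easy|].
  cbn. rewrite IH by (intros; apply E; lia). rewrite E by lia. ring.
Qed.

Lemma csum_S_l f n : csum f (S n) = (f O + csum (fun i => f (S i)) n)%C.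
Proof.
  induction n as [|n IH]; [cbn; ring|].
  change (csum f (S (S n))) with (csum f (S n) + f (S n))%C.
  rewrite IH. cbn. ring.
Qed.

Lemma rsum_S_l f n : rsum f (S n) = f O + rsum (fun i => f (S i)) n.
Proof.
  induction n as [|n IH]; [cbn; ring|].
  change (rsum f (S (S n))) with (rsum f (S n) + f (S n)).
  rewrite IH. cbn. ring.
Qed.

Lemma csum_add f n k :
  csum f (n + k) = (csum f n + csum (fun i => f (n + i)%nat) k)%C.
Proof.
  induction k as [|k IH]; [rewrite Nat.add_0_r; cbn; ring|].
  rewrite Nat.add_succ_r. cbn. rewrite IH. ring.
Qed.

Lemma rsum_add f n k : rsum f (n + k) = rsum f n + rsum (fun i => f (n + i)%nat) k.
Proof.
  induction k as [|k IH]; [rewrite Nat.add_0_r; cbn; ring|].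
  rewrite Nat.add_succ_r. cbn. rewrite IH. ring.
Qed.

Lemma csum_exchange f n k :
  csum (fun i => csum (f i) k) n = csum (fun j => csum (fun i => f i j) n) k.
Proof.
  induction n as [|n IH]; cbn; [now rewrite csum_zero|].
  rewrite IH. rewrite csum_plus. reflexivity.
Qed.

Lemma rsum_exchange f n k :
  rsum (fun i => rsum (f i) k) n = rsum (fun j => rsum (fun i => f i j) n) k.
Proof.
  induction n as [|n IH]; cbn; [now rewrite rsum_zero|].
  rewrite IH. rewrite rsum_plus. reflexivity.
Qed.

Lemma rsum_le f g n :
  (forall i, (i < n)%nat -> f i <= g i) -> rsum f n <= rsum g n.
Proof.
  induction n as [|n IH]; intros H; cbn; [lra|].
  assert (rsum f n <= rsum g n) by (apply IH; intros; apply H; lia).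
  specialize (H n ltac:(lia)). lra.
Qed.

Lemma rsum_ge0 f n : (forall i, (i < n)%nat -> 0 <= f i) -> 0 <= rsum f n.
Proof.
  intros H. rewrite <- (rsum_zero (fun _ => 0) n) by easy. now apply rsum_le.
Qed.

Lemma rsum_mono f n k :
  (forall i, 0 <= f i) -> (n <= k)%nat -> rsum f n <= rsum f k.
Proof.
  intros H L. replace k with (n + (k - n))%nat by lia. rewrite rsum_add.
  assert (0 <= rsum (fun i => f (n + i)%nat) (k - n)) by (apply rsum_ge0; auto).
  lra.
Qed.

Lemma rsum_term f n : (forall i, 0 <= f i) -> f n <= rsum f (S n).
Proof. intros H. cbn. assert (0 <= rsum f n) by (apply rsum_ge0; auto). lra. Qed.

Lemma Cmod_csum f n : Cmod (csum f n) <= rsum (fun i => Cmod (f i)) n.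
Proof.
  induction n as [|n IH]; cbn; [rewrite Cmod_0; lra|].
  eapply Rle_trans; [apply Cmod_triangle|]. lra.
Qed.

Lemma csum_fst f n : fst (csum f n) = rsum (fun i => fst (f i)) n.
Proof. induction n as [|n IH]; cbn; [easy|]. now rewrite <- IH. Qed.

Lemma csum_snd f n : snd (csum f n) = rsum (fun i => snd (f i)) n.
Proof. induction n as [|n IH]; cbn; [easy|]. now rewrite <- IH. Qed.

Lemma csum_telescope f n : csum (fun i => f i - f (S i))%C n = (f O - f n)%C.
Proof. induction n as [|n IH]; cbn; [|rewrite IH]; ring. Qed.

Lemma sum_n_csum (f : nat -> C) n : sum_n f n = csum f (S n).
Proof.
  induction n as [|n IH]; [rewrite sum_O; cbn; ring|].
  rewrite sum_Sn, IH. reflexivity.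
Qed.

Lemma sum_n_rsum (f : nat -> R) n : sum_n f n = rsum f (S n).
Proof.
  induction n as [|n IH]; [rewrite sum_O; cbn; ring|].
  rewrite sum_Sn, IH. reflexivity.
Qed.

Lemma sum_1_csum (f : nat -> C) n : sum_n_m f 1 n = csum (fun i => f (S i)) n.
Proof.
  induction n as [|n IH]; [now rewrite sum_n_m_zero by lia|].
  rewrite sum_n_Sm by lia. now rewrite IH.
Qed.

Lemma sum_1_rsum (f : nat -> R) n : sum_n_m f 1 n = rsum (fun i => f (S i)) n.
Proof.
  induction n as [|n IH]; [now rewrite sum_n_m_zero by lia|].
  rewrite sum_n_Sm by lia. now rewrite IH.
Qed.

Lemma csum_blocks f m s :
  csum f (m * s) = csum (fun a => csum (fun l => f (m * l + a)%nat) s) m.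
Proof.
  induction s as [|s IH].
  - rewrite Nat.mul_0_r. cbn. symmetry. now apply csum_zero.
  - replace (m * S s)%nat with (m * s + m)%nat by lia.
    rewrite csum_add, IH. cbn. now rewrite csum_plus.
Qed.

Lemma Cmod_minus_sym x y : Cmod (x - y) = Cmod (y - x).
Proof. rewrite <- Cmod_opp. f_equal. ring. Qed.

Lemma Cmod_triangle3 x y z : Cmod (x - z) <= Cmod (x - y) + Cmod (y - z).
Proof. replace (x - z)%C with ((x - y) + (y - z))%C by ring. apply Cmod_triangle. Qed.

Lemma Cmod_triangle_inv x y : Cmod x - Cmod y <= Cmod (x - y).
Proof.
  assert (H := Cmod_triangle (x - y) y). replace (x - y + y)%C with x in H by ring. lra.
Qed.

Lemma im_le_Cmod (c : C) : Rabs (Im c) <= Cmod c.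
Proof. eapply Rle_trans; [apply Rmax_r|apply Rmax_Cmod]. Qed.

Lemma Cmod_le_components (c : C) : Cmod c <= Rabs (fst c) + Rabs (snd c).
Proof.
  replace c with (RtoC (fst c) + Ci * RtoC (snd c))%C at 1.
  - eapply Rle_trans; [apply Cmod_triangle|].
    rewrite Cmod_mult, Cmod_Ci, !Cmod_R. lra.
  - destruct c as [x y]. unfold Ci, RtoC, Cplus, Cmult. cbn. f_equal; ring.
Qed.

(** Stated as a real limit so that squeezing applies directly; [is_series_ccv] and [is_pseries_ccv]
    translate from the filters of the definitions. *)
Definition ccv (u : nat -> C) (l : C) : Prop :=
  is_lim_seq (fun n => Cmod (u n - l)) 0.

Lemma ccv_eps u l :
  ccv u l <-> (forall eps, 0 < eps -> exists N, forall n, (N <= n)%nat -> Cmod (u n - l) < eps).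
Proof.
  unfold ccv. rewrite <- is_lim_seq_spec. cbn. split.
  - intros H eps He. destruct (H (mkposreal eps He)) as [N HN]. exists N. intros n Hn.
    specialize (HN n Hn). cbn in HN. rewrite Rminus_0_r, Rabs_pos_eq in HN; [easy|apply Cmod_ge_0].
  - intros H eps. destruct (H eps (cond_pos eps)) as [N HN]. exists N. intros n Hn.
    rewrite Rminus_0_r, Rabs_pos_eq; [now apply HN|apply Cmod_ge_0].
Qed.

Lemma ccv_squeeze u l v :
  (forall n, Cmod (u n - l) <= v n) -> is_lim_seq v 0 -> ccv u l.
Proof.
  intros H Hv. apply is_lim_seq_le_le with (u := fun _ => 0) (w := v).
  - intros n. split; [apply Cmod_ge_0|apply H].
  - apply is_lim_seq_const.
  - exact Hv.
Qed.

Lemma ccv_ext u v l : (forall n, u n = v n) -> ccv u l -> ccv v l.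
Proof. intros E. apply is_lim_seq_ext. intros n. now rewrite E. Qed.

Lemma ccv_const l : ccv (fun _ => l) l.
Proof.
  apply ccv_squeeze with (v := fun _ => 0); [|apply is_lim_seq_const].
  intros _. replace (l - l)%C with (RtoC 0) by ring. rewrite Cmod_0. lra.
Qed.

Lemma lim0_plus (u v : nat -> R) :
  is_lim_seq u 0 -> is_lim_seq v 0 -> is_lim_seq (fun n => u n + v n) 0.
Proof.
  intros Hu Hv. replace (Finite 0) with (Finite (0 + 0)) by (f_equal; ring).
  now apply is_lim_seq_plus'.
Qed.

Lemma lim0_scal c (u : nat -> R) :
  is_lim_seq u 0 -> is_lim_seq (fun n => c * u n) 0.
Proof.
  intros Hu. replace (Finite 0) with (Rbar_mult c 0) by (cbn; f_equal; ring).
  now apply is_lim_seq_scal_l.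
Qed.

Lemma ccv_plus u v l k : ccv u l -> ccv v k -> ccv (fun n => u n + v n)%C (l + k).
Proof.
  intros Hu Hv. apply ccv_squeeze with (v := fun n => Cmod (u n - l) + Cmod (v n - k)).
  - intros n. replace (u n + v n - (l + k))%C with ((u n - l) + (v n - k))%C by ring.
    apply Cmod_triangle.
  - now apply lim0_plus.
Qed.

Lemma ccv_scal c u l : ccv u l -> ccv (fun n => c * u n)%C (c * l).
Proof.
  intros Hu. apply ccv_squeeze with (v := fun n => Cmod c * Cmod (u n - l)).
  - intros n. replace (c * u n - c * l)%C with (c * (u n - l))%C by ring.
    rewrite Cmod_mult. lra.
  - now apply lim0_scal.
Qed.

Lemma ccv_minus u v l k : ccv u l -> ccv v k -> ccv (fun n => u n - v n)%C (l - k).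
Proof.
  intros Hu Hv. replace (l - k)%C with (l + (-(1)) * k)%C by ring.
  eapply ccv_ext; [|apply ccv_plus; [exact Hu|apply (ccv_scal (-(1))), Hv]].
  intros n. cbn. ring.
Qed.

Lemma ccv_csum (u : nat -> nat -> C) l k :
  (forall i, (i < k)%nat -> ccv (u i) (l i)) ->
  ccv (fun n => csum (fun i => u i n) k) (csum l k).
Proof.
  induction k as [|k IH]; intros H; cbn; [apply ccv_const|].
  apply ccv_plus; [apply IH; intros; apply H; lia|apply H; lia].
Qed.

Lemma ccv_unique u l k : ccv u l -> ccv u k -> l = k.
Proof.
  intros Hl Hk. assert (H := lim0_plus _ _ Hl Hk).
  assert (H0 : is_lim_seq (fun _ : nat => Cmod (l - k)) 0).
  { eapply is_lim_seq_le_le; [|apply is_lim_seq_const|exact H]. intros n. cbn.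
    split; [apply Cmod_ge_0|]. rewrite (Cmod_minus_sym (u n) l). apply Cmod_triangle3. }
  apply is_lim_seq_unique in H0. rewrite Lim_seq_const in H0. injection H0 as H0.
  apply Cmod_eq_0 in H0. replace l with (l - k + k)%C by ring. rewrite H0. ring.
Qed.

Lemma ccv_shift u l k : ccv u l <-> ccv (fun n => u (n + k)%nat) l.
Proof. exact (is_lim_seq_incr_n (fun n => Cmod (u n - l)) k 0). Qed.

Lemma ccv_Cmod_le u l M : (forall n, Cmod (u n) <= M) -> ccv u l -> Cmod l <= M.
Proof.
  intros H Hu. apply (is_lim_seq_le (fun n => Cmod l - Cmod (u n - l)) (fun _ => M)
    (Cmod l) M).
  - intros n. specialize (H n). rewrite Cmod_minus_sym.
    assert (T := Cmod_triangle_inv l (u n)). assert (T2 := Cmod_triangle_inv l (l - u n)).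
    replace (l - (l - u n))%C with (u n) in T2 by ring. lra.
  - replace (Finite (Cmod l)) with (Finite (Cmod l - 0)) by (f_equal; ring).
    apply is_lim_seq_minus'; [apply is_lim_seq_const|exact Hu].
  - apply is_lim_seq_const.
Qed.

Lemma ccv_components u l :
  ccv u l <-> is_lim_seq (fun n => fst (u n)) (fst l) /\ is_lim_seq (fun n => snd (u n)) (snd l).
Proof.
  split.
  - intros H. split.
    + apply is_lim_seq_ext with (fun n => fst (u n - l)%C + fst l); [intros n; cbn; ring|].
      replace (Finite (fst l)) with (Finite (0 + fst l)) by (f_equal; ring).
      apply is_lim_seq_plus'; [|apply is_lim_seq_const].
      apply is_lim_seq_abs_0. eapply is_lim_seq_le_le; [|apply is_lim_seq_const|exact H].
      intros n. cbn. split; [apply Rabs_pos|]. apply (re_le_Cmod (u n - l)).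
    + apply is_lim_seq_ext with (fun n => snd (u n - l)%C + snd l); [intros n; cbn; ring|].
      replace (Finite (snd l)) with (Finite (0 + snd l)) by (f_equal; ring).
      apply is_lim_seq_plus'; [|apply is_lim_seq_const].
      apply is_lim_seq_abs_0. eapply is_lim_seq_le_le; [|apply is_lim_seq_const|exact H].
      intros n. cbn. split; [apply Rabs_pos|]. apply (im_le_Cmod (u n - l)).
  - intros [H1 H2].
    apply ccv_squeeze with (v := fun n => Rabs (fst (u n - l)%C) + Rabs (snd (u n - l)%C)).
    + intros n. apply Cmod_le_components.
    + apply lim0_plus; apply -> is_lim_seq_abs_0; cbn.
      * replace (Finite 0) with (Finite (fst l - fst l)) by (f_equal; ring).
        apply is_lim_seq_minus'; [exact H1|apply is_lim_seq_const].
      * replace (Finite 0) with (Finite (snd l - snd l)) by (f_equal; ring).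
        apply is_lim_seq_minus'; [exact H2|apply is_lim_seq_const].
Qed.

Lemma ccv_bounded u l : ccv u l -> exists M, 0 < M /\ forall n, Cmod (u n) <= M.
Proof.
  intros H. rewrite ccv_eps in H. destruct (H 1 ltac:(lra)) as [N HN].
  exists (rsum (fun n => Cmod (u n)) N + Cmod l + 1).
  assert (P0 : 0 <= rsum (fun n => Cmod (u n)) N) by (apply rsum_ge0; intros; apply Cmod_ge_0).
  assert (P1 := Cmod_ge_0 l). split; [lra|]. intros n.
  destruct (Nat.lt_ge_cases n N) as [L|L].
  - assert (T := rsum_term (fun n => Cmod (u n)) n (fun i => Cmod_ge_0 (u i))). cbn -[rsum] in T.
    assert (T2 := rsum_mono (fun n => Cmod (u n)) (S n) N (fun i => Cmod_ge_0 (u i)) L). lra.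
  - specialize (HN n L). assert (T := Cmod_triangle_inv (u n) l). lra.
Qed.

Lemma rsum_bounded_cv f M :
  (forall i, 0 <= f i) -> (forall n, rsum f n <= M) ->
  exists S : R, is_lim_seq (rsum f) S /\ S <= M /\ forall n, rsum f n <= S.
Proof.
  intros H0 HM. destruct (ex_finite_lim_seq_incr (rsum f) M) as [S HS].
  - intros n. cbn. specialize (H0 n). lra.
  - exact HM.
  - exists S. split; [exact HS|]. split.
    + apply (is_lim_seq_le (rsum f) (fun _ => M) S M HM HS). apply is_lim_seq_const.
    + apply is_lim_seq_incr_compare; [exact HS|]. intros n. cbn. specialize (H0 n). lra.
Qed.

Lemma csum_minus_initial f n k :
  (n <= k)%nat ->
  Cmod (csum f k - csum f n) <= rsum (fun i => Cmod (f i)) k - rsum (fun i => Cmod (f i)) n.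
Proof.
  intros L. replace k with (n + (k - n))%nat by lia. rewrite csum_add, rsum_add.
  replace (csum f n + csum (fun i => f (n + i)%nat) (k - n) - csum f n)%C
    with (csum (fun i => f (n + i)%nat) (k - n)) by ring.
  eapply Rle_trans; [apply Cmod_csum|]. lra.
Qed.

(** Blocks of the complex series are dominated by blocks of the bounded series of moduli, so both
    components are Cauchy. *)
Lemma abs_cv f M :
  (forall n, rsum (fun i => Cmod (f i)) n <= M) ->
  exists l, ccv (csum f) l.
Proof.
  intros HM.
  destruct (rsum_bounded_cv _ M (fun i => Cmod_ge_0 (f i)) HM) as (S & HS & _ & HSn).
  assert (Cau : forall eps : posreal, exists N, forall n k, (N <= n)%nat -> (N <= k)%nat ->
    Cmod (csum f n - csum f k) < eps).
  { rewrite <- is_lim_seq_spec in HS. cbn in HS. intros eps. destruct (HS eps) as [N HN]. exists N.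
    assert (A : forall n k, (N <= n)%nat -> (n <= k)%nat -> Cmod (csum f k - csum f n) < eps).
    { intros n k L1 L2. eapply Rle_lt_trans; [apply csum_minus_initial, L2|].
      specialize (HN n L1). specialize (HSn k). apply Rabs_def2 in HN. lra. }
    intros n k L1 L2. destruct (Nat.le_ge_cases n k) as [L|L].
    - rewrite Cmod_minus_sym. now apply A.
    - now apply A. }
  assert (C1 : ex_finite_lim_seq (fun n => fst (csum f n))).
  { apply ex_lim_seq_cauchy_corr. intros eps. destruct (Cau eps) as [N HN]. exists N.
    intros n k Hn Hk. eapply Rle_lt_trans; [|apply (HN n k Hn Hk)].
    apply (re_le_Cmod (csum f n - csum f k)). }
  assert (C2 : ex_finite_lim_seq (fun n => snd (csum f n))).
  { apply ex_lim_seq_cauchy_corr. intros eps. destruct (Cau eps) as [N HN]. exists N.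
    intros n k Hn Hk. eapply Rle_lt_trans; [|apply (HN n k Hn Hk)].
    apply (im_le_Cmod (csum f n - csum f k)). }
  destruct C1 as [x Hx], C2 as [y Hy]. exists (x, y). apply ccv_components. now split.
Qed.

Lemma is_series_ccv (f : nat -> C) l :
  is_series (K := C_AbsRing) (V := C_NormedModule) f l <-> ccv (csum f) l.
Proof.
  assert (E : forall u : nat -> C,
    filterlim u eventually (locally (T := C_UniformSpace) l) <-> ccv u l).
  { intros u. split.
    - intros H. apply ccv_components. split.
      + apply filterlim_comp with (1 := H). apply continuous_fst.
      + apply filterlim_comp with (1 := H). apply continuous_snd.
    - intros H. apply filterlim_locally. intros eps.
      rewrite ccv_eps in H. destruct (H eps (cond_pos eps)) as [N HN]. exists N.
      intros n Hn. apply C_NormedModule_mixin_compat1. now apply HN. }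
  unfold is_series.
  (* [sum_n f n] has n + 1 terms and [csum f n] has n, hence the shift by 1. *)
  rewrite (ccv_shift (csum f) l 1). rewrite <- E.
  split; apply filterlim_ext; intros n; rewrite Nat.add_1_r; [|symmetry]; apply sum_n_csum.
Qed.

Lemma pow_n_Cpow (z : C) n : pow_n (K := C_Ring) z n = (z ^ n)%C.
Proof. induction n as [|n IH]; cbn; [easy|]. now rewrite IH. Qed.

Lemma is_pseries_ccv (a : nat -> C) h l :
  is_pseries (K := C_AbsRing) (V := C_NormedModule) a h l
  <-> ccv (csum (fun k => a k * h ^ k)%C) l.
Proof.
  unfold is_pseries. rewrite is_series_ccv.
  assert (E : forall i, scal (K := C_AbsRing) (V := C_NormedModule) (pow_n h i) (a i)
    = (a i * h ^ i)%C).
  { intros i. rewrite (Cmult_comm (a i) (h ^ i)). exact (f_equal (fun x => (x * a i)%C) (pow_n_Cpow h i)). }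
  split; apply ccv_ext; intros n; apply csum_ext; intros i _; rewrite E; reflexivity.
Qed.

(** * Majorized power series *)

(** [M] bounds a weighted l^1 norm of the coefficients. This norm dominates the supremum on the
    closed disc ([amaj_bound]) and r times the derivative at the centre ([amaj_cder]), and it adds
    up over infinite series ([amaj_series]). *)
Definition amaj (f : C -> C) (z0 : C) (r M : R) : Prop :=
  exists a : nat -> C,
    (forall n, rsum (fun k => Cmod (a k) * r ^ k) n <= M) /\
    forall z, Cmod (z - z0) <= r -> ccv (csum (fun k => a k * (z - z0) ^ k)%C) (f z).

Lemma coef_term_le (a : nat -> C) h r n :
  Cmod h <= r ->
  rsum (fun k => Cmod (a k * h ^ k)%C) n <= rsum (fun k => Cmod (a k) * r ^ k) n.
Proof.
  intros Hh. apply rsum_le. intros k _. rewrite Cmod_mult, Cmod_pow.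
  apply Rmult_le_compat_l; [apply Cmod_ge_0|]. apply pow_incr. split; [apply Cmod_ge_0|easy].
Qed.

Lemma amaj_bound f z0 r M z : amaj f z0 r M -> Cmod (z - z0) <= r -> Cmod (f z) <= M.
Proof.
  intros (a & Ha & Hf) Hz. apply ccv_Cmod_le with (2 := Hf z Hz). intros n.
  eapply Rle_trans; [apply Cmod_csum|]. eapply Rle_trans; [apply coef_term_le, Hz|]. apply Ha.
Qed.

Lemma amaj_ext f g z0 r M :
  (forall z, Cmod (z - z0) <= r -> f z = g z) -> amaj f z0 r M -> amaj g z0 r M.
Proof.
  intros E (a & Ha & Hf). exists a. split; [exact Ha|]. intros z Hz. rewrite <- E by easy. auto.
Qed.

Lemma amaj_weaken f z0 r M M' : M <= M' -> amaj f z0 r M -> amaj f z0 r M'.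
Proof.
  intros L (a & Ha & Hf). exists a. split; [|easy]. intros n. specialize (Ha n). lra.
Qed.

Lemma amaj_shrink f z0 r r' M : 0 <= r' <= r -> amaj f z0 r M -> amaj f z0 r' M.
Proof.
  intros L (a & Ha & Hf). exists a. split.
  - intros n. eapply Rle_trans; [|apply (Ha n)]. apply rsum_le. intros k _.
    apply Rmult_le_compat_l; [apply Cmod_ge_0|]. now apply pow_incr.
  - intros z Hz. apply Hf. lra.
Qed.

Lemma amaj_plus f g z0 r M1 M2 :
  0 <= r ->
  amaj f z0 r M1 -> amaj g z0 r M2 -> amaj (fun z => f z + g z)%C z0 r (M1 + M2).
Proof.
  intros Hr (a & Ha & Hf) (b & Hb & Hg). exists (fun k => a k + b k)%C. split.
  - intros n. eapply Rle_trans; [|apply (Rplus_le_compat _ _ _ _ (Ha n) (Hb n))].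
    rewrite <- rsum_plus. apply rsum_le. intros k _. rewrite <- Rmult_plus_distr_r.
    apply Rmult_le_compat_r; [now apply pow_le|apply Cmod_triangle].
  - intros z Hz. eapply ccv_ext; [|apply ccv_plus; [now apply Hf|now apply Hg]].
    intros n. cbn. rewrite <- csum_plus. apply csum_ext. intros. ring.
Qed.

Lemma amaj_scal c f z0 r M :
  amaj f z0 r M -> amaj (fun z => c * f z)%C z0 r (Cmod c * M).
Proof.
  intros (a & Ha & Hf). exists (fun k => c * a k)%C. split.
  - intros n. rewrite (rsum_ext _ (fun k => Cmod c * (Cmod (a k) * r ^ k))).
    + rewrite rsum_scal. apply Rmult_le_compat_l; [apply Cmod_ge_0|apply Ha].
    + intros i _. rewrite Cmod_mult. ring.
  - intros z Hz. eapply ccv_ext; [|apply ccv_scal, Hf, Hz].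
    intros n. cbn. rewrite <- csum_scal. apply csum_ext. intros. ring.
Qed.

Lemma amaj_const c z0 r : amaj (fun _ => c) z0 r (Cmod c).
Proof.
  exists (fun k => match k with O => c | S _ => RtoC 0 end). split.
  - intros [|n]; [cbn; apply Cmod_ge_0|]. rewrite rsum_S_l, rsum_zero.
    + cbn. lra.
    + intros i _. rewrite Cmod_0. ring.
  - intros z _. apply (proj2 (ccv_shift _ _ 1)). eapply ccv_ext; [|apply ccv_const].
    intros n. cbn beta. rewrite Nat.add_1_r, csum_S_l, csum_zero; [cbn; ring|].
    intros i _. ring.
Qed.

(** Write z - c = (z0 - c) + (z - z0): the first part scales the coefficients, the second shifts
    them by one place and costs a factor r. *)
Lemma amaj_mul_linear f z0 r M c :
  0 <= r -> amaj f z0 r M ->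
  amaj (fun z => (z - c) * f z)%C z0 r ((Cmod (z0 - c) + r) * M).
Proof.
  intros Hr (a & Ha & Hf).
  pose (b := fun k => match k with O => RtoC 0 | S j => a j end).
  exists (fun k => (z0 - c) * a k + b k)%C. split.
  - intros n. apply Rle_trans with
      (Cmod (z0 - c) * rsum (fun k => Cmod (a k) * r ^ k) n + rsum (fun k => Cmod (b k) * r ^ k) n).
    + rewrite <- rsum_scal, <- rsum_plus. apply rsum_le. intros k _.
      rewrite <- Rmult_assoc, <- Cmod_mult, <- Rmult_plus_distr_r.
      apply Rmult_le_compat_r; [now apply pow_le|apply Cmod_triangle].
    + rewrite Rmult_plus_distr_r. apply Rplus_le_compat.
      * apply Rmult_le_compat_l; [apply Cmod_ge_0|apply Ha].
      * destruct n as [|n].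
        -- cbn. specialize (Ha O). cbn in Ha. nra.
        -- rewrite rsum_S_l. unfold b. rewrite Cmod_0.
           rewrite (rsum_ext _ (fun k => r * (Cmod (a k) * r ^ k))) by (intros; cbn; ring).
           rewrite rsum_scal. specialize (Ha n). nra.
  - intros z Hz. specialize (Hf z Hz). apply (proj2 (ccv_shift _ _ 1)).
    replace ((z - c) * f z)%C with ((z0 - c) * f z + (z - z0) * f z)%C by ring.
    eapply ccv_ext; [|apply ccv_plus; [apply ccv_scal, ((proj1 (ccv_shift _ _ 1)) Hf)|apply ccv_scal, Hf]].
    intros n. cbn beta. rewrite Nat.add_1_r.
    rewrite (csum_ext (fun k => ((z0 - c) * a k + b k) * (z - z0) ^ k)%C
      (fun k => (z0 - c) * (a k * (z - z0) ^ k) + b k * (z - z0) ^ k)%C) by (intros; ring).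
    rewrite csum_plus, csum_scal. f_equal.
    rewrite (csum_S_l (fun k => b k * _)%C). cbn [b]. rewrite <- csum_scal.
    rewrite Cmult_0_l, Cplus_0_l. apply csum_ext. intros. cbn [Cpow]. ring.
Qed.

(** With d = z0 - c the quotient has coefficients solving d q_k + q_(k-1) = a_k. Summing moduli
    gives |d| Q <= M + r Q for the weighted sums Q, hence Q <= M / (|d| - r). *)
Lemma amaj_div_linear f z0 r M c :
  0 <= r < Cmod (z0 - c) -> amaj f z0 r M ->
  amaj (fun z => f z / (z - c))%C z0 r (M / (Cmod (z0 - c) - r)).
Proof.
  intros [Hr Hc] (a & Ha & Hf). set (d := (z0 - c)%C) in *.
  assert (Hd : d <> 0%C) by (intros E; rewrite E, Cmod_0 in Hc; lra).
  pose (q := fix q k := match k with O => (a O / d)%C | S j => ((a (S j) - q j) / d)%C end).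
  assert (Hq : forall n, rsum (fun k => Cmod (q k) * r ^ k) n <= M / (Cmod d - r)).
  { assert (Q0 : forall n, 0 <= rsum (fun k => Cmod (q k) * r ^ k) n).
    { intros n. apply rsum_ge0. intros. apply Rmult_le_pos; [apply Cmod_ge_0|now apply pow_le]. }
    assert (Step : forall n, Cmod d * rsum (fun k => Cmod (q k) * r ^ k) (S n)
      <= rsum (fun k => Cmod (a k) * r ^ k) (S n) + r * rsum (fun k => Cmod (q k) * r ^ k) n).
    { intros n. rewrite !rsum_S_l.
      assert (E0 : Cmod d * Cmod (q O) = Cmod (a O)).
      { rewrite <- Cmod_mult. f_equal. cbn. field. exact Hd. }
      assert (rsum (fun k => Cmod d * (Cmod (q (S k)) * r ^ S k)) n
        <= rsum (fun k => Cmod (a (S k)) * r ^ S k) n + r * rsum (fun k => Cmod (q k) * r ^ k) n).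
      { rewrite <- rsum_scal, <- rsum_plus. apply rsum_le. intros k _.
        rewrite <- Rmult_assoc, <- Cmod_mult.
        replace (d * q (S k))%C with (a (S k) - q k)%C by (cbn; field; exact Hd).
        assert (T := Cmod_triangle (a (S k)) (- q k)). rewrite Cmod_opp in T.
        change (a (S k) + - q k)%C with (a (S k) - q k)%C in T.
        assert (P := pow_le r k Hr). cbn [pow].
        assert (P2 : 0 <= r * r ^ k) by nra. nra. }
      rewrite rsum_scal in H. rewrite !pow_O. lra. }
    assert (M0 : 0 <= M) by (specialize (Ha O); exact Ha).
    intros [|n].
    - cbn. apply Rmult_le_pos; [easy|]. left. apply Rinv_0_lt_compat. lra.
    - apply Rle_div_r; [lra|]. specialize (Step n). specialize (Ha (S n)).
      assert (L : rsum (fun k => Cmod (q k) * r ^ k) n <= rsum (fun k => Cmod (q k) * r ^ k) (S n)).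
      { apply rsum_mono; [|lia]. intros. apply Rmult_le_pos; [apply Cmod_ge_0|now apply pow_le]. }
      nra. }
  exists q. split; [exact Hq|]. intros z Hz.
  destruct (abs_cv (fun k => q k * (z - z0) ^ k)%C (M / (Cmod d - r))) as [l Hl].
  { intros n. eapply Rle_trans; [apply coef_term_le, Hz|apply Hq]. }
  assert (Hzc : (z - c)%C <> 0%C).
  { intros E. assert (T : d = (- (z - z0))%C).
    { replace (- (z - z0))%C with (d - (z - c))%C by (unfold d; ring). rewrite E. ring. }
    rewrite T, Cmod_opp in Hc. lra. }
  replace (f z / (z - c))%C with l; [exact Hl|].
  assert (El : ((z - c) * l)%C = f z).
  { apply (ccv_unique (csum (fun k => a k * (z - z0) ^ k)%C)); [|now apply Hf].
    apply (proj2 (ccv_shift _ _ 1)).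
    replace ((z - c) * l)%C with (d * l + (z - z0) * l)%C by (unfold d; ring).
    eapply ccv_ext; [|apply ccv_plus; [apply ccv_scal, ((proj1 (ccv_shift _ _ 1)) Hl)|apply ccv_scal, Hl]].
    intros n. cbn beta. rewrite Nat.add_1_r, !csum_S_l. rewrite Cmult_plus_distr_l.
    rewrite <- !csum_scal, <- Cplus_assoc, <- csum_plus. f_equal.
    - cbn. field. exact Hd.
    - apply csum_ext. intros i _. cbn. field. exact Hd. }
  rewrite <- El. field. exact Hzc.
Qed.

(** Fatou for series: for fixed n only finite sums are exchanged, and the bound persists as the
    number of rows tends to infinity. *)
Lemma double_series_bound (a : nat -> nat -> C) (b : nat -> C) r (M : nat -> R) S :
  0 < r ->
  (forall l n, rsum (fun k => Cmod (a l k) * r ^ k) n <= M l) ->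
  (forall n, rsum M n <= S) ->
  (forall k, ccv (csum (fun l => a l k)) (b k)) ->
  forall n, rsum (fun k => Cmod (b k) * r ^ k) n <= S.
Proof.
  intros Hr Ha HM Hb n.
  apply (is_lim_seq_le (fun L => rsum (fun k => Cmod (b k) * r ^ k) n
     - rsum (fun k => r ^ k * Cmod (csum (fun l => a l k) L - b k)) n) (fun _ => S)
     (rsum (fun k => Cmod (b k) * r ^ k) n) S).
  - intros L. apply Rle_trans with (rsum (fun l => rsum (fun k => Cmod (a l k) * r ^ k) n) L).
    + rewrite rsum_exchange. apply Rle_minus_l. rewrite <- rsum_plus. apply rsum_le. intros k _.
      assert (P := pow_lt r k Hr).
      assert (T := Cmod_triangle_inv (b k) (csum (fun l => a l k) L)). rewrite Cmod_minus_sym in T.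
      assert (T2 := Cmod_csum (fun l => a l k) L).
      rewrite (rsum_ext (fun i => Cmod (a i k) * r ^ k) (fun i => r ^ k * Cmod (a i k)))
        by (intros; ring).
      rewrite rsum_scal. nra.
    + apply Rle_trans with (2 := HM L). apply rsum_le. intros l _. apply Ha.
  - replace (Finite (rsum (fun k => Cmod (b k) * r ^ k) n))
      with (Finite (rsum (fun k => Cmod (b k) * r ^ k) n - 0)) by (f_equal; ring).
    apply is_lim_seq_minus'; [apply is_lim_seq_const|].
    induction n as [|n IH]; [apply is_lim_seq_const|].
    cbn [rsum]. apply lim0_plus; [exact IH|]. apply lim0_scal, Hb.
  - apply is_lim_seq_const.
Qed.

(** Weierstrass's double series theorem: the coefficients of F are the column sums of the array
    formed by the coefficients of the f_l. *)
Lemma amaj_series (f : nat -> C -> C) (F : C -> C) z0 r (M : nat -> R) S :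
  0 < r ->
  (forall l, amaj (f l) z0 r (M l)) ->
  (forall n, rsum M n <= S) ->
  (forall z, Cmod (z - z0) <= r -> ccv (csum (fun l => f l z)) (F z)) ->
  amaj F z0 r S.
Proof.
  intros Hr Hf HM HF.
  assert (X : exists a : nat -> nat -> C, forall l,
     (forall n, rsum (fun k => Cmod (a l k) * r ^ k) n <= M l) /\
     forall z, Cmod (z - z0) <= r -> ccv (csum (fun k => a l k * (z - z0) ^ k)%C) (f l z)).
  { exists (fun l => proj1_sig (constructive_indefinite_description _ (Hf l))).
    intros l. now destruct (constructive_indefinite_description _ (Hf l)). }
  destruct X as [a Ha].
  assert (M0 : forall l, 0 <= M l) by (intros l; apply (proj1 (Ha l) O)).
  assert (X : forall k, exists b, ccv (csum (fun l => a l k)) b).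
  { intros k. apply abs_cv with (S / r ^ k). intros n. assert (P := pow_lt r k Hr).
    apply Rle_div_r; [easy|]. rewrite Rmult_comm, <- rsum_scal.
    apply Rle_trans with (2 := HM n). apply rsum_le. intros l _.
    apply Rle_trans with (2 := proj1 (Ha l) (Datatypes.S k)).
    rewrite Rmult_comm. apply (rsum_term (fun k => Cmod (a l k) * r ^ k)).
    intros i. apply Rmult_le_pos; [apply Cmod_ge_0|apply pow_le; lra]. }
  assert (Y : exists b : nat -> C, forall k, ccv (csum (fun l => a l k)) (b k)).
  { exists (fun k => proj1_sig (constructive_indefinite_description _ (X k))).
    intros k. now destruct (constructive_indefinite_description _ (X k)). }
  clear X. destruct Y as [b Hb].
  exists b. split; [apply (double_series_bound a b r M S); auto; intros; apply Ha|].
  intros z Hz. apply ccv_eps. intros eps He.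
  destruct (rsum_bounded_cv M S M0 HM) as (T & HT & _ & HTn).
  assert (X : exists L, T - rsum M L < eps / 3).
  { rewrite <- is_lim_seq_spec in HT. cbn in HT.
    destruct (HT (mkposreal (eps / 3) ltac:(lra))) as [L HL]. exists L.
    specialize (HL L (le_n L)). cbn in HL. apply Rabs_def2 in HL. lra. }
  destruct X as [L HL].
  (* Three errors of eps / 3: the rows beyond L in the coefficients ([B1]), the truncation at n of
     the first L rows ([B2]), the rows beyond L in the values ([B3]). [B1] is uniform in n, so L can
     be fixed before n. *)
  assert (B1 : forall n, Cmod (csum (fun k => b k * (z - z0) ^ k)%C n
    - csum (fun k => csum (fun l => a l k) L * (z - z0) ^ k)%C n) < eps / 3).
  { intros n. rewrite <- csum_minus. eapply Rle_lt_trans; [|exact HL].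
    rewrite (csum_ext _ (fun k => (b k - csum (fun l => a l k) L) * (z - z0) ^ k)%C)
      by (intros; ring).
    eapply Rle_trans; [apply Cmod_csum|]. eapply Rle_trans; [apply coef_term_le, Hz|].
    apply (double_series_bound (fun l k => a (L + l)%nat k) _ r (fun l => M (L + l)%nat)); auto.
    - intros l. apply Ha.
    - intros k. specialize (HTn (L + k)%nat). rewrite rsum_add in HTn. lra.
    - intros k. apply ccv_ext with (fun n => csum (fun l => a l k) (n + L) - csum (fun l => a l k) L)%C.
      + intros j. rewrite Nat.add_comm, csum_add. ring.
      + apply ccv_minus; [|apply ccv_const]. apply -> (ccv_shift (csum (fun l => a l k)) (b k) L).
        apply Hb. }
  assert (B2 : exists N, forall n, (N <= n)%nat ->
    Cmod (csum (fun k => csum (fun l => a l k) L * (z - z0) ^ k)%C n - csum (fun l => f l z) L) < eps / 3).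
  { assert (X : ccv (fun n => csum (fun l => csum (fun k => a l k * (z - z0) ^ k)%C n) L)
      (csum (fun l => f l z) L)) by (apply ccv_csum; intros; now apply Ha).
    rewrite ccv_eps in X. destruct (X (eps / 3) ltac:(lra)) as [N HN]. exists N. intros n Hn.
    specialize (HN n Hn). rewrite csum_exchange in HN.
    rewrite (csum_ext _ (fun k => csum (fun l => a l k * (z - z0) ^ k)%C L)); [easy|].
    intros k _. rewrite Cmult_comm, <- csum_scal. apply csum_ext. intros; ring. }
  assert (B3 : Cmod (csum (fun l => f l z) L - F z) < eps / 3).
  { rewrite Cmod_minus_sym. eapply Rle_lt_trans; [|exact HL].
    assert (Hb' : forall l, Cmod (f l z) <= M l) by (intros l; apply (amaj_bound _ z0 r); auto).
    apply ccv_Cmod_le with (u := fun k => (csum (fun l => f l z) (k + L) - csum (fun l => f l z) L)%C).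
    - intros k. rewrite Nat.add_comm, csum_add.
      replace (_ + _ - _)%C with (csum (fun i => f (L + i)%nat z) k) by ring.
      eapply Rle_trans; [apply Cmod_csum|].
      specialize (HTn (L + k)%nat). rewrite rsum_add in HTn.
      apply Rle_trans with (rsum (fun i => M (L + i)%nat) k); [|lra]. apply rsum_le. auto.
    - apply ccv_minus; [|apply ccv_const].
      apply -> (ccv_shift (csum (fun l => f l z)) (F z) L). now apply HF. }
  destruct B2 as [N HN]. exists N. intros n Hn. specialize (B1 n). specialize (HN n Hn).
  assert (T1 := Cmod_triangle3 (csum (fun k => b k * (z - z0) ^ k)%C n)
    (csum (fun k => csum (fun l => a l k) L * (z - z0) ^ k)%C n) (F z)).
  assert (T2 := Cmod_triangle3 (csum (fun k => csum (fun l => a l k) L * (z - z0) ^ k)%C n)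
    (csum (fun l => f l z) L) (F z)). lra.
Qed.

(** * Complex derivatives *)

(** No quotient occurs, so z = z0 needs no exception and the rules of calculus are plain
    estimates. *)
Definition cder (f : C -> C) (z0 d : C) : Prop :=
  forall eps, 0 < eps -> exists delta, 0 < delta /\
    forall z, Cmod (z - z0) < delta ->
      Cmod (f z - f z0 - d * (z - z0)) <= eps * Cmod (z - z0).

Lemma cder_ext_loc f g z0 d rho :
  0 < rho -> (forall z, Cmod (z - z0) < rho -> f z = g z) -> cder f z0 d -> cder g z0 d.
Proof.
  intros Hrho E H eps He. destruct (H eps He) as (delta & Hd & Hdelta).
  exists (Rmin delta rho). split; [now apply Rmin_pos|]. intros z Hz.
  rewrite <- (E z), <- (E z0).
  - apply Hdelta. eapply Rlt_le_trans; [exact Hz|apply Rmin_l].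
  - replace (z0 - z0)%C with (RtoC 0) by ring. now rewrite Cmod_0.
  - eapply Rlt_le_trans; [exact Hz|apply Rmin_r].
Qed.

Lemma cder_ext f g z0 d : (forall z, f z = g z) -> cder f z0 d -> cder g z0 d.
Proof. intros E. apply cder_ext_loc with 1; [lra|auto]. Qed.

Lemma cder_const c z0 : cder (fun _ => c) z0 0.
Proof.
  intros eps He. exists 1. split; [lra|]. intros z _.
  replace (c - c - 0 * (z - z0))%C with (RtoC 0) by ring. rewrite Cmod_0.
  assert (P := Cmod_ge_0 (z - z0)). nra.
Qed.

Lemma cder_shift c z0 : cder (fun z => z + c)%C z0 1.
Proof.
  intros eps He. exists 1. split; [lra|]. intros z _.
  replace (z + c - (z0 + c) - 1 * (z - z0))%C with (RtoC 0) by ring. rewrite Cmod_0.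
  assert (P := Cmod_ge_0 (z - z0)). nra.
Qed.

Lemma cder_plus f g z0 d e :
  cder f z0 d -> cder g z0 e -> cder (fun z => f z + g z)%C z0 (d + e).
Proof.
  intros Hf Hg eps He.
  destruct (Hf (eps / 2) ltac:(lra)) as (d1 & P1 & H1).
  destruct (Hg (eps / 2) ltac:(lra)) as (d2 & P2 & H2).
  exists (Rmin d1 d2). split; [now apply Rmin_pos|]. intros z Hz.
  assert (Z1 := Rmin_l d1 d2). assert (Z2 := Rmin_r d1 d2).
  specialize (H1 z ltac:(lra)). specialize (H2 z ltac:(lra)).
  replace (f z + g z - (f z0 + g z0) - (d + e) * (z - z0))%C with
    ((f z - f z0 - d * (z - z0)) + (g z - g z0 - e * (z - z0)))%C by ring.
  eapply Rle_trans; [apply Cmod_triangle|]. lra.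
Qed.

Lemma cder_mult f g z0 d e :
  cder f z0 d -> cder g z0 e ->
  cder (fun z => f z * g z)%C z0 (d * g z0 + f z0 * e).
Proof.
  intros Hf Hg eps He.
  set (A := Cmod (f z0)). set (B := Cmod (g z0)). set (D := Cmod d). set (E := Cmod e).
  assert (A0 : 0 <= A) by apply Cmod_ge_0. assert (B0 : 0 <= B) by apply Cmod_ge_0.
  assert (D0 : 0 <= D) by apply Cmod_ge_0. assert (E0 : 0 <= E) by apply Cmod_ge_0.
  (* [K] dominates every norm in play. The tolerance [k] makes the linear errors ([R1]) and the
     products with [u] ([R3]) cost eps / 3 each; the bound [w] on the distance from z to z0 does the
     same for the quadratic term ([R2]). *)
  set (K := A + B + D + E + 2).
  assert (K0 : 2 <= K) by (unfold K; lra).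
  set (k := eps / (3 * K)).
  assert (k0 : 0 < k) by (apply Rdiv_lt_0_compat; lra).
  assert (kK : k * K = eps / 3) by (unfold k; field; lra).
  destruct (Hf k k0) as (d1 & P1 & H1).
  destruct (Hg (Rmin k 1)) as (d2 & P2 & H2); [apply Rmin_pos; lra|].
  set (w := eps / (3 * K * K)).
  assert (w0 : 0 < w) by (apply Rdiv_lt_0_compat; nra).
  assert (wK : w * K * K = eps / 3) by (unfold w; field; lra).
  exists (Rmin (Rmin 1 w) (Rmin d1 d2)).
  split; [apply Rmin_pos; apply Rmin_pos; lra|]. intros z Hz.
  assert (Z1 := Rmin_l (Rmin 1 w) (Rmin d1 d2)). assert (Z2 := Rmin_r (Rmin 1 w) (Rmin d1 d2)).
  assert (Z5 := Rmin_l 1 w). assert (Z6 := Rmin_r 1 w).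
  assert (Z3 := Rmin_l d1 d2). assert (Z4 := Rmin_r d1 d2).
  specialize (H1 z ltac:(lra)). specialize (H2 z ltac:(lra)).
  assert (M1 := Rmin_l k 1). assert (M2 := Rmin_r k 1).
  set (u := (f z - f z0 - d * (z - z0))%C) in *. set (v := (g z - g z0 - e * (z - z0))%C) in *.
  set (h := Cmod (z - z0)) in *. assert (h0 : 0 <= h) by apply Cmod_ge_0.
  replace (f z * g z - f z0 * g z0 - (d * g z0 + f z0 * e) * (z - z0))%C with
    (u * g z0 + ((f z0 * v) + ((d * (z - z0)) * (e * (z - z0) + v) + u * (e * (z - z0) + v))))%C
    by (unfold u, v; ring).
  assert (V : Cmod (e * (z - z0) + v) <= (E + 1) * h).
  { eapply Rle_trans; [apply Cmod_triangle|]. rewrite Cmod_mult. fold h E. nra. }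
  assert (V2 : Cmod v <= k * h) by nra.
  eapply Rle_trans; [apply Cmod_triangle|].
  eapply Rle_trans; [apply Rplus_le_compat_l, Cmod_triangle|].
  eapply Rle_trans; [apply Rplus_le_compat_l, Rplus_le_compat_l, Cmod_triangle|].
  rewrite !Cmod_mult. fold h A B D.
  assert (V0 := Cmod_ge_0 (e * (z - z0) + v)). assert (U0 := Cmod_ge_0 u).
  assert (W0 := Cmod_ge_0 v).
  assert (Q1 : Cmod u * B <= k * h * B) by nra.
  assert (Q2 : A * Cmod v <= A * (k * h)) by nra.
  assert (Q3 : D * h * Cmod (e * (z - z0) + v) <= D * h * ((E + 1) * h)).
  { apply Rmult_le_compat_l; [nra|exact V]. }
  assert (Q4 : Cmod u * Cmod (e * (z - z0) + v) <= k * h * ((E + 1) * h)).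
  { apply Rmult_le_compat; auto. }
  assert (R1 : k * h * B + A * (k * h) <= k * K * h).
  { replace (k * h * B + A * (k * h)) with (k * h * (A + B)) by ring.
    replace (k * K * h) with (k * h * K) by ring. apply Rmult_le_compat_l; [nra|]. unfold K; lra. }
  assert (R2 : D * h * ((E + 1) * h) <= w * K * K * h).
  { replace (D * h * ((E + 1) * h)) with (h * (D * (E + 1)) * h) by ring.
    apply Rmult_le_compat_r; [easy|]. rewrite Rmult_assoc. apply Rmult_le_compat; [easy|nra|lra|].
    apply Rmult_le_compat; [easy|lra|unfold K; lra|unfold K; lra]. }
  assert (R3 : k * h * ((E + 1) * h) <= k * K * h).
  { replace (k * K * h) with (k * h * K) by ring. apply Rmult_le_compat_l; [nra|].
    assert ((E + 1) * h <= E + 1) by nra. unfold K; lra. }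
  rewrite kK in *. rewrite wK in *. lra.
Qed.

Lemma Cmod_center z0 : Cmod (z0 - z0) = 0.
Proof. replace (z0 - z0)%C with (RtoC 0) by ring. apply Cmod_0. Qed.

Lemma amaj_nonneg f z0 r M : amaj f z0 r M -> 0 <= M.
Proof. intros (a & Ha & _). apply (Ha O). Qed.

(** In the tail, |z - z0|^k <= (|z - z0| / r)^p r^k. Used with p = 1 for the value at the centre, p
    = 2 for the derivative, and p just past the first nonzero coefficient for isolated zeros. *)
Lemma amaj_expansion f z0 r M p (a : nat -> C) :
  0 < r ->
  (forall n, rsum (fun k => Cmod (a k) * r ^ k) n <= M) ->
  (forall z, Cmod (z - z0) <= r -> ccv (csum (fun k => a k * (z - z0) ^ k)%C) (f z)) ->
  forall z, Cmod (z - z0) <= r ->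
    Cmod (f z - csum (fun k => a k * (z - z0) ^ k)%C p) <= M * (Cmod (z - z0) / r) ^ p.
Proof.
  intros Hr Ha Hf z Hz. set (h := Cmod (z - z0)) in *.
  assert (h0 : 0 <= h) by apply Cmod_ge_0.
  assert (q0 : 0 <= h / r <= 1).
  { split; [apply Rmult_le_pos; [easy|left; now apply Rinv_0_lt_compat]|].
    apply Rle_div_l; lra. }
  apply ccv_Cmod_le with
    (u := fun n => (csum (fun k => a k * (z - z0) ^ k) (n + p) - csum (fun k => a k * (z - z0) ^ k) p)%C).
  - intros n. rewrite Nat.add_comm, csum_add.
    replace (_ + _ - _)%C with (csum (fun i => a (p + i)%nat * (z - z0) ^ (p + i))%C n) by ring.
    eapply Rle_trans; [apply Cmod_csum|].
    apply Rle_trans with ((h / r) ^ p * rsum (fun i => Cmod (a (p + i)%nat) * r ^ (p + i)) n).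
    + rewrite <- rsum_scal. apply rsum_le. intros i _. rewrite Cmod_mult, Cmod_pow. fold h.
      rewrite (Rmult_comm ((h / r) ^ p)), Rmult_assoc. apply Rmult_le_compat_l; [apply Cmod_ge_0|].
      rewrite !pow_add. replace (h ^ p) with ((h / r) ^ p * r ^ p)
        by (rewrite <- Rpow_mult_distr; f_equal; field; lra).
      assert (h ^ i <= r ^ i) by (apply pow_incr; easy).
      assert (0 <= (h / r) ^ p) by (apply pow_le; lra).
      assert (0 <= r ^ p) by (apply pow_le; lra).
      assert (0 <= (h / r) ^ p * r ^ p) by now apply Rmult_le_pos. nra.
    + rewrite Rmult_comm. apply Rmult_le_compat_r; [apply pow_le; lra|].
      specialize (Ha (p + n)%nat). rewrite rsum_add in Ha.
      assert (0 <= rsum (fun k => Cmod (a k) * r ^ k) p); [|lra].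
      apply rsum_ge0. intros. apply Rmult_le_pos; [apply Cmod_ge_0|apply pow_le; lra].
  - apply ccv_minus; [|apply ccv_const].
    apply -> (ccv_shift (csum (fun k => a k * (z - z0) ^ k)%C) (f z) p). now apply Hf.
Qed.

Lemma pseries_cder f z0 r M (a : nat -> C) :
  0 < r ->
  (forall n, rsum (fun k => Cmod (a k) * r ^ k) n <= M) ->
  (forall z, Cmod (z - z0) <= r -> ccv (csum (fun k => a k * (z - z0) ^ k)%C) (f z)) ->
  cder f z0 (a 1%nat).
Proof.
  intros Hr Ha Hf eps He.
  assert (M0 : 0 <= M) by apply (Ha O).
  assert (E0 : f z0 = a O).
  { assert (T := amaj_expansion f z0 r M 1 a Hr Ha Hf z0).
    rewrite Cmod_center in T. specialize (T ltac:(lra)).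
    replace (M * (0 / r) ^ 1) with 0 in T by (field; lra).
    cbn in T. assert (T0 := Cmod_ge_0 (f z0 - (0 + a O * 1))).
    assert (T1 : (f z0 - (0 + a O * 1))%C = 0) by (apply Cmod_eq_0; lra).
    replace (f z0) with (f z0 - (0 + a O * 1) + a O)%C by ring. rewrite T1. ring. }
  set (K := M / (r * r) + 1).
  assert (KM : M / (r * r) <= K) by (unfold K; lra).
  assert (K1 : 1 <= K).
  { unfold K. assert (0 <= M / (r * r)); [|lra]. apply Rmult_le_pos; [easy|].
    left. apply Rinv_0_lt_compat. nra. }
  exists (Rmin r (eps / K)). split.
  { apply Rmin_pos; [easy|]. apply Rdiv_lt_0_compat; lra. }
  intros z Hz. assert (Z1 := Rmin_l r (eps / K)). assert (Z2 := Rmin_r r (eps / K)).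
  assert (T := amaj_expansion f z0 r M 2 a Hr Ha Hf z ltac:(lra)).
  rewrite E0. replace (f z - a O - a 1%nat * (z - z0))%C
    with (f z - csum (fun k => a k * (z - z0) ^ k) 2)%C by (cbn; ring).
  eapply Rle_trans; [exact T|]. set (h := Cmod (z - z0)) in *.
  assert (h0 : 0 <= h) by apply Cmod_ge_0.
  replace (M * (h / r) ^ 2) with (M / (r * r) * h * h) by (field; lra).
  apply Rmult_le_compat_r; [easy|].
  apply Rle_trans with (K * (eps / K)); [|right; field; lra].
  apply Rmult_le_compat; try lra. apply Rmult_le_pos; [easy|]. left. apply Rinv_0_lt_compat. nra.
Qed.

(** Stands in for Cauchy's estimate: |a_1| r is one term of a sum bounded by M. *)
Lemma amaj_cder f z0 r M :
  0 < r -> amaj f z0 r M -> exists d, cder f z0 d /\ Cmod d <= M / r.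
Proof.
  intros Hr (a & Ha & Hf). exists (a 1%nat). split; [now apply (pseries_cder f z0 r M)|].
  apply Rle_div_r; [easy|]. specialize (Ha 2%nat). cbn in Ha. rewrite !Rmult_1_r in Ha.
  assert (P := Cmod_ge_0 (a O)). lra.
Qed.

(** [C_derive] takes the limits of both components of the difference quotient along the horizontal
    line through z0, so a genuine complex derivative determines its value. *)
Lemma C_derive_cder f z0 d : cder f z0 d -> C_derive f z0 = d.
Proof.
  intros H.
  assert (A : forall eps, 0 < eps -> exists delta, 0 < delta /\ forall x, Rabs (x - fst z0) < delta ->
    x <> fst z0 ->
    Cmod ((f (x, snd z0) - f z0) / ((x, snd z0) - z0) - d)%C < eps).
  { intros eps He. destruct (H (eps / 2) ltac:(lra)) as (delta & Pd & Hd).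
    exists delta. split; [easy|]. intros x Hx Nx.
    assert (E : ((x, snd z0) - z0)%C = RtoC (x - fst z0)).
    { destruct z0 as [u v]. unfold RtoC, Cminus, Cplus, Copp. cbn. f_equal; ring. }
    assert (N0 : ((x, snd z0) - z0)%C <> 0%C).
    { rewrite E. intros F. apply RtoC_inj in F. lra. }
    specialize (Hd (x, snd z0)). rewrite E, Cmod_R in Hd. specialize (Hd Hx).
    replace ((f (x, snd z0) - f z0) / ((x, snd z0) - z0) - d)%C
      with ((f (x, snd z0) - f z0 - d * ((x, snd z0) - z0)) / ((x, snd z0) - z0))%C
      by (field; exact N0).
    rewrite Cmod_div by exact N0. rewrite E, Cmod_R.
    assert (P : 0 < Rabs (x - fst z0)) by (apply Rabs_pos_lt; lra).
    apply Rle_lt_trans with (eps / 2); [|lra]. apply Rle_div_l; lra. }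
  unfold C_derive, C_lim. rewrite (surjective_pairing d). f_equal.
  - rewrite (is_lim_unique _ _ (fst d)); [easy|]. apply is_lim_spec. intros eps.
    destruct (A eps (cond_pos eps)) as (delta & Pd & Hd). exists (mkposreal delta Pd).
    intros x Hx Nx. eapply Rle_lt_trans; [|apply (Hd x Hx Nx)].
    apply (re_le_Cmod ((f (x, snd z0) - f z0) / ((x, snd z0) - z0) - d)).
  - rewrite (is_lim_unique _ _ (snd d)); [easy|]. apply is_lim_spec. intros eps.
    destruct (A eps (cond_pos eps)) as (delta & Pd & Hd). exists (mkposreal delta Pd).
    intros x Hx Nx. eapply Rle_lt_trans; [|apply (Hd x Hx Nx)].
    apply (im_le_Cmod ((f (x, snd z0) - f z0) / ((x, snd z0) - z0) - d)).
Qed.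

Lemma cder_unique f z0 d e : cder f z0 d -> cder f z0 e -> d = e.
Proof. intros Hd He. rewrite <- (C_derive_cder f z0 d Hd). now apply C_derive_cder. Qed.

Lemma cder_scal c f z0 d : cder f z0 d -> cder (fun z => c * f z)%C z0 (c * d).
Proof.
  intros H. replace (c * d)%C with (0 * f z0 + c * d)%C by ring.
  apply (cder_mult (fun _ => c) f); [apply cder_const|exact H].
Qed.

Lemma cder_minus f g z0 d e :
  cder f z0 d -> cder g z0 e -> cder (fun z => f z - g z)%C z0 (d - e).
Proof.
  intros Hf Hg. replace (d - e)%C with (d + (-(1)) * e)%C by ring.
  eapply cder_ext; [|apply cder_plus; [exact Hf|apply (cder_scal (-(1))), Hg]].
  intros z. cbn. ring.
Qed.

Lemma cder_csum (f : nat -> C -> C) z0 (d : nat -> C) n :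
  (forall i, (i < n)%nat -> cder (f i) z0 (d i)) ->
  cder (fun z => csum (fun i => f i z) n) z0 (csum d n).
Proof.
  induction n as [|n IH]; intros H; cbn; [apply cder_const|].
  apply cder_plus; [apply IH; intros; apply H; lia|apply H; lia].
Qed.

(** * Analyticity, isolated zeros and uniqueness of coefficients *)

Lemma amaj_analytic f z0 r M : 0 < r -> amaj f z0 r M -> analytic_at f z0.
Proof.
  intros Hr (a & _ & Hf). exists a, r. split; [easy|]. intros z Hz.
  apply is_pseries_ccv. apply Hf. lra.
Qed.

Lemma ccv_sum_term f l : ccv (csum f) l -> ccv f 0.
Proof.
  intros H. replace (RtoC 0) with (l - l)%C by ring.
  apply ccv_ext with (fun n => csum f (n + 1) - csum f n)%C.
  - intros n. rewrite Nat.add_1_r. cbn. ring.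
  - apply ccv_minus; [|exact H]. now apply -> (ccv_shift (csum f) l 1).
Qed.

Lemma rsum_geom_le q n : 0 <= q < 1 -> rsum (fun k => q ^ k) n <= / (1 - q).
Proof.
  intros Hq. apply Rmult_le_reg_r with (1 - q); [lra|]. rewrite Rinv_l by lra.
  assert (E : rsum (fun k => q ^ k) n * (1 - q) = 1 - q ^ n).
  { induction n as [|n IH]; cbn; [ring|]. rewrite Rmult_plus_distr_r, IH. ring. }
  rewrite E. assert (0 <= q ^ n) by (apply pow_le; lra). lra.
Qed.

(** Abel's lemma, by comparison with the geometric series of ratio s / r. *)
Lemma bounded_terms_abs_cv (a : nat -> C) r M s :
  0 <= s < r -> (forall k, Cmod (a k) * r ^ k <= M) ->
  forall n, rsum (fun k => Cmod (a k) * s ^ k) n <= M / (1 - s / r).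
Proof.
  intros Hs HM n.
  assert (Hq : 0 <= s / r < 1).
  { split; [apply Rmult_le_pos; [lra|left; apply Rinv_0_lt_compat; lra]|].
    apply Rlt_div_l; lra. }
  assert (M0 : 0 <= M).
  { apply Rle_trans with (2 := HM O). cbn. assert (T := Cmod_ge_0 (a O)). lra. }
  apply Rle_trans with (M * rsum (fun k => (s / r) ^ k) n).
  - rewrite <- rsum_scal. apply rsum_le. intros k _.
    replace (s ^ k) with (r ^ k * (s / r) ^ k) by (rewrite <- Rpow_mult_distr; f_equal; field; lra).
    rewrite <- Rmult_assoc. apply Rmult_le_compat_r; [apply pow_le; lra|apply HM].
  - apply Rmult_le_compat_l; [easy|]. now apply rsum_geom_le.
Qed.

(** Convergence at the single point z0 + r/2 bounds the terms there, hence gives absolute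
    convergence on the disc of radius r/4. *)
Lemma analytic_amaj f z0 : analytic_at f z0 -> exists r M, 0 < r /\ amaj f z0 r M.
Proof.
  intros (a & r & Hr & Hf).
  assert (Ez : Cmod (z0 + RtoC (r / 2) - z0) = r / 2).
  { replace (z0 + RtoC (r / 2) - z0)%C with (RtoC (r / 2)) by ring.
    rewrite Cmod_R. apply Rabs_pos_eq. lra. }
  assert (H := Hf (z0 + RtoC (r / 2))%C ltac:(rewrite Ez; lra)).
  apply is_pseries_ccv in H. apply ccv_sum_term in H.
  destruct (ccv_bounded _ _ H) as (M & M0 & HM).
  exists (r / 4), (M / (1 - (r / 4) / (r / 2))). split; [lra|]. exists a. split.
  - apply bounded_terms_abs_cv; [lra|]. intros k. specialize (HM k).
    cbn beta in HM. rewrite Cmod_mult, Cmod_pow, Ez in HM. exact HM.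
  - intros z Hz. apply is_pseries_ccv. apply Hf. lra.
Qed.

(** If a_p is the first nonzero coefficient, a zero at distance h gives |a_p| h^p <= M (h/r)^(p+1),
    which fails for small h > 0. *)
Lemma pseries_isolated_zero f z0 r M (a : nat -> C) p :
  0 < r ->
  (forall n, rsum (fun k => Cmod (a k) * r ^ k) n <= M) ->
  (forall z, Cmod (z - z0) <= r -> ccv (csum (fun k => a k * (z - z0) ^ k)%C) (f z)) ->
  a p <> 0%C ->
  exists rho, 0 < rho /\ forall z, 0 < Cmod (z - z0) < rho -> f z <> 0%C.
Proof.
  intros Hr Ha Hf Hp.
  assert (Hmin : exists p, a p <> 0%C /\ forall k, (k < p)%nat -> a k = 0%C).
  { induction p as [p IH] using (well_founded_induction lt_wf).
    destruct (classic (exists k, (k < p)%nat /\ a k <> 0%C)) as [(k & L & Hk)|N].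
    - now apply (IH k).
    - exists p. split; [easy|]. intros k L. apply NNPP. intros F. apply N. now exists k. }
  clear p Hp. destruct Hmin as (p & Hp0 & Hmin).
  assert (M0 : 0 <= M) by apply (Ha O).
  assert (A0 : 0 < Cmod (a p)) by now apply Cmod_gt_0.
  assert (rp := pow_lt r (S p) Hr).
  exists (Rmin r (Cmod (a p) * r ^ (S p) / (M + 1))). split.
  { apply Rmin_pos; [easy|]. apply Rdiv_lt_0_compat; [now apply Rmult_lt_0_compat|lra]. }
  intros z [Hz1 Hz2] F.
  assert (R1 := Rmin_l r (Cmod (a p) * r ^ (S p) / (M + 1))).
  assert (R2 := Rmin_r r (Cmod (a p) * r ^ (S p) / (M + 1))).
  assert (T := amaj_expansion f z0 r M (S p) a Hr Ha Hf z ltac:(lra)).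
  rewrite F in T. cbn [csum] in T. rewrite csum_zero in T.
  2:{ intros i Hi. rewrite Hmin by easy. ring. }
  replace (0 - (0 + a p * (z - z0) ^ p))%C with (- (a p * (z - z0) ^ p))%C in T by ring.
  rewrite Cmod_opp, Cmod_mult, Cmod_pow in T. set (h := Cmod (z - z0)) in *.
  assert (hp := pow_lt h p Hz1).
  replace (M * (h / r) ^ S p) with (M * h / r ^ (S p) * h ^ p) in T.
  2:{ unfold Rdiv. rewrite Rpow_mult_distr, pow_inv. cbn [pow]. ring. }
  apply Rmult_le_reg_r in T; [|easy]. apply Rle_div_r in T; [|easy].
  assert (h * (M + 1) < Cmod (a p) * r ^ S p) by (apply Rlt_div_r; lra). nra.
Qed.

Lemma amaj_zero_or_nonzero f z0 r M :
  0 < r -> amaj f z0 r M ->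
  exists rho, 0 < rho /\
    ((forall z, Cmod (z - z0) < rho -> f z = 0%C)
     \/ (forall z, 0 < Cmod (z - z0) < rho -> f z <> 0%C)).
Proof.
  intros Hr (a & Ha & Hf).
  destruct (classic (exists p, a p <> 0%C)) as [[p Hp]|Hp].
  - destruct (pseries_isolated_zero f z0 r M a p Hr Ha Hf Hp) as (rho & Hrho & H).
    exists rho. auto.
  - exists r. split; [easy|]. left. intros z Hz.
    apply (ccv_unique (csum (fun k => a k * (z - z0) ^ k)%C)); [apply Hf; lra|].
    eapply ccv_ext; [|apply ccv_const]. intros n. cbn. symmetry. apply csum_zero.
    intros i _. replace (a i) with (RtoC 0); [ring|]. symmetry. apply NNPP. intros F. apply Hp. now exists i.
Qed.

(** Only small positive t are compared, which fits generating functions of a real variable. The sum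
    [F] of the difference series, extended to a complex disc, would have zeros accumulating at 0. *)
Lemma pseries_unique (a b : nat -> C) r :
  0 < r ->
  (forall t, 0 < t < r -> exists l,
     ccv (csum (fun k => a k * RtoC t ^ k)%C) l /\ ccv (csum (fun k => b k * RtoC t ^ k)%C) l) ->
  forall k, a k = b k.
Proof.
  intros Hr H p. apply NNPP. intros Hp. pose (c := fun k => (a k - b k)%C).
  assert (Hc : forall t, 0 < t < r -> ccv (csum (fun k => c k * RtoC t ^ k)%C) 0).
  { intros t Ht. destruct (H t Ht) as (l & H1 & H2).
    replace (RtoC 0) with (l - l)%C by ring. eapply ccv_ext; [|apply (ccv_minus _ _ _ _ H1 H2)].
    intros n. cbn. rewrite <- csum_minus. apply csum_ext. intros i _. unfold c. ring. }
  destruct (ccv_bounded _ _ (ccv_sum_term _ _ (Hc (r / 2) ltac:(lra)))) as (M & M0 & HM).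
  assert (Hb := bounded_terms_abs_cv c (r / 2) M (r / 4) ltac:(lra)).
  assert (HM' : forall k, Cmod (c k) * (r / 2) ^ k <= M).
  { intros k. specialize (HM k). cbn beta in HM.
    rewrite Cmod_mult, Cmod_pow, Cmod_R, Rabs_pos_eq in HM by lra. exact HM. }
  specialize (Hb HM').
  pose (F := fun z => epsilon (inhabits (RtoC 0)) (fun l => ccv (csum (fun k => c k * (z - 0) ^ k)%C) l)).
  assert (HF : forall z, Cmod (z - 0) <= r / 4 -> ccv (csum (fun k => c k * (z - 0) ^ k)%C) (F z)).
  { intros z Hz. unfold F.
    apply (epsilon_spec _ (fun l => ccv (csum (fun k => c k * (z - 0) ^ k)%C) l)).
    apply abs_cv with (M / (1 - r / 4 / (r / 2))). intros n.
    eapply Rle_trans; [apply coef_term_le, Hz|]. apply Hb. }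
  destruct (pseries_isolated_zero F 0 (r / 4) _ c p ltac:(lra) Hb HF) as (rho & Hrho & N).
  { intros E. apply Hp. replace (a p) with (c p + b p)%C by (unfold c; ring). rewrite E. ring. }
  set (t := Rmin rho (r / 4) / 2). assert (S1 := Rmin_l rho (r / 4)). assert (S2 := Rmin_r rho (r / 4)).
  assert (S3 : 0 < Rmin rho (r / 4)) by (apply Rmin_pos; lra).
  assert (Ct : Cmod (RtoC t - 0) = t).
  { replace (RtoC t - 0)%C with (RtoC t) by ring. rewrite Cmod_R. apply Rabs_pos_eq. unfold t. lra. }
  apply (N (RtoC t)); [rewrite Ct; unfold t; lra|].
  apply (ccv_unique (csum (fun k => c k * (RtoC t - 0) ^ k)%C)); [apply HF; rewrite Ct; unfold t; lra|].
  replace (RtoC t - 0)%C with (RtoC t) by ring. apply Hc. unfold t. lra.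
Qed.

(** * Identity theorem for meromorphic functions *)

Lemma amaj_mul_pow f z0 r M k :
  0 <= r -> amaj f z0 r M -> exists M', amaj (fun z => (z - z0) ^ k * f z)%C z0 r M'.
Proof.
  intros Hr Hf. induction k as [|k [M' IH]].
  - exists M. eapply amaj_ext; [|exact Hf]. intros z _. cbn. ring.
  - eexists. eapply amaj_ext; [|apply (amaj_mul_linear _ z0 r M' z0 Hr IH)].
    intros z _. cbn. ring.
Qed.

Lemma meromorphic_local f z0 :
  meromorphic f -> exists k F r M, 0 < r /\ amaj F z0 r M /\
    forall z, 0 < Cmod (z - z0) < r -> f z = (F z / (z - z0) ^ k)%C.
Proof.
  intros H. destruct (H z0) as [A|(k & g & r & Hk & A & _ & Hr & E)].
  - destruct (analytic_amaj f z0 A) as (r & M & Hr & HM). exists O, f, r, M.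
    split; [easy|]. split; [easy|]. intros z _. cbn. field.
  - destruct (analytic_amaj g z0 A) as (r' & M & Hr' & HM). exists k, g, (Rmin r r'), M.
    assert (L1 := Rmin_l r r'). assert (L2 := Rmin_r r r').
    repeat split.
    + now apply Rmin_pos.
    + apply amaj_shrink with r'; [|easy]. split; [apply Rmin_glb; lra|easy].
    + intros z Hz. apply E. lra.
Qed.

Lemma C_minus_nz (z z0 : C) : 0 < Cmod (z - z0) -> (z - z0)%C <> 0%C.
Proof. intros H E. rewrite E, Cmod_0 in H. lra. Qed.

Lemma C_minus_eq0 (a b : C) : (a - b)%C = 0%C -> a = b.
Proof. intros E. replace a with (a - b + b)%C by ring. rewrite E. ring. Qed.

(** Multiplying the difference by the powers of z - z0 that clear both poles makes it analytic near
    z0, where zeros are isolated or fill a disc. *)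
Lemma meromorphic_dichotomy f g z0 :
  meromorphic f -> meromorphic g ->
  exists rho, 0 < rho /\
    ((forall z, 0 < Cmod (z - z0) < rho -> f z = g z)
     \/ (forall z, 0 < Cmod (z - z0) < rho -> f z <> g z)).
Proof.
  intros Hf Hg.
  destruct (meromorphic_local f z0 Hf) as (k & F & r1 & M1 & Hr1 & HF & Ef).
  destruct (meromorphic_local g z0 Hg) as (l & G & r2 & M2 & Hr2 & HG & Eg).
  set (r := Rmin r1 r2). assert (Hr : 0 < r) by now apply Rmin_pos.
  assert (L1 : r <= r1) by apply Rmin_l. assert (L2 : r <= r2) by apply Rmin_r.
  destruct (amaj_mul_pow F z0 r M1 l) as [M1' HF']; [lra|apply amaj_shrink with r1; [lra|easy]|].
  destruct (amaj_mul_pow G z0 r M2 k) as [M2' HG']; [lra|apply amaj_shrink with r2; [lra|easy]|].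
  assert (HD := amaj_plus _ _ _ _ _ _ (Rlt_le _ _ Hr) HF' (amaj_scal (-(1)) _ _ _ _ HG')).
  destruct (amaj_zero_or_nonzero _ _ _ _ Hr HD) as (rho & Hrho & Hdich).
  exists (Rmin rho r). split; [now apply Rmin_pos|].
  assert (R1 := Rmin_l rho r). assert (R2 := Rmin_r rho r).
  destruct Hdich as [D|D]; [left|right]; intros z Hz;
    assert (Nz := C_minus_nz z z0 (proj1 Hz)); rewrite (Ef z), (Eg z) by lra.
  - specialize (D z ltac:(lra)). cbn beta in D.
    assert (E : ((z - z0) ^ l * F z)%C = ((z - z0) ^ k * G z)%C)
      by (apply C_minus_eq0; rewrite <- D; ring).
    assert (N1 := Cpow_nz _ k Nz). assert (N2 := Cpow_nz _ l Nz).
    replace (F z / (z - z0) ^ k)%C with ((z - z0) ^ l * F z / ((z - z0) ^ k * (z - z0) ^ l))%C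
      by (field; auto).
    rewrite E. field; auto.
  - intros E. apply (D z); [lra|].
    assert (N1 := Cpow_nz _ k Nz). assert (N2 := Cpow_nz _ l Nz).
    replace (F z) with (F z / (z - z0) ^ k * (z - z0) ^ k)%C by (field; auto).
    rewrite E. field; auto.
Qed.

(* Along the real line, the truth value of "f = g on a punctured neighbourhood
   of x" is locally constant by the dichotomy, hence constant. *)
Lemma meromorphic_identity f g (x0 : R) rho0 :
  meromorphic f -> meromorphic g -> 0 < rho0 ->
  (forall z, 0 < Cmod (z - RtoC x0) < rho0 -> f z = g z) ->
  forall x : R, exists rho, 0 < rho /\
    forall z, 0 < Cmod (z - RtoC x) < rho -> f z = g z.
Proof.
  intros Hf Hg Hrho0 H0.
  pose (A := fun x : R => exists rho, 0 < rho /\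
    forall z, 0 < Cmod (z - RtoC x) < rho -> f z = g z).
  pose (phi := fun x : R => if excluded_middle_informative (A x) then 1 else 0).
  assert (Loc : forall x, exists rho, 0 < rho /\ forall y, Rabs (y - x) < rho -> phi y = phi x).
  { intros x. destruct (meromorphic_dichotomy f g (RtoC x) Hf Hg) as (rho & Hrho & D).
    exists rho. split; [easy|]. intros y Hy.
    destruct (Req_dec y x) as [->|Nyx]; [easy|].
    (* With this radius the disc about y stays inside the punctured disc about x. *)
    set (eta := Rmin (Rabs (y - x)) (rho - Rabs (y - x))).
    assert (P : 0 < Rabs (y - x)) by (apply Rabs_pos_lt; lra).
    assert (Heta : 0 < eta) by (apply Rmin_pos; lra).
    assert (E1 : eta <= Rabs (y - x)) by apply Rmin_l.
    assert (E2 : eta <= rho - Rabs (y - x)) by apply Rmin_r.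
    assert (In : forall z, Cmod (z - RtoC y) < eta -> 0 < Cmod (z - RtoC x) < rho).
    { intros z Hz. assert (Eyx : Cmod (RtoC y - RtoC x) = Rabs (y - x))
        by (rewrite <- RtoC_minus; apply Cmod_R).
      assert (T1 := Cmod_triangle3 z (RtoC y) (RtoC x)).
      assert (T2 := Cmod_triangle3 (RtoC y) z (RtoC x)). rewrite (Cmod_minus_sym _ z) in T2. lra. }
    unfold phi. destruct D as [D|D].
    - destruct (excluded_middle_informative (A y)) as [_|N].
      + destruct (excluded_middle_informative (A x)) as [_|N]; [easy|].
        exfalso. apply N. now exists rho.
      + exfalso. apply N. exists eta. split; [easy|]. intros z Hz. apply D, In. lra.
    - destruct (excluded_middle_informative (A y)) as [Ay|_].
      + exfalso. destruct Ay as (s & Hs & Es).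
        set (t := Rmin s eta / 2). assert (S1 := Rmin_l s eta). assert (S2 := Rmin_r s eta).
        assert (S3 : 0 < Rmin s eta) by now apply Rmin_pos.
        assert (Ct : Cmod (RtoC y + RtoC t - RtoC y) = t).
        { replace (RtoC y + RtoC t - RtoC y)%C with (RtoC t) by ring. rewrite Cmod_R.
          apply Rabs_pos_eq. unfold t. lra. }
        apply (D (RtoC y + RtoC t)%C); [apply In|apply Es]; rewrite Ct; unfold t; lra.
      + destruct (excluded_middle_informative (A x)) as [Ax|_]; [|easy].
        exfalso. destruct Ax as (s & Hs & Es).
        set (t := Rmin s rho / 2). assert (S1 := Rmin_l s rho). assert (S2 := Rmin_r s rho).
        assert (S3 : 0 < Rmin s rho) by now apply Rmin_pos.
        assert (Ct : Cmod (RtoC x + RtoC t - RtoC x) = t).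
        { replace (RtoC x + RtoC t - RtoC x)%C with (RtoC t) by ring. rewrite Cmod_R.
          apply Rabs_pos_eq. unfold t. lra. }
        apply (D (RtoC x + RtoC t)%C); [|apply Es]; rewrite Ct; unfold t; lra. }
  assert (Der : forall x, is_derive phi x 0).
  { intros x. destruct (Loc x) as (rho & Hrho & E).
    apply is_derive_ext_loc with (fun _ => phi x); [|apply (is_derive_const (phi x) x)].
    exists (mkposreal rho Hrho). intros y Hy. symmetry. apply E. exact Hy. }
  assert (Const : forall a b, a < b -> phi a = phi b).
  { intros a b L. apply (eq_is_derive phi a b); [|easy]. intros t _. apply Der. }
  assert (A0 : phi x0 = 1).
  { unfold phi. destruct (excluded_middle_informative (A x0)) as [_|N]; [easy|].
    exfalso. apply N. now exists rho0. }
  intros x. change (A x).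
  assert (Px : phi x = 1).
  { destruct (Rtotal_order x x0) as [L|[->|L]]; [|easy|].
    - now rewrite (Const x x0).
    - now rewrite <- (Const x0 x). }
  unfold phi in Px. destruct (excluded_middle_informative (A x)); [easy|lra].
Qed.

Lemma amaj_eq_center f g z0 r1 M1 r2 M2 rho :
  0 < r1 -> 0 < r2 -> amaj f z0 r1 M1 -> amaj g z0 r2 M2 -> 0 < rho ->
  (forall z, 0 < Cmod (z - z0) < rho -> f z = g z) -> f z0 = g z0.
Proof.
  intros Hr1 Hr2 Hf Hg Hrho E.
  set (r := Rmin r1 r2). assert (Hr : 0 < r) by now apply Rmin_pos.
  assert (L1 : r <= r1) by apply Rmin_l. assert (L2 : r <= r2) by apply Rmin_r.
  assert (HF : amaj f z0 r M1) by (apply amaj_shrink with r1; [lra|easy]).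
  assert (HG : amaj g z0 r M2) by (apply amaj_shrink with r2; [lra|easy]).
  assert (HD := amaj_plus _ _ _ _ _ _ (Rlt_le _ _ Hr) HF (amaj_scal (-(1)) _ _ _ _ HG)).
  destruct (amaj_zero_or_nonzero _ _ _ _ Hr HD) as (s & Hs & [D|D]).
  - specialize (D z0). rewrite Cmod_center in D. specialize (D Hs). cbn beta in D.
    apply C_minus_eq0. rewrite <- D. ring.
  - exfalso. set (t := Rmin s rho / 2). assert (S1 := Rmin_l s rho). assert (S2 := Rmin_r s rho).
    assert (S3 : 0 < Rmin s rho) by now apply Rmin_pos.
    assert (Ct : Cmod (z0 + RtoC t - z0) = t).
    { replace (z0 + RtoC t - z0)%C with (RtoC t) by ring. rewrite Cmod_R.
      apply Rabs_pos_eq. unfold t. lra. }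
    apply (D (z0 + RtoC t)%C); [rewrite Ct; unfold t; lra|].
    rewrite E by (rewrite Ct; unfold t; lra). ring.
Qed.

(** The functions agree near x, off x. A pole of g, written G / (z-x)^k with k > 0, would make G
    equal to (z-x)^k f there, so G(x) = 0, a contradiction. Hence g is analytic at x and takes the
    same value there too. *)
Lemma meromorphic_cder_eq f g (x0 x : R) rho0 d :
  meromorphic f -> meromorphic g -> 0 < rho0 ->
  (forall z, 0 < Cmod (z - RtoC x0) < rho0 -> f z = g z) ->
  analytic_at f (RtoC x) -> cder f (RtoC x) d -> cder g (RtoC x) d.
Proof.
  intros Hf Hg Hrho0 H0 Af Hd.
  destruct (meromorphic_identity f g x0 rho0 Hf Hg Hrho0 H0 x) as (rho & Hrho & E).
  destruct (analytic_amaj f _ Af) as (r1 & M1 & Hr1 & HM1).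
  assert (Ex : f (RtoC x) = g (RtoC x)).
  { destruct (Hg (RtoC x)) as [Ag|(k & G & r & Hk & AG & NG & Hr & EG)].
    - destruct (analytic_amaj g _ Ag) as (r2 & M2 & Hr2 & HM2).
      now apply (amaj_eq_center f g _ r1 M1 r2 M2 rho).
    - exfalso. apply NG.
      destruct (analytic_amaj G _ AG) as (r2 & M2 & Hr2 & HM2).
      destruct (amaj_mul_pow f (RtoC x) r1 M1 k ltac:(lra) HM1) as [M1' HM1'].
      rewrite (amaj_eq_center G (fun z => (z - RtoC x) ^ k * f z)%C _ r2 M2 r1 M1' (Rmin rho r)); auto.
      + destruct k as [|k]; [lia|]. cbn. ring.
      + now apply Rmin_pos.
      + intros z Hz. assert (S1 := Rmin_l rho r). assert (S2 := Rmin_r rho r).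
        rewrite E by lra. rewrite EG by lra.
        assert (N1 := Cpow_nz _ k (C_minus_nz _ _ (proj1 Hz))). field. exact N1. }
  apply cder_ext_loc with f rho; auto. intros z Hz.
  destruct (classic (z = RtoC x)) as [->|N]; [easy|]. apply E. split; [|easy].
  apply Cmod_gt_0. intros F. apply N. now apply C_minus_eq0.
Qed.

(** [epsilon] returns some continuation as soon as one exists; the identity theorem gives it the
    derivative of the explicit [L]. *)
Lemma C_derive_L_function chi L (x : R) d :
  is_L_function chi L -> analytic_at L (RtoC x) -> cder L (RtoC x) d ->
  C_derive (L_function chi) (RtoC x) = d.
Proof.
  intros HL A Hd. apply C_derive_cder.
  assert (HL2 : is_L_function chi (L_function chi)).
  { exact (epsilon_spec _ (is_L_function chi) (ex_intro _ L HL)). }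
  (* The disc of radius 1 about 3 lies in Re z > 1, where both functions are the sum of the
     series. *)
  apply (meromorphic_cder_eq L (L_function chi) 3 x 1 d); auto; try apply HL; try apply HL2; [lra|].
  intros z Hz.
  assert (Rz : 1 < Re z).
  { assert (T := re_le_Cmod (z - RtoC 3)).
    replace (Re (z - RtoC 3)) with (Re z - 3) in T by (unfold Re; cbn; ring).
    assert (T2 : Rabs (Re z - 3) < 1) by lra. apply Rabs_def2 in T2. lra. }
  destruct HL as [_ HL]. destruct HL2 as [_ HL2].
  apply (ccv_unique _ _ _ (proj1 (is_series_ccv _ _) (HL z Rz)) (proj1 (is_series_ccv _ _) (HL2 z Rz))).
Qed.

(** * Exponential and binomial series *)

Lemma CV_radius_gt (a : nat -> R) r M t :
  (forall n, Rabs (a n) * r ^ n <= M) -> 0 < r -> Rabs t < r -> Rbar_lt (Rabs t) (CV_radius a).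
Proof.
  intros H Hr Ht. apply Rbar_lt_le_trans with r; [exact Ht|].
  apply (proj1 (CV_radius_bounded a)). exists M. intros n.
  rewrite Rabs_mult, <- RPow_abs, (Rabs_pos_eq r) by lra. apply H.
Qed.

Lemma ccv_PSeries (c : nat -> C) t :
  ex_pseries (fun k => fst (c k)) t -> ex_pseries (fun k => snd (c k)) t ->
  ccv (csum (fun k => c k * RtoC t ^ k)%C)
    (PSeries (fun k => fst (c k)) t, PSeries (fun k => snd (c k)) t).
Proof.
  intros H1 H2. apply PSeries_correct, is_pseries_R in H1. apply PSeries_correct, is_pseries_R in H2.
  assert (G : forall f : nat -> R, forall l, is_series f l -> is_lim_seq (rsum f) l).
  { intros f l Hf. apply (is_lim_seq_incr_1 (rsum f)). apply is_lim_seq_ext with (sum_n f); [apply sum_n_rsum|].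
    exact Hf. }
  apply ccv_components. cbn [fst snd]. split.
  - eapply is_lim_seq_ext; [|apply (G _ _ H1)]. intros n. rewrite csum_fst. apply rsum_ext.
    intros k _. rewrite <- RtoC_pow. cbn. ring.
  - eapply is_lim_seq_ext; [|apply (G _ _ H2)]. intros n. rewrite csum_snd. apply rsum_ext.
    intros k _. rewrite <- RtoC_pow. cbn. ring.
Qed.

Lemma zero_derivative_constant (h : R -> R) r :
  (forall t, Rabs t < r -> is_derive h t 0) -> forall t, Rabs t < r -> h t = h 0.
Proof.
  intros H t Ht. apply Rabs_def2 in Ht. destruct (Rtotal_order t 0) as [L|[->|L]]; [|easy|].
  - apply (eq_is_derive h t 0); [|easy]. intros s Hs. apply H. apply Rabs_def1; lra.
  - symmetry. apply (eq_is_derive h 0 t); [|easy]. intros s Hs. apply H. apply Rabs_def1; lra.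
Qed.

(* The recursion says that F = sum c_k t^k solves (1 + kappa t) F' = w F,
   F(0) = 1, so that F exp(- w theta) has derivative zero. *)
Lemma ode_pseries (c : nat -> C) r M (w : C) kappa (theta : R -> R) :
  0 < r ->
  (forall n, rsum (fun k => Cmod (c k) * r ^ k) n <= M) ->
  c O = 1%C ->
  (forall k, RtoC (INR (S k)) * c (S k) + RtoC (kappa * INR k) * c k = w * c k)%C ->
  theta 0 = 0 ->
  (forall t, Rabs t < r -> 1 + kappa * t <> 0) ->
  (forall t, Rabs t < r -> is_derive theta t (/ (1 + kappa * t))) ->
  forall t, Rabs t < r ->
    ccv (csum (fun k => c k * RtoC t ^ k)%C) (Cexp (w * RtoC (theta t))).
Proof.
  intros Hr Hc c0 Hrec th0 Hk Hth.
  set (a := fun k => fst (c k)). set (b := fun k => snd (c k)).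
  assert (Tc : forall k, Cmod (c k) * r ^ k <= M).
  { intros k. apply Rle_trans with (2 := Hc (S k)). apply (rsum_term (fun k => Cmod (c k) * r ^ k)).
    intros i. apply Rmult_le_pos; [apply Cmod_ge_0|apply pow_le; lra]. }
  assert (Ra : forall t, Rabs t < r -> Rbar_lt (Rabs t) (CV_radius a)).
  { intros t Ht. apply CV_radius_gt with r M; auto. intros k. apply Rle_trans with (2 := Tc k).
    apply Rmult_le_compat_r; [apply pow_le; lra|]. apply (re_le_Cmod (c k)). }
  assert (Rb : forall t, Rabs t < r -> Rbar_lt (Rabs t) (CV_radius b)).
  { intros t Ht. apply CV_radius_gt with r M; auto. intros k. apply Rle_trans with (2 := Tc k).
    apply Rmult_le_compat_r; [apply pow_le; lra|]. apply (im_le_Cmod (c k)). }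
  set (u := PSeries a). set (v := PSeries b).
  set (p := fst w). set (q := snd w).
  assert (Eq : forall t, Rabs t < r ->
    (1 + kappa * t) * PSeries (PS_derive a) t = p * u t - q * v t /\
    (1 + kappa * t) * PSeries (PS_derive b) t = p * v t + q * u t).
  { intros t Ht.
    assert (xa := CV_radius_inside a t (Ra t Ht)). assert (xb := CV_radius_inside b t (Rb t Ht)).
    assert (xda := ex_pseries_derive a t (Ra t Ht)). assert (xdb := ex_pseries_derive b t (Rb t Ht)).
    assert (S : forall (x : nat -> R) y, ex_pseries x t -> ex_pseries (PS_scal y x) t).
    { intros x y Hx. apply ex_pseries_scal; [apply Rmult_comm|exact Hx]. }
    assert (D : forall x : nat -> R, ex_pseries (PS_derive x) t ->
       (1 + kappa * t) * PSeries (PS_derive x) t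
       = PSeries (PS_plus (PS_derive x) (PS_scal kappa (PS_incr_1 (PS_derive x)))) t).
    { intros x Hx. rewrite PSeries_plus, PSeries_scal, PSeries_incr_1; [ring|exact Hx|].
      apply S. now apply ex_pseries_incr_1. }
    assert (K : forall (x : nat -> R) k, PS_plus (PS_derive x) (PS_scal kappa (PS_incr_1 (PS_derive x))) k
      = INR (Datatypes.S k) * x (Datatypes.S k) + kappa * INR k * x k).
    { intros x k. unfold PS_plus, PS_scal, PS_derive, PS_incr_1, plus, scal. cbn [AbelianMonoid.plus].
      destruct k as [|k]; cbn -[INR]; unfold mult; cbn -[INR]; [|ring].
      change (INR 0) with 0. unfold zero. cbn -[INR]. ring. }
    unfold u, v. split.
    - rewrite (D a xda).
      replace (p * PSeries a t - q * PSeries b t) with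
        (PSeries (PS_plus (PS_scal p a) (PS_scal (- q) b)) t).
      + apply PSeries_ext. intros k. rewrite K. specialize (Hrec k). apply (f_equal fst) in Hrec.
        unfold PS_plus, PS_scal, plus, scal. cbn -[INR] in *. unfold mult. cbn -[INR].
        unfold a, b, p, q. ring_simplify in Hrec. ring_simplify. lra.
      + rewrite PSeries_plus, !PSeries_scal by auto. ring.
    - rewrite (D b xdb).
      replace (p * PSeries b t + q * PSeries a t) with
        (PSeries (PS_plus (PS_scal p b) (PS_scal q a)) t).
      + apply PSeries_ext. intros k. rewrite K. specialize (Hrec k). apply (f_equal snd) in Hrec.
        unfold PS_plus, PS_scal, plus, scal. cbn -[INR] in *. unfold mult. cbn -[INR].
        unfold a, b, p, q. ring_simplify in Hrec. ring_simplify. lra.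
      + rewrite PSeries_plus, !PSeries_scal by auto. ring. }
  assert (Du : forall t, Rabs t < r -> is_derive u t ((p * u t - q * v t) / (1 + kappa * t))).
  { intros t Ht. replace ((p * u t - q * v t) / (1 + kappa * t)) with (PSeries (PS_derive a) t).
    - now apply is_derive_PSeries, Ra.
    - rewrite <- (proj1 (Eq t Ht)). field. now apply Hk. }
  assert (Dv : forall t, Rabs t < r -> is_derive v t ((p * v t + q * u t) / (1 + kappa * t))).
  { intros t Ht. replace ((p * v t + q * u t) / (1 + kappa * t)) with (PSeries (PS_derive b) t).
    - now apply is_derive_PSeries, Rb.
    - rewrite <- (proj2 (Eq t Ht)). field. now apply Hk. }
  assert (u0 : u 0 = 1) by (unfold u; rewrite PSeries_0; unfold a; now rewrite c0).
  assert (v0 : v 0 = 0) by (unfold v; rewrite PSeries_0; unfold b; now rewrite c0).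
  (* Real and imaginary parts of F exp(- w theta), with F = u + i v and w = p + i q. *)
  set (h1 := fun t => exp (- p * theta t) * (u t * cos (q * theta t) + v t * sin (q * theta t))).
  set (h2 := fun t => exp (- p * theta t) * (v t * cos (q * theta t) - u t * sin (q * theta t))).
  assert (H1 : forall t, Rabs t < r -> h1 t = h1 0).
  { apply zero_derivative_constant. intros t Ht. unfold h1. auto_derive.
    - repeat split; try (eexists; now eauto).
    - rewrite (is_derive_unique (fun x : R => theta x) _ _ (Hth t Ht)),
        (is_derive_unique (fun x : R => u x) _ _ (Du t Ht)),
        (is_derive_unique (fun x : R => v x) _ _ (Dv t Ht)). field. now apply Hk. }
  assert (H2 : forall t, Rabs t < r -> h2 t = h2 0).
  { apply zero_derivative_constant. intros t Ht. unfold h2. auto_derive.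
    - repeat split; try (eexists; now eauto).
    - rewrite (is_derive_unique (fun x : R => theta x) _ _ (Hth t Ht)),
        (is_derive_unique (fun x : R => u x) _ _ (Du t Ht)),
        (is_derive_unique (fun x : R => v x) _ _ (Dv t Ht)). field. now apply Hk. }
  intros t Ht.
  specialize (H1 t Ht). specialize (H2 t Ht). unfold h1, h2 in H1, H2.
  rewrite th0, !Rmult_0_r, exp_0, cos_0, sin_0, u0, v0 in H1, H2.
  replace (Cexp (w * RtoC (theta t))) with (u t, v t).
  { apply ccv_PSeries; apply CV_radius_inside; auto. }
  replace (w * RtoC (theta t))%C with ((p * theta t, q * theta t) : C).
  2:{ unfold p, q, RtoC, Cmult. cbn. f_equal; ring. }
  unfold Cexp. cbn [Re Im fst snd].
  set (E := exp (p * theta t)).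
  assert (EE : E * exp (- p * theta t) = 1).
  { unfold E. rewrite <- exp_plus. replace (p * theta t + - p * theta t) with 0 by ring. apply exp_0. }
  set (co := cos (q * theta t)) in *. set (si := sin (q * theta t)) in *.
  assert (CS : co * co + si * si = 1).
  { assert (T := sin2_cos2 (q * theta t)). unfold Rsqr in T. fold co si in T. lra. }
  (* These two equations say that (u, v), rotated by - q theta, is (E, 0); inverting the rotation
     gives u = E co and v = E si. *)
  assert (A1 : u t * co + v t * si = E).
  { apply (f_equal (Rmult E)) in H1. rewrite <- Rmult_assoc, EE in H1. lra. }
  assert (A2 : v t * co - u t * si = 0).
  { apply (f_equal (Rmult E)) in H2. rewrite <- Rmult_assoc, EE in H2. lra. }
  f_equal.
  - rewrite <- A1. replace (u t) with (u t * (co * co + si * si)) at 1 by (rewrite CS; ring).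
    replace ((u t * co + v t * si) * co) with (u t * (co * co) + si * (v t * co)) by ring.
    replace (v t * co) with (u t * si) by lra. ring.
  - rewrite <- A1. replace (v t) with (v t * (co * co + si * si)) at 1 by (rewrite CS; ring).
    replace ((u t * co + v t * si) * si) with (v t * (si * si) + co * (u t * si)) by ring.
    replace (u t * si) with (v t * co) by lra. ring.
Qed.

Lemma rsum_exp_le x n : 0 <= x -> rsum (fun k => x ^ k / INR (fact k)) n <= exp x.
Proof.
  intros Hx. assert (H := is_exp_Reals x). apply is_pseries_R in H.
  assert (P : forall k, 0 <= x ^ k / INR (fact k)).
  { intros k. apply Rmult_le_pos; [now apply pow_le|]. left. apply Rinv_0_lt_compat, INR_fact_lt_0. }
  apply Rle_trans with (sum_n (fun k => / INR (fact k) * x ^ k) n).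
  - rewrite sum_n_rsum. rewrite (rsum_ext _ (fun k => x ^ k / INR (fact k)) (S n)).
    + apply rsum_mono; [exact P|lia].
    + intros i _. unfold Rdiv. ring.
  - apply is_lim_seq_incr_compare; [exact H|]. intros k. rewrite sum_Sn.
    specialize (P (S k)). unfold plus. cbn -[fact INR pow]. unfold Rdiv in P. lra.
Qed.

(** The case kappa = 0 of the differential equation, theta(t) = t, evaluated at t = 1 inside the
    radius 2. *)
Lemma ccv_Cexp z : ccv (csum (fun k => z ^ k / RtoC (INR (fact k)))%C) (Cexp z).
Proof.
  assert (H := ode_pseries (fun k => z ^ k / RtoC (INR (fact k)))%C 2 (exp (Cmod z * 2)) z 0
    (fun t => t)).
  assert (F : forall k, RtoC (INR (fact k)) <> 0%C).
  { intros k E. apply RtoC_inj in E. now apply (INR_fact_neq_0 k). }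
  replace (Cexp z) with (Cexp (z * RtoC 1)) by (f_equal; ring).
  eapply ccv_ext; [|apply (H ltac:(lra)) with (t := 1)].
  - intros n. apply csum_ext. intros i _. rewrite Cpow_1_l. ring.
  - intros n. rewrite (rsum_ext _ (fun k => (Cmod z * 2) ^ k / INR (fact k))).
    + apply rsum_exp_le. assert (T := Cmod_ge_0 z). lra.
    + intros k _. rewrite Cmod_div, Cmod_pow, Cmod_R, Rabs_pos_eq, Rpow_mult_distr by (auto; apply pos_INR).
      unfold Rdiv. ring.
  - cbn. field.
  - intros k. rewrite Rmult_0_l, Cmult_0_l, Cplus_0_r. rewrite fact_simpl, mult_INR, RtoC_mult. cbn [Cpow].
    field. split; [apply F|]. intros E. apply RtoC_inj in E. now apply (not_0_INR (S k)).
  - reflexivity.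
  - intros t _. lra.
  - intros t _. replace (/ (1 + 0 * t)) with 1 by (field; lra). apply (is_derive_id t).
  - rewrite Rabs_R1. lra.
Qed.

(** * Rising factorials and the binomial series *)

Fixpoint poch (z : C) (k : nat) : C :=
  match k with O => 1%C | S j => (poch z j * (z + RtoC (INR j)))%C end.

(** Majorizes |(z)_k| for all |z| <= c at once. *)
Fixpoint rpoch (c : R) (k : nat) : R :=
  match k with O => 1 | S j => rpoch c j * (c + INR j) end.

Lemma rpoch_nonneg c k : 0 <= c -> 0 <= rpoch c k.
Proof.
  intros Hc. induction k as [|k IH]; cbn -[INR]; [lra|].
  apply Rmult_le_pos; [easy|]. assert (T := pos_INR k). lra.
Qed.

Lemma Cmod_poch_le z c k : Cmod z <= c -> Cmod (poch z k) <= rpoch c k.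
Proof.
  intros Hz. induction k as [|k IH]; cbn -[INR]; [rewrite Cmod_1; lra|].
  rewrite Cmod_mult. apply Rmult_le_compat; try apply Cmod_ge_0; [easy|].
  eapply Rle_trans; [apply Cmod_triangle|]. rewrite Cmod_R, Rabs_pos_eq by apply pos_INR. lra.
Qed.

Lemma poch_add z k i : poch z (k + i) = (poch z k * poch (z + RtoC (INR k)) i)%C.
Proof.
  induction i as [|i IH]; [rewrite Nat.add_0_r; cbn; ring|].
  rewrite Nat.add_succ_r. cbn -[INR]. rewrite IH, plus_INR, RtoC_plus. ring.
Qed.

Lemma rpoch_add c k i : rpoch c (k + i) = rpoch c k * rpoch (c + INR k) i.
Proof.
  induction i as [|i IH]; [rewrite Nat.add_0_r; cbn; ring|].
  rewrite Nat.add_succ_r. cbn -[INR]. rewrite IH, plus_INR. ring.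
Qed.

(** From N on, the partial sum up to k plus f_k / (1 - q) does not increase. *)
Lemma rsum_ratio_bounded (f : nat -> R) q N :
  0 <= q < 1 -> (forall k, 0 <= f k) -> (forall k, (N <= k)%nat -> f (S k) <= q * f k) ->
  exists M, forall n, rsum f n <= M.
Proof.
  intros Hq H0 Hstep. exists (rsum f N + f N / (1 - q)).
  assert (P : 0 <= f N / (1 - q)).
  { apply Rmult_le_pos; [apply H0|]. left. apply Rinv_0_lt_compat. lra. }
  assert (A : forall i, rsum f (N + i) + f (N + i)%nat / (1 - q) <= rsum f N + f N / (1 - q)).
  { induction i as [|i IH]; [rewrite Nat.add_0_r; lra|].
    rewrite Nat.add_succ_r. cbn. specialize (Hstep (N + i)%nat ltac:(lia)).
    eapply Rle_trans; [|exact IH]. rewrite Rplus_assoc. apply Rplus_le_compat_l.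
    apply Rle_trans with (f (N + i)%nat + q * f (N + i)%nat / (1 - q)).
    - apply Rplus_le_compat_l. apply Rmult_le_compat_r; [left; apply Rinv_0_lt_compat; lra|easy].
    - right. field. lra. }
  intros n. destruct (Nat.le_ge_cases n N) as [L|L].
  - assert (T := rsum_mono f n N H0 L). lra.
  - specialize (A (n - N)%nat). replace (N + (n - N))%nat with n in A by lia.
    assert (0 <= f n / (1 - q)); [|lra].
    apply Rmult_le_pos; [apply H0|]. left. apply Rinv_0_lt_compat. lra.
Qed.

(** The radius 3/4 leaves room above 1/2, the largest |y / X| when |y| <= h and X >= 2 h. For k >= N
    > 6 c the ratio of consecutive terms is at most (7/6)(3/4) = 7/8. *)
Lemma rpoch_series_bounded c :
  0 <= c -> exists M, forall n, rsum (fun k => rpoch c k / INR (fact k) * (3 / 4) ^ k) n <= M.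
Proof.
  intros Hc. destruct (INR_unbounded (6 * c)) as [N HN].
  apply rsum_ratio_bounded with (7 / 8) N; [lra| |].
  - intros k. apply Rmult_le_pos; [|apply pow_le; lra].
    apply Rmult_le_pos; [now apply rpoch_nonneg|]. left. apply Rinv_0_lt_compat, INR_fact_lt_0.
  - intros k L. apply le_INR in L. assert (P := rpoch_nonneg c k Hc).
    rewrite fact_simpl, mult_INR, S_INR. cbn -[INR fact].
    assert (F := INR_fact_lt_0 k). assert (K := pos_INR k).
    replace (rpoch c k * (c + INR k) / ((INR k + 1) * INR (fact k)) * (3 / 4 * (3 / 4) ^ k))
      with ((c + INR k) / (INR k + 1) * (3 / 4) * (rpoch c k / INR (fact k) * (3 / 4) ^ k))
      by (field; lra).
    apply Rmult_le_compat_r.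
    + apply Rmult_le_pos; [|apply pow_le; lra].
      apply Rmult_le_pos; [easy|]. left. now apply Rinv_0_lt_compat.
    + apply Rle_trans with (7 / 6 * (3 / 4)); [|lra]. apply Rmult_le_compat_r; [lra|].
      apply Rle_div_l; lra.
Qed.

(** The case kappa = 1 of the differential equation, with theta(t) = ln (1 + t) and w = - z. *)
Lemma ccv_binomial z t :
  Rabs t < 3 / 4 ->
  ccv (csum (fun k => poch z k / RtoC (INR (fact k)) * RtoC (- t) ^ k)%C)
    (Rpos_Cpower (1 + t) (- z)).
Proof.
  intros Ht.
  destruct (rpoch_series_bounded (Cmod z) (Cmod_ge_0 z)) as [M HM].
  assert (F : forall k, RtoC (INR (fact k)) <> 0%C).
  { intros k E. apply RtoC_inj in E. now apply (INR_fact_neq_0 k). }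
  assert (H := ode_pseries (fun k => poch z k / RtoC (INR (fact k)) * RtoC (Ropp 1) ^ k)%C (3 / 4) M (- z) 1
    (fun t => ln (1 + t))).
  unfold Rpos_Cpower. eapply ccv_ext; [|apply (H ltac:(lra))].
  - intros n. apply csum_ext. intros i _. replace (- t) with (Ropp 1 * t) by ring.
    rewrite RtoC_mult, Cpow_mult_l. ring.
  - intros n. apply Rle_trans with (2 := HM n). apply rsum_le. intros k _.
    rewrite Cmod_mult, Cmod_div, Cmod_pow, !Cmod_R by auto.
    rewrite Rabs_Ropp, Rabs_R1, pow1, Rmult_1_r, (Rabs_pos_eq (INR (fact k))) by apply pos_INR.
    apply Rmult_le_compat_r; [apply pow_le; lra|].
    apply Rmult_le_compat_r; [left; apply Rinv_0_lt_compat, INR_fact_lt_0|]. apply Cmod_poch_le. lra.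
  - cbn. field.
  - intros k. rewrite Rmult_1_l. rewrite fact_simpl, mult_INR, RtoC_mult. cbn -[INR fact]. rewrite (RtoC_opp 1).
    field. split; [apply F|]. intros E. apply RtoC_inj in E. now apply (not_0_INR (S k)).
  - now rewrite Rplus_0_r, ln_1.
  - intros s Hs. apply Rabs_def2 in Hs. lra.
  - intros s Hs. apply Rabs_def2 in Hs. auto_derive; [lra|]. field. lra.
  - exact Ht.
Qed.

(** * Bernoulli-type coefficients *)

(** Each b_j needs all earlier values, so the structural recursion builds tables: [g n] is the
    solution up to n, [G] says that later tables do not revise it, and the solution is the
    diagonal. *)
Lemma convolution_inverse (c d : nat -> R) :
  d O <> 0 -> exists b : nat -> R, forall j, rsum (fun k => b k * d (j - k)%nat) (S j) = c j.
Proof.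
  intros Hd.
  pose (g := fix g n : nat -> R := match n with
    | O => fun _ => c O / d O
    | S j => fun k => if Nat.leb k j then g j k
        else (c (S j) - rsum (fun i => g j i * d (S j - i)%nat) (S j)) / d O end).
  assert (G : forall n k, (k <= n)%nat -> g n k = g k k).
  { induction n as [|n IH]; intros k L; [now replace k with O by lia|].
    destruct (Nat.eq_dec k (S n)) as [->|N]; [easy|]. cbn [g].
    rewrite (proj2 (Nat.leb_le k n)) by lia. apply IH. lia. }
  exists (fun n => g n n). intros [|j].
  - cbn. field. exact Hd.
  - change (rsum (fun k => g k k * d (S j - k)%nat) (S (S j)))
      with (rsum (fun k => g k k * d (S j - k)%nat) (S j) + g (S j) (S j) * d (S j - S j)%nat).
    rewrite Nat.sub_diag.
    replace (g (S j) (S j)) with ((c (S j) - rsum (fun i => g j i * d (S j - i)%nat) (S j)) / d O).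
    2:{ change (g (S j) (S j)) with (if Nat.leb (S j) j then g j (S j)
        else (c (S j) - rsum (fun i => g j i * d (S j - i)%nat) (S j)) / d O).
        now rewrite (proj2 (Nat.leb_gt (S j) j)) by lia. }
    rewrite (rsum_ext (fun i => g j i * _) (fun i => g i i * d (S j - i)%nat)).
    + field. exact Hd.
    + intros i L. now rewrite G by lia.
Qed.

Lemma rsum_pow2 n : rsum (fun k => 2 ^ k) n = 2 ^ n - 1.
Proof. induction n as [|n IH]; cbn; [ring|]. rewrite IH. ring. Qed.

(** Strong induction. Up to the factor |d_0|, the earlier terms contribute C K^k (1 + 2 + ... +
    2^(k-1)) = C K^k (2^k - 1), and c_k supplies the missing C K^k. This is why K is doubled. *)
Lemma convolution_inverse_bound (b c d : nat -> R) C K :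
  d O <> 0 -> 0 <= C -> 0 <= K ->
  (forall j, rsum (fun k => b k * d (j - k)%nat) (S j) = c j) ->
  (forall k, Rabs (d k) <= Rabs (d O) * K ^ k) ->
  (forall k, Rabs (c k) <= C * Rabs (d O) * K ^ k) ->
  forall k, Rabs (b k) <= C * (2 * K) ^ k.
Proof.
  intros Hd HC HK Hb Bd Bc k.
  assert (D0 : 0 < Rabs (d O)) by now apply Rabs_pos_lt.
  induction k as [k IH] using (well_founded_induction lt_wf).
  specialize (Hb k). cbn [rsum] in Hb. rewrite Nat.sub_diag in Hb.
  assert (E : b k * d O = c k - rsum (fun i => b i * d (k - i)%nat) k) by lra.
  apply Rmult_le_reg_r with (Rabs (d O)); [easy|]. rewrite <- Rabs_mult, E.
  assert (A : Rabs (rsum (fun i => b i * d (k - i)%nat) k) <= C * Rabs (d O) * K ^ k * (2 ^ k - 1)).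
  { rewrite <- rsum_pow2, <- rsum_scal.
    assert (G : forall f n, Rabs (rsum f n) <= rsum (fun i => Rabs (f i)) n).
    { intros f n. induction n as [|n IHn]; cbn; [rewrite Rabs_R0; lra|].
      eapply Rle_trans; [apply Rabs_triang|]. lra. }
    eapply Rle_trans; [apply G|]. apply rsum_le. intros i L. rewrite Rabs_mult.
    replace (K ^ k) with (K ^ i * K ^ (k - i)) by (rewrite <- pow_add; f_equal; lia).
    replace (C * Rabs (d O) * (K ^ i * K ^ (k - i)) * 2 ^ i)
      with (C * (2 * K) ^ i * (Rabs (d O) * K ^ (k - i))) by (rewrite Rpow_mult_distr; ring).
    apply Rmult_le_compat; try apply Rabs_pos; auto. }
  eapply Rle_trans; [apply Rabs_triang|]. rewrite Rabs_Ropp.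
  rewrite Rpow_mult_distr. specialize (Bc k). lra.
Qed.

Lemma exp_coef_bound x K k : Rabs x <= K -> Rabs (x ^ k / INR (fact k)) <= K ^ k.
Proof.
  intros H. unfold Rdiv. rewrite Rabs_mult, <- RPow_abs, Rabs_inv, (Rabs_pos_eq (INR _)) by apply pos_INR.
  assert (F : 1 <= INR (fact k)) by (apply (le_INR 1), lt_O_fact).
  assert (P : Rabs x ^ k <= K ^ k) by (apply pow_incr; split; [apply Rabs_pos|easy]).
  assert (P0 : 0 <= Rabs x ^ k) by (apply pow_le, Rabs_pos).
  apply Rle_trans with (Rabs x ^ k); [|easy]. apply Rle_div_l; [lra|]. nra.
Qed.

Lemma is_pseries_exp x t : is_pseries (fun k => x ^ k / INR (fact k)) t (exp (x * t)).
Proof.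
  apply is_pseries_R. assert (H := is_exp_Reals (x * t)). apply is_pseries_R in H.
  eapply is_series_ext; [|exact H]. intros k.
  match goal with |- ?x = ?y => change (x = y :> R) end. cbn beta.
  rewrite Rpow_mult_distr. unfold Rdiv. ring.
Qed.

Lemma is_pseries_exp_quot x t :
  t <> 0 -> is_pseries (fun k => x ^ (S k) / INR (fact (S k))) t ((exp (x * t) - 1) / t).
Proof.
  intros Ht. apply is_pseries_R.
  assert (H := is_pseries_exp x t). apply is_pseries_R in H.
  assert (H1 : is_series (fun k => x ^ (S k) / INR (fact (S k)) * t ^ (S k)) (exp (x * t) - 1)).
  { apply (is_series_incr_1 (fun k => x ^ k / INR (fact k) * t ^ k)).
    match goal with |- is_series _ ?l => replace l with (exp (x * t)); [exact H|] end.
    unfold plus. cbn. field. }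
  apply (is_series_scal (/ t)) in H1.
  replace ((exp (x * t) - 1) / t) with (scal (/ t) (exp (x * t) - 1)).
  - eapply is_series_ext; [|exact H1]. intros k.
    match goal with |- ?x = ?y => change (x = y :> R) end.
    unfold scal. cbn -[fact INR pow]. unfold mult. cbn -[fact INR pow].
    cbn [pow]. field. split; auto using INR_fact_neq_0.
  - unfold scal. cbn. unfold mult. cbn. field. exact Ht.
Qed.

(* Coefficientwise form of (sum_k b_k t^k) (1 - e^(-ht)) / t = e^(-at). *)
Definition is_bernoulli (h a : R) (b : nat -> R) : Prop :=
  forall j, rsum (fun k => b k * - ((- h) ^ S (j - k) / INR (fact (S (j - k))))) (S j)
    = (- a) ^ j / INR (fact j).

Lemma bernoulli_exists h a :
  0 < h -> exists b, is_bernoulli h a b.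
Proof.
  intros Hh. unfold is_bernoulli.
  apply (convolution_inverse (fun j => (- a) ^ j / INR (fact j))
    (fun i => - ((- h) ^ S i / INR (fact (S i))))).
  cbn. lra.
Qed.

(** Geometric bounds on the coefficients of both factors justify the Cauchy product with (1 -
    e^(-ht)) / t, which turns the recursion into the closed form. *)
Lemma bernoulli_generating h a b :
  0 < h -> is_bernoulli h a b ->
  exists r, 0 < r /\ forall t, 0 < Rabs t < r ->
    is_pseries b t (t * exp (- a * t) / (1 - exp (- h * t))).
Proof.
  intros Hh Hb. set (K := h + Rabs a). assert (Pa := Rabs_pos a).
  assert (HK : 0 < K) by (unfold K; lra).
  set (d := fun i => - ((- h) ^ S i / INR (fact (S i)))).
  set (c := fun j => (- a) ^ j / INR (fact j)).
  assert (d0 : d O = h) by (unfold d; cbn; field).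
  assert (Bd : forall k, Rabs (d k) <= h * K ^ k).
  { intros k. unfold d. rewrite Rabs_Ropp.
    apply Rle_trans with (h ^ S k).
    - apply exp_coef_bound. rewrite Rabs_Ropp, Rabs_pos_eq; lra.
    - cbn. apply Rmult_le_compat_l; [lra|]. apply pow_incr. unfold K. lra. }
  assert (Bc : forall k, Rabs (c k) <= K ^ k).
  { intros k. apply exp_coef_bound. rewrite Rabs_Ropp. unfold K. lra. }
  assert (Bb : forall k, Rabs (b k) <= / h * (2 * K) ^ k).
  { apply (convolution_inverse_bound b c d).
    - rewrite d0. lra.
    - left. now apply Rinv_0_lt_compat.
    - lra.
    - exact Hb.
    - intros k. rewrite d0, (Rabs_pos_eq h) by lra. apply Bd.
    - intros k. rewrite d0, (Rabs_pos_eq h) by lra. rewrite Rinv_l by lra. rewrite Rmult_1_l. apply Bc. }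
  set (r := / (2 * K)). assert (Hr : 0 < r) by (apply Rinv_0_lt_compat; lra).
  assert (rK : 2 * K * r = 1) by (unfold r; field; lra).
  exists r. split; [easy|]. intros t Ht.
  assert (Nt : t <> 0) by (intros ->; rewrite Rabs_R0 in Ht; lra).
  assert (Rb : Rbar_lt (Rabs t) (CV_radius b)).
  { apply CV_radius_gt with r (/ h); [|easy|easy]. intros n.
    apply Rle_trans with (/ h * (2 * K) ^ n * r ^ n).
    - apply Rmult_le_compat_r; [apply pow_le; lra|apply Bb].
    - rewrite Rmult_assoc, <- Rpow_mult_distr, rK, pow1. lra. }
  assert (Rd : Rbar_lt (Rabs t) (CV_radius d)).
  { apply CV_radius_gt with r h; [|easy|easy]. intros n.
    apply Rle_trans with (h * K ^ n * r ^ n).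
    - apply Rmult_le_compat_r; [apply pow_le; lra|apply Bd].
    - rewrite Rmult_assoc, <- Rpow_mult_distr. apply Rle_trans with (h * 1 ^ n); [|rewrite pow1; lra].
      apply Rmult_le_compat_l; [lra|]. apply pow_incr. nra. }
  assert (E := PSeries_mult b d t Rb Rd).
  rewrite (PSeries_ext (PS_mult b d) c) in E.
  2:{ intros n. unfold PS_mult. rewrite <- sum_n_Reals, sum_n_rsum. apply Hb. }
  rewrite (is_pseries_unique c t _ (is_pseries_exp (- a) t)) in E.
  assert (Ed : PSeries d t = (1 - exp (- h * t)) / t).
  { apply is_pseries_unique. assert (H := is_pseries_exp_quot (- h) t Nt).
    apply is_pseries_opp in H. replace ((1 - exp (- h * t)) / t) with (opp ((exp (- h * t) - 1) / t)).
    - exact H.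
    - unfold opp. cbn. field. exact Nt. }
  assert (N1 : 1 - exp (- h * t) <> 0).
  { intros F. assert (X : exp (- h * t) = exp 0) by (rewrite exp_0; lra).
    apply exp_inv in X. destruct (Rmult_integral _ _ X); lra. }
  replace (t * exp (- a * t) / (1 - exp (- h * t))) with (PSeries b t).
  - apply PSeries_correct, CV_radius_inside, Rb.
  - rewrite E, Ed. field. auto.
Qed.

(** * Expansions in inverse powers *)

Lemma Cexp_plus z w : Cexp (z + w) = (Cexp z * Cexp w)%C.
Proof.
  destruct z as [x y], w as [u v]. unfold Cexp, Cplus, Cmult. cbn.
  rewrite exp_plus, cos_plus, sin_plus. f_equal; ring.
Qed.

Lemma Cexp_RtoC x : Cexp (RtoC x) = RtoC (exp x).
Proof. unfold Cexp, RtoC. cbn. rewrite cos_0, sin_0. f_equal; ring. Qed.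

Lemma Cmod_Cexp z : Cmod (Cexp z) = exp (Re z).
Proof.
  unfold Cmod, Cexp. cbn [fst snd].
  replace ((exp (Re z) * cos (Im z)) ^ 2 + (exp (Re z) * sin (Im z)) ^ 2)
    with (exp (Re z) ^ 2).
  - apply sqrt_pow2. left. apply exp_pos.
  - assert (T := sin2_cos2 (Im z)). unfold Rsqr in T.
    replace ((exp (Re z) * cos (Im z)) ^ 2 + (exp (Re z) * sin (Im z)) ^ 2)
      with (exp (Re z) ^ 2 * (sin (Im z) * sin (Im z) + cos (Im z) * cos (Im z))) by ring.
    rewrite T. ring.
Qed.

Lemma Cpower_plus X z w : Rpos_Cpower X (z + w) = (Rpos_Cpower X z * Rpos_Cpower X w)%C.
Proof. unfold Rpos_Cpower. rewrite <- Cexp_plus. f_equal. ring. Qed.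

Lemma Cpower_mult X Y z :
  0 < X -> 0 < Y -> Rpos_Cpower (X * Y) z = (Rpos_Cpower X z * Rpos_Cpower Y z)%C.
Proof.
  intros HX HY. unfold Rpos_Cpower. rewrite <- Cexp_plus, ln_mult by easy. f_equal.
  rewrite RtoC_plus. ring.
Qed.

Lemma Cpower_nat X k : 0 < X -> Rpos_Cpower X (RtoC (INR k)) = RtoC (X ^ k).
Proof.
  intros HX. unfold Rpos_Cpower. rewrite <- RtoC_mult, Cexp_RtoC. f_equal.
  rewrite <- Rpower_pow by easy. reflexivity.
Qed.

Lemma Cpower_opp_nat X k : 0 < X -> Rpos_Cpower X (- RtoC (INR k)) = RtoC ((/ X) ^ k).
Proof.
  intros HX. unfold Rpos_Cpower. rewrite <- RtoC_opp, <- RtoC_mult, Cexp_RtoC. f_equal.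
  rewrite pow_inv, <- Rpower_pow, <- Rpower_Ropp by easy. reflexivity.
Qed.

Lemma Cpower_shift X z k :
  0 < X -> Rpos_Cpower X (- (z + RtoC (INR k))) = (Rpos_Cpower X (- z) * RtoC ((/ X) ^ k))%C.
Proof.
  intros HX. rewrite <- Cpower_opp_nat by easy. rewrite <- Cpower_plus. f_equal. ring.
Qed.

Lemma Cmod_Cpower X z : Cmod (Rpos_Cpower X z) = exp (Re z * ln X).
Proof.
  unfold Rpos_Cpower. rewrite Cmod_Cexp. f_equal. destruct z as [x y]. unfold RtoC, Cmult. cbn. ring.
Qed.

(** Expand X^(-z) = X^(-z0) exp(-(z - z0) ln X). The linear coefficient is singled out because it is
    the derivative in [cder_Cpower]. *)
Lemma Cpower_pseries X z0 r :
  0 <= r ->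
  exists a : nat -> C,
    (forall n, rsum (fun k => Cmod (a k) * r ^ k) n
       <= exp (- Re z0 * ln X) * exp (r * Rabs (ln X))) /\
    (forall z, ccv (csum (fun k => a k * (z - z0) ^ k)%C) (Rpos_Cpower X (- z))) /\
    a 1%nat = (RtoC (- ln X) * Rpos_Cpower X (- z0))%C.
Proof.
  intros Hr.
  exists (fun k => Rpos_Cpower X (- z0) * (RtoC (- ln X) ^ k / RtoC (INR (fact k))))%C.
  assert (F : forall k, RtoC (INR (fact k)) <> 0%C).
  { intros k E. apply RtoC_inj in E. now apply (INR_fact_neq_0 k). }
  split; [|split].
  - intros n. rewrite (rsum_ext _ (fun k => exp (- Re z0 * ln X) * ((r * Rabs (ln X)) ^ k / INR (fact k)))).
    + rewrite rsum_scal. apply Rmult_le_compat_l; [left; apply exp_pos|].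
      apply rsum_exp_le. apply Rmult_le_pos; [easy|apply Rabs_pos].
    + intros k _. rewrite Cmod_mult, Cmod_Cpower, Cmod_div, Cmod_pow, !Cmod_R by auto.
      rewrite Rabs_Ropp, (Rabs_pos_eq (INR _)) by apply pos_INR. rewrite Rpow_mult_distr.
      replace (Re (- z0)) with (- Re z0) by reflexivity. unfold Rdiv. ring.
  - intros z. assert (H := ccv_scal (Rpos_Cpower X (- z0)) _ _ (ccv_Cexp ((z - z0) * RtoC (- ln X)))).
    replace (Rpos_Cpower X (- z)) with (Rpos_Cpower X (- z0) * Cexp ((z - z0) * RtoC (- ln X)))%C.
    + eapply ccv_ext; [|exact H]. intros n. cbn beta. rewrite <- csum_scal. apply csum_ext. intros i _.
      rewrite Cpow_mult_l. field. apply F.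
    + unfold Rpos_Cpower. rewrite <- Cexp_plus. f_equal. rewrite RtoC_opp. ring.
  - cbn. field.
Qed.

Lemma amaj_Cpower X z0 r :
  1 <= X -> 0 <= r -> amaj (fun z => Rpos_Cpower X (- z)) z0 r (exp ((r - Re z0) * ln X)).
Proof.
  intros HX Hr. destruct (Cpower_pseries X z0 r Hr) as (a & Ha & Hf & _). exists a. split; [|auto].
  intros n. assert (H := Ha n).
  rewrite Rabs_pos_eq in H.
  - rewrite <- exp_plus in H. replace ((r - Re z0) * ln X) with (- Re z0 * ln X + r * ln X) by ring. exact H.
  - rewrite <- ln_1. destruct (Req_dec X 1) as [->|N]; [lra|]. left. apply ln_increasing; lra.
Qed.

Lemma cder_Cpower X z0 :
  cder (fun z => Rpos_Cpower X (- z)) z0 (RtoC (- ln X) * Rpos_Cpower X (- z0))%C.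
Proof.
  destruct (Cpower_pseries X z0 1 Rle_0_1) as (a & Ha & Hf & <-).
  apply (pseries_cder _ z0 1 (exp (- Re z0 * ln X) * exp (1 * Rabs (ln X)))); auto. lra.
Qed.

Lemma amaj_poch f z0 r M k :
  0 <= r -> amaj f z0 r M ->
  amaj (fun z => poch z k * f z)%C z0 r (rpoch (Cmod z0 + r) k * M).
Proof.
  intros Hr Hf. assert (M0 := amaj_nonneg _ _ _ _ Hf). induction k as [|k IH].
  - apply amaj_weaken with M; [cbn; lra|]. eapply amaj_ext; [|exact Hf]. intros; cbn; ring.
  - assert (H := amaj_mul_linear _ z0 r _ (- RtoC (INR k))%C Hr IH).
    eapply amaj_weaken; [|eapply amaj_ext; [|exact H]].
    + cbn [rpoch]. assert (T := Cmod_triangle z0 (RtoC (INR k))).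
      rewrite Cmod_R, Rabs_pos_eq in T by apply pos_INR.
      replace (z0 - - RtoC (INR k))%C with (z0 + RtoC (INR k))%C by ring.
      assert (P := rpoch_nonneg (Cmod z0 + r) k). assert (P1 := Cmod_ge_0 z0).
      assert (0 <= rpoch (Cmod z0 + r) k * M) by (apply Rmult_le_pos; lra).
      nra.
    + intros z _. cbn -[INR]. ring.
Qed.

(** The first clause is absolute convergence at the worst point X = 2 h with |z| <= c, so one bound
    serves a whole disc of z and all larger X. The coefficients [phi] are free of z because (z)_j
    belongs to the basis functions. *)
Definition inv_expansion (h : R) (F : C -> R -> C) (phi : nat -> R) : Prop :=
  (forall c, 0 <= c -> exists M, forall n,
     rsum (fun j => Rabs (phi j) * rpoch c j * (/ (2 * h)) ^ j) n <= M) /\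
  (forall z X, 2 * h <= X ->
     ccv (csum (fun j => RtoC (phi j) * (poch z j * RtoC ((/ X) ^ j) * Rpos_Cpower X (- z)))%C) (F z X)).

Lemma inv_expansion_ext h F G phi psi :
  (forall z X, 2 * h <= X -> F z X = G z X) -> (forall j, phi j = psi j) ->
  inv_expansion h F phi -> inv_expansion h G psi.
Proof.
  intros E1 E2 [H1 H2]. split.
  - intros c Hc. destruct (H1 c Hc) as [M HM]. exists M. intros n. eapply Rle_trans; [|apply (HM n)].
    right. apply rsum_ext. intros; now rewrite E2.
  - intros z X HX. rewrite <- E1 by easy. eapply ccv_ext; [|apply H2, HX].
    intros n. apply csum_ext. intros; now rewrite E2.
Qed.

Lemma inv_expansion_plus h F G phi psi :
  0 < h ->
  inv_expansion h F phi -> inv_expansion h G psi ->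
  inv_expansion h (fun z X => F z X + G z X)%C (fun j => phi j + psi j).
Proof.
  intros Hh [F1 F2] [G1 G2]. split.
  - intros c Hc. destruct (F1 c Hc) as [M HM], (G1 c Hc) as [K HK]. exists (M + K). intros n.
    eapply Rle_trans; [|apply (Rplus_le_compat _ _ _ _ (HM n) (HK n))].
    rewrite <- rsum_plus. apply rsum_le. intros j _. rewrite <- !Rmult_plus_distr_r.
    apply Rmult_le_compat_r; [apply pow_le; left; apply Rinv_0_lt_compat; lra|].
    apply Rmult_le_compat_r; [now apply rpoch_nonneg|apply Rabs_triang].
  - intros z X HX. eapply ccv_ext; [|apply (ccv_plus _ _ _ _ (F2 z X HX) (G2 z X HX))].
    intros n. cbn beta. rewrite <- csum_plus. apply csum_ext. intros j _. rewrite RtoC_plus. ring.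
Qed.

Lemma inv_expansion_scal h F phi y :
  inv_expansion h F phi ->
  inv_expansion h (fun z X => RtoC y * F z X)%C (fun j => y * phi j).
Proof.
  intros [F1 F2]. split.
  - intros c Hc. destruct (F1 c Hc) as [M HM]. exists (Rabs y * M). intros n.
    rewrite (rsum_ext _ (fun j => Rabs y * (Rabs (phi j) * rpoch c j * (/ (2 * h)) ^ j))).
    + rewrite rsum_scal. apply Rmult_le_compat_l; [apply Rabs_pos|apply HM].
    + intros j _. rewrite Rabs_mult. ring.
  - intros z X HX. eapply ccv_ext; [|apply (ccv_scal (RtoC y) _ _ (F2 z X HX))].
    intros n. cbn beta. rewrite <- csum_scal. apply csum_ext. intros j _. rewrite RtoC_mult. ring.
Qed.

Lemma inv_expansion_zero h : inv_expansion h (fun _ _ => 0%C) (fun _ => 0).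
Proof.
  split.
  - intros c Hc. exists 0. intros n. rewrite rsum_zero; [lra|]. intros. rewrite Rabs_R0. ring.
  - intros z X HX. eapply ccv_ext; [|apply ccv_const]. intros n. cbn beta. symmetry. apply csum_zero.
    intros. ring.
Qed.

Lemma inv_expansion_csum h (F : nat -> C -> R -> C) (phi : nat -> nat -> R) n :
  0 < h -> (forall k, inv_expansion h (F k) (phi k)) ->
  inv_expansion h (fun z X => csum (fun k => F k z X) n) (fun j => rsum (fun k => phi k j) n).
Proof.
  intros Hh H. induction n as [|n IH]; [apply inv_expansion_zero|].
  cbn. now apply inv_expansion_plus.
Qed.

(* (z)_k (X+y)^(-z-k) = sum_j (shift_coef k y j) (z)_j X^(-z-j),
   because (z)_k (z+k)_i = (z)_(k+i). *)
Definition shift_coef (k : nat) (y : R) (j : nat) : R :=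
  if Nat.leb k j then (- y) ^ (j - k) / INR (fact (j - k)) else 0.

(** Factor out X: (X + y)^(-z-k) = X^(-z-k) (1 + y/X)^(-z-k) with |y/X| <= 1/2, where the binomial
    series applies. *)
Lemma inv_expansion_shift h k y :
  0 < h -> Rabs y <= h ->
  inv_expansion h (fun z X => poch z k * Rpos_Cpower (X + y) (- (z + RtoC (INR k))))%C (shift_coef k y).
Proof.
  intros Hh Hy.
  assert (C0 : forall j, (j < k)%nat -> shift_coef k y j = 0).
  { intros j L. unfold shift_coef. now rewrite (proj2 (Nat.leb_gt k j)). }
  assert (C1 : forall i, shift_coef k y (k + i) = (- y) ^ i / INR (fact i)).
  { intros i. unfold shift_coef. rewrite (proj2 (Nat.leb_le k (k + i))) by lia.
    now replace (k + i - k)%nat with i by lia. }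
  assert (P2 : 0 < / (2 * h)) by (apply Rinv_0_lt_compat; lra).
  split.
  - intros c Hc. assert (Hck : 0 <= c + INR k) by (assert (T := pos_INR k); lra).
    destruct (rpoch_series_bounded (c + INR k) Hck) as [M HM].
    exists (rpoch c k * (/ (2 * h)) ^ k * M). intros n.
    apply Rle_trans with (rsum (fun j => Rabs (shift_coef k y j) * rpoch c j * (/ (2 * h)) ^ j) (k + n)).
    { apply rsum_mono; [|lia]. intros i. apply Rmult_le_pos; [|apply pow_le; lra].
      apply Rmult_le_pos; [apply Rabs_pos|now apply rpoch_nonneg]. }
    rewrite rsum_add, rsum_zero, Rplus_0_l.
    2:{ intros i L. rewrite C0 by easy. rewrite Rabs_R0. ring. }
    eapply Rle_trans; [|apply Rmult_le_compat_l; [|apply (HM n)]].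
    2:{ apply Rmult_le_pos; [now apply rpoch_nonneg|apply pow_le; lra]. }
    rewrite <- rsum_scal. apply rsum_le. intros i _. rewrite C1, rpoch_add, pow_add.
    assert (Q1 := rpoch_nonneg c k Hc). assert (Q2 := rpoch_nonneg (c + INR k) i Hck).
    assert (Q3 : Rabs ((- y) ^ i / INR (fact i)) * (/ (2 * h)) ^ i <= / INR (fact i) * (3 / 4) ^ i).
    { unfold Rdiv. rewrite Rabs_mult, <- RPow_abs, Rabs_Ropp, Rabs_inv, (Rabs_pos_eq (INR _)) by apply pos_INR.
      rewrite Rmult_comm, <- Rmult_assoc, <- Rpow_mult_distr, Rmult_comm.
      apply Rmult_le_compat_l; [left; apply Rinv_0_lt_compat, INR_fact_lt_0|].
      apply pow_incr. assert (A := Rabs_pos y). split; [apply Rmult_le_pos; lra|].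
      apply Rle_trans with (/ (2 * h) * h); [apply Rmult_le_compat_l; lra|].
      replace (/ (2 * h) * h) with (/ 2) by (field; lra). lra. }
    assert (Q4 : 0 <= rpoch c k * (/ (2 * h)) ^ k * rpoch (c + INR k) i).
    { apply Rmult_le_pos; [apply Rmult_le_pos; [easy|apply pow_le; lra]|easy]. }
    apply (Rmult_le_compat_l _ _ _ Q4) in Q3. unfold Rdiv in *. lra.
  - intros z X HX. assert (X0 : 0 < X) by lra.
    assert (HyX : Rabs (y / X) < 3 / 4).
    { unfold Rdiv. rewrite Rabs_mult, Rabs_inv, (Rabs_pos_eq X) by lra.
      apply (Rlt_div_l (Rabs y) (3 / 4) X); lra. }
    assert (B := ccv_binomial (z + RtoC (INR k)) (y / X) HyX).
    apply (proj2 (ccv_shift _ _ k)).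
    assert (Xy : 0 < 1 + y / X) by (apply Rabs_def2 in HyX; lra).
    replace (X + y) with (X * (1 + y / X)) by (field; lra).
    rewrite Cpower_mult, Cpower_shift by easy.
    replace (poch z k * (Rpos_Cpower X (- z) * RtoC ((/ X) ^ k) * Rpos_Cpower (1 + y / X) (- (z + RtoC (INR k)))))%C
      with (poch z k * Rpos_Cpower X (- z) * RtoC ((/ X) ^ k) * Rpos_Cpower (1 + y / X) (- (z + RtoC (INR k))))%C
      by ring.
    eapply ccv_ext; [|apply ccv_scal, B].
    intros n. cbn beta. rewrite Nat.add_comm, csum_add, (csum_zero _ k), Cplus_0_l.
    2:{ intros i L. rewrite C0 by easy. ring. }
    rewrite <- csum_scal. apply csum_ext. intros i _. rewrite C1, poch_add, pow_add.
    rewrite <- RtoC_pow. replace (- (y / X)) with (- y * / X) by (field; lra).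
    rewrite Rpow_mult_distr. unfold Rdiv. rewrite !RtoC_mult. rewrite RtoC_inv by apply INR_fact_neq_0.
    unfold Cdiv. ring.
Qed.

(** Coefficients of (1 - e^(-ht)) / t, the very numbers convolved with b in [is_bernoulli]. *)
Definition delta_coef (h : R) (j : nat) : R := - ((- h) ^ S j / INR (fact (S j))).

(* The entire function of z equal to (X^(1-z) - (X+h)^(1-z)) / (z - 1) off z = 1. *)
Definition power_quotient (h : R) (z : C) (X : R) : C :=
  epsilon (inhabits (RtoC 0)) (fun l => ccv (csum (fun j =>
    RtoC (delta_coef h j) * (poch z j * RtoC ((/ X) ^ j) * Rpos_Cpower X (- z)))%C) l).

Lemma poch_S_l z k : poch z (S k) = (z * poch (z + 1) k)%C.
Proof.
  replace (S k) with (1 + k)%nat by lia. rewrite poch_add. cbn. f_equal. ring.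
Qed.

(** Absolute convergence is inherited from [shift_coef 0 h], since |delta_coef h j| <= h h^j /
    j!. *)
Lemma inv_expansion_power_quotient h :
  0 < h -> inv_expansion h (power_quotient h) (delta_coef h).
Proof.
  intros Hh. assert (P2 : 0 < / (2 * h)) by (apply Rinv_0_lt_compat; lra).
  assert (Habs : forall c, 0 <= c -> exists M, forall n,
     rsum (fun j => Rabs (delta_coef h j) * rpoch c j * (/ (2 * h)) ^ j) n <= M).
  { intros c Hc. destruct (proj1 (inv_expansion_shift h 0 h Hh ltac:(rewrite Rabs_pos_eq; lra)) c Hc) as [M HM].
    exists (h * M). intros n. eapply Rle_trans; [|apply Rmult_le_compat_l; [lra|apply (HM n)]].
    rewrite <- rsum_scal. apply rsum_le. intros j _. rewrite <- !Rmult_assoc.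
    apply Rmult_le_compat_r; [apply pow_le; lra|].
    apply Rmult_le_compat_r; [now apply rpoch_nonneg|].
    unfold delta_coef, shift_coef. cbn [Nat.leb]. rewrite Nat.sub_0_r, Rabs_Ropp. unfold Rdiv.
    rewrite !Rabs_mult, <- !RPow_abs, !Rabs_Ropp, !Rabs_inv, !(Rabs_pos_eq (INR _)) by apply pos_INR.
    rewrite (Rabs_pos_eq h) by lra. cbn [pow]. rewrite <- Rmult_assoc.
    apply Rmult_le_compat_l; [apply Rmult_le_pos; [lra|apply pow_le; lra]|].
    apply Rinv_le_contravar; [apply INR_fact_lt_0|]. apply le_INR, fact_le. lia. }
  split; [exact Habs|]. intros z X HX.
  apply (epsilon_spec _ (fun l => ccv (csum (fun j =>
    RtoC (delta_coef h j) * (poch z j * RtoC ((/ X) ^ j) * Rpos_Cpower X (- z)))%C) l)).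
  destruct (Habs (Cmod z) (Cmod_ge_0 z)) as [M HM].
  apply abs_cv with (Cmod (Rpos_Cpower X (- z)) * M). intros n.
  eapply Rle_trans; [|apply Rmult_le_compat_l; [apply Cmod_ge_0|apply (HM n)]].
  rewrite <- rsum_scal. apply rsum_le. intros j _. rewrite !Cmod_mult, !Cmod_R.
  rewrite (Rabs_pos_eq ((/ X) ^ j)) by (apply pow_le; left; apply Rinv_0_lt_compat; lra).
  assert (Q1 := Cmod_poch_le z (Cmod z) j (Rle_refl _)).
  assert (Q2 : (/ X) ^ j <= (/ (2 * h)) ^ j).
  { apply pow_incr. split; [left; apply Rinv_0_lt_compat; lra|]. apply Rinv_le_contravar; lra. }
  assert (Q3 : Cmod (poch z j) * (/ X) ^ j <= rpoch (Cmod z) j * (/ (2 * h)) ^ j).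
  { apply Rmult_le_compat; auto; [apply Cmod_ge_0|apply pow_le; left; apply Rinv_0_lt_compat; lra]. }
  apply (Rmult_le_compat_l (Rabs (delta_coef h j) * Cmod (Rpos_Cpower X (- z)))) in Q3; [lra|].
  apply Rmult_le_pos; [apply Rabs_pos|apply Cmod_ge_0].
Qed.

(** Since (z-1)_(i+1) = (z-1) (z)_i, every term of the binomial series of 1 - (1 + h/X)^(1-z)
    contains the factor z - 1; multiplied by X^(1-z), it is z - 1 times the defining series. *)
Lemma power_quotient_spec h z X :
  0 < h -> 2 * h <= X ->
  ((z - 1) * power_quotient h z X = Rpos_Cpower X (1 - z) - Rpos_Cpower (X + h) (1 - z))%C.
Proof.
  intros Hh HX. assert (X0 : 0 < X) by lra.
  assert (H := ccv_scal (z - 1) _ _ (proj2 (inv_expansion_power_quotient h Hh) z X HX)).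
  apply (ccv_unique _ _ _ H).
  assert (HhX : Rabs (h / X) < 3 / 4).
  { rewrite Rabs_pos_eq; [apply Rlt_div_l; lra|]. apply Rmult_le_pos; [lra|left; apply Rinv_0_lt_compat; lra]. }
  assert (B := ccv_binomial (z - 1) (h / X) HhX).
  assert (B1 := proj1 (ccv_shift _ _ 1) B).
  assert (Xy : 0 < 1 + h / X) by (apply Rabs_def2 in HhX; lra).
  assert (B2 := ccv_scal (Rpos_Cpower X (1 - z)) _ _ (ccv_minus _ _ _ _ (ccv_const 1%C) B1)).
  replace (Rpos_Cpower X (1 - z) - Rpos_Cpower (X + h) (1 - z))%C
    with (Rpos_Cpower X (1 - z) * (1 - Rpos_Cpower (1 + h / X) (- (z - 1))))%C.
  2:{ replace (X + h) with (X * (1 + h / X)) by (field; lra). rewrite Cpower_mult by easy.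
      replace (- (z - 1))%C with (1 - z)%C by ring. ring. }
  eapply ccv_ext; [|exact B2]. intros n. cbn beta. rewrite Nat.add_1_r, csum_S_l.
  replace (Rpos_Cpower X (1 - z)) with (RtoC X * Rpos_Cpower X (- z))%C.
  2:{ unfold Cminus. rewrite Cpower_plus. f_equal. rewrite <- (pow_1 X) at 1.
      rewrite <- Cpower_nat by easy. reflexivity. }
  replace (1 - _)%C with (- csum (fun i => poch (z - 1) (S i) / RtoC (INR (fact (S i))) * RtoC (- (h / X)) ^ S i) n)%C.
  2:{ cbn. field. }
  replace (RtoC X * Rpos_Cpower X (- z) * - _)%C with (- RtoC X * Rpos_Cpower X (- z) *
     csum (fun i => poch (z - 1) (S i) / RtoC (INR (fact (S i))) * RtoC (- (h / X)) ^ S i) n)%C by ring.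
  rewrite <- !csum_scal. apply csum_ext. intros i _.
  rewrite poch_S_l. replace (z - 1 + 1)%C with z by ring.
  rewrite <- RtoC_pow. replace (- (h / X)) with (- h * / X) by (field; lra).
  rewrite Rpow_mult_distr. unfold delta_coef, Rdiv. rewrite RtoC_opp, !RtoC_mult.
  rewrite RtoC_inv by apply INR_fact_neq_0. unfold Cdiv.
  replace ((/ X) ^ S i) with (/ X * (/ X) ^ i) by reflexivity. rewrite RtoC_mult, RtoC_inv by lra.
  assert (N1 : RtoC X <> 0%C) by (intros E; apply RtoC_inj in E; lra).
  assert (N2 : RtoC (INR (fact (S i))) <> 0%C)
    by (intros E; apply RtoC_inj in E; now apply (INR_fact_neq_0 (S i))).
  field. auto.
Qed.

(** For j >= N and X >= 2 h, X^(-j) <= X^(-N) (2h)^(-(j-N)), so the sum at 2 h controls the sum at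
    X, at the price of (2h)^N. *)
Lemma inv_expansion_decay h F phi N z0 r :
  0 < h -> 0 < r -> inv_expansion h F phi -> (forall j, (j < N)%nat -> phi j = 0) ->
  exists K, 0 <= K /\ forall X, 2 * h <= X -> 1 <= X ->
    amaj (fun z => F z X) z0 r (K * (exp ((r - Re z0) * ln X) * (/ X) ^ N)).
Proof.
  intros Hh Hr [H1 H2] H0. set (c := Cmod z0 + r).
  assert (Hc : 0 <= c) by (unfold c; assert (T := Cmod_ge_0 z0); lra).
  destruct (H1 c Hc) as [M HM]. assert (M0 : 0 <= M) by apply (HM O).
  assert (P2 : 0 < / (2 * h)) by (apply Rinv_0_lt_compat; lra).
  exists ((2 * h) ^ N * M). split; [apply Rmult_le_pos; [apply pow_le; lra|easy]|].
  intros X HX HX1.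
  assert (PX : 0 < / X) by (apply Rinv_0_lt_compat; lra).
  set (E := exp ((r - Re z0) * ln X)).
  assert (E0 : 0 < E) by apply exp_pos.
  apply amaj_series with
    (f := fun j z => (RtoC (phi j) * (poch z j * RtoC ((/ X) ^ j) * Rpos_Cpower X (- z)))%C)
    (M := fun j => Rabs (phi j) * rpoch c j * (/ X) ^ j * E).
  - exact Hr.
  - intros j. assert (A := amaj_poch _ z0 r _ j (Rlt_le _ _ Hr) (amaj_Cpower X z0 r HX1 (Rlt_le _ _ Hr))).
    apply (amaj_scal (RtoC (phi j) * RtoC ((/ X) ^ j))%C) in A.
    eapply amaj_weaken; [|eapply amaj_ext; [|exact A]].
    + right. rewrite Cmod_mult, !Cmod_R, (Rabs_pos_eq ((/ X) ^ j)) by (apply pow_le; lra).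
      fold c E. ring.
    + intros z _. cbn beta. ring.
  - intros n. apply Rle_trans with
      ((2 * h) ^ N * (E * (/ X) ^ N) * rsum (fun j => Rabs (phi j) * rpoch c j * (/ (2 * h)) ^ j) n).
    + rewrite <- rsum_scal. apply rsum_le. intros j _.
      assert (Q1 := rpoch_nonneg c j Hc). assert (Q2 := Rabs_pos (phi j)).
      destruct (Nat.lt_ge_cases j N) as [L|L].
      * rewrite H0 by easy. rewrite Rabs_R0. right. ring.
      * replace ((/ X) ^ j) with ((/ X) ^ N * (/ X) ^ (j - N)) by (rewrite <- pow_add; f_equal; lia).
        replace ((/ (2 * h)) ^ j) with ((/ (2 * h)) ^ N * (/ (2 * h)) ^ (j - N))
          by (rewrite <- pow_add; f_equal; lia).
        replace ((2 * h) ^ N * (E * (/ X) ^ N) * (Rabs (phi j) * rpoch c j * ((/ (2 * h)) ^ N * (/ (2 * h)) ^ (j - N))))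
          with (Rabs (phi j) * rpoch c j * (/ X) ^ N * E * (((2 * h) ^ N * (/ (2 * h)) ^ N) * (/ (2 * h)) ^ (j - N)))
          by ring.
        rewrite <- Rpow_mult_distr, Rinv_r, pow1, Rmult_1_l by lra.
        replace (Rabs (phi j) * rpoch c j * ((/ X) ^ N * (/ X) ^ (j - N)) * E)
          with (Rabs (phi j) * rpoch c j * (/ X) ^ N * E * (/ X) ^ (j - N)) by ring.
        apply Rmult_le_compat_l.
        -- apply Rmult_le_pos; [|lra]. apply Rmult_le_pos; [now apply Rmult_le_pos|apply pow_le; lra].
        -- apply pow_incr. split; [lra|]. apply Rinv_le_contravar; lra.
    + specialize (HM n). replace ((2 * h) ^ N * M * (E * (/ X) ^ N)) with ((2 * h) ^ N * (E * (/ X) ^ N) * M) by ring.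
      apply Rmult_le_compat_l; [|exact HM].
      apply Rmult_le_pos; [apply pow_le; lra|]. apply Rmult_le_pos; [lra|apply pow_le; lra].
  - intros z _. now apply H2.
Qed.

(** * Euler-Maclaurin continuation *)

(* The term of index [k] of the Euler-Maclaurin expansion; [b 0] belongs to the
   polar term [X^(1-z) / (h (z-1))], hence the shift. *)
Definition em_term (b : nat -> R) (k : nat) (z : C) (X : R) : C :=
  (RtoC (b (S k)) * (poch z k * Rpos_Cpower X (- (z + RtoC (INR k)))))%C.

Definition em_poly (b : nat -> R) (N : nat) (z : C) (X : R) : C :=
  csum (fun k => em_term b k z X) N.

Definition em_rem (h a : R) (b : nat -> R) (N : nat) (z : C) (X : R) : C :=
  (em_poly b N z X - em_poly b N z (X + h) - Rpos_Cpower (X + a) (- z)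
   + RtoC (/ h) * power_quotient h z X)%C.

Lemma is_bernoulli_0 h a b : 0 < h -> is_bernoulli h a b -> b O = / h.
Proof.
  intros Hh H. specialize (H O). cbn in H.
  apply Rmult_eq_reg_r with h; [|lra]. rewrite Rinv_l by lra.
  replace (- (- h * 1 / 1)) with h in H by field.
  replace (1 / 1) with 1 in H by field. lra.
Qed.

(** The coefficient of index j is the recursion [is_bernoulli] at j: its term b_0 = 1/h comes from
    [power_quotient], the terms b_(k+1) with k < j from the shift by h, and its right side from the
    shift by a. The index k = j contributes 1 - 1 and k > j nothing, so the cut at N is invisible
    for j < N. *)
Lemma em_rem_expansion h a b N :
  0 < h -> 0 <= a <= h -> is_bernoulli h a b ->
  exists phi, inv_expansion h (em_rem h a b N) phi /\ forall j, (j < N)%nat -> phi j = 0.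
Proof.
  intros Hh Ha Hb.
  exists (fun j => rsum (fun k => b (S k) * (shift_coef k 0 j + -1 * shift_coef k h j)) N
    + (-1 * shift_coef 0 a j + / h * delta_coef h j)).
  split.
  - assert (A0 : forall k, inv_expansion h
      (fun z X => poch z k * Rpos_Cpower (X + 0) (- (z + RtoC (INR k))))%C (shift_coef k 0)).
    { intros k. apply inv_expansion_shift; [easy|]. rewrite Rabs_R0. lra. }
    assert (A1 : forall k, inv_expansion h
      (fun z X => poch z k * Rpos_Cpower (X + h) (- (z + RtoC (INR k))))%C (shift_coef k h)).
    { intros k. apply inv_expansion_shift; [easy|]. rewrite Rabs_pos_eq; lra. }
    assert (A2 : inv_expansion h
      (fun z X => poch z 0 * Rpos_Cpower (X + a) (- (z + RtoC (INR 0))))%C (shift_coef 0 a)).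
    { apply inv_expansion_shift; [easy|]. rewrite Rabs_pos_eq; lra. }
    assert (A3 := inv_expansion_csum h _ _ N Hh (fun k => inv_expansion_scal h _ _ (b (S k))
      (inv_expansion_plus h _ _ _ _ Hh (A0 k) (inv_expansion_scal h _ _ (-1) (A1 k))))).
    assert (A4 := inv_expansion_plus h _ _ _ _ Hh A3 (inv_expansion_plus h _ _ _ _ Hh
      (inv_expansion_scal h _ _ (-1) A2)
      (inv_expansion_scal h _ _ (/ h) (inv_expansion_power_quotient h Hh)))).
    eapply inv_expansion_ext; [| |exact A4].
    + intros z X _. unfold em_rem, em_poly. rewrite Rplus_0_r.
      rewrite (csum_ext _ (fun k => em_term b k z X - em_term b k z (X + h))%C).
      * rewrite csum_minus. cbn [poch INR]. rewrite Cplus_0_r. ring.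
      * intros k _. unfold em_term. ring.
    + reflexivity.
  - intros j L. assert (B := Hb j). rewrite rsum_S_l, Nat.sub_0_r in B.
    rewrite (is_bernoulli_0 h a b Hh Hb) in B.
    replace N with (j + (N - j))%nat by lia. rewrite rsum_add.
    rewrite (rsum_ext _ (fun k => b (S k) * - ((- h) ^ S (j - S k) / INR (fact (S (j - S k))))) j).
    2:{ intros k Lk. unfold shift_coef. rewrite (proj2 (Nat.leb_le k j)) by lia.
        replace (S (j - S k)) with (j - k)%nat by lia.
        rewrite Ropp_0, (pow_i (j - k)) by lia. unfold Rdiv. ring. }
    rewrite (rsum_zero _ (N - j)).
    2:{ intros i Li. unfold shift_coef. destruct i as [|i].
        - rewrite Nat.add_0_r, Nat.leb_refl, Nat.sub_diag. cbn. ring.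
        - rewrite (proj2 (Nat.leb_gt (j + S i) j)) by lia. ring. }
    unfold shift_coef, delta_coef. cbn [Nat.leb]. rewrite Nat.sub_0_r. lra.
Qed.

(** Telescoping, from 1/(x+1)^2 <= 1/x - 1/(x+1). *)
Lemma rsum_inv_square t n : rsum (fun i => (/ INR (t + i + 2)) ^ 2) n <= 1.
Proof.
  apply Rle_trans with (/ INR (t + 1) - / INR (t + n + 1)).
  - induction n as [|n IH]; cbn [rsum].
    + replace (t + 0)%nat with t by lia. lra.
    + assert (T : (/ INR (t + n + 2)) ^ 2 <= / INR (t + n + 1) - / INR (t + S n + 1)); [|lra].
      set (x := INR (t + n + 1)).
      replace (t + n + 2)%nat with (S (t + n + 1)) by lia.
      replace (t + S n + 1)%nat with (S (t + n + 1)) by lia. rewrite S_INR. fold x.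
      assert (Hx : 1 <= x) by (apply (le_INR 1); lia).
      replace (/ x - / (x + 1)) with (/ (x * (x + 1))) by (field; lra).
      replace ((/ (x + 1)) ^ 2) with (/ ((x + 1) * (x + 1))) by (field; lra).
      apply Rinv_le_contravar; nra.
  - assert (1 <= INR (t + 1)) by (apply (le_INR 1); lia).
    assert (0 < / INR (t + n + 1)) by (apply Rinv_0_lt_compat, lt_0_INR; lia).
    assert (/ INR (t + 1) <= / 1) by (apply Rinv_le_contravar; lra). lra.
Qed.

(** With X = h x and x = t + 2 the decay is X^(r - Re z0 - N), and X >= x >= 1 with the hypothesis
    on N turns it into x^(-q-2). Two of these powers are spent on summation; the other q remain for
    the tail. *)
Lemma em_rem_bound h a b N q z0 r :
  1 <= h -> 0 <= a <= h -> is_bernoulli h a b -> 0 < r ->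
  r - Re z0 + INR q + 2 <= INR N ->
  exists K, 0 <= K /\ forall t,
    amaj (fun z => em_rem h a b N z (h * INR (t + 2))) z0 r (K * (/ INR (t + 2)) ^ (q + 2)).
Proof.
  intros Hh Ha Hb Hr HN.
  destruct (em_rem_expansion h a b N ltac:(lra) Ha Hb) as (phi & Hphi & Hz).
  destruct (inv_expansion_decay h _ phi N z0 r ltac:(lra) Hr Hphi Hz) as (K & K0 & HK).
  exists K. split; [easy|]. intros t.
  assert (T2 : 2 <= INR (t + 2)) by (apply (le_INR 2); lia).
  set (x := INR (t + 2)) in *. set (X := h * x). assert (xX : x <= X) by (unfold X; nra).
  eapply amaj_weaken; [|apply (HK X)]; [|unfold X; nra|lra].
  apply Rmult_le_compat_l; [easy|].
  rewrite !pow_inv, <- !Rpower_pow by lra. unfold Rpower. rewrite <- !exp_Ropp, <- exp_plus.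
  assert (LX : 0 <= ln X) by (rewrite <- ln_1; left; apply ln_increasing; lra).
  assert (Lx : ln x <= ln X).
  { destruct (Req_dec x X) as [Ex|Nx]; [rewrite Ex; lra|]. left. apply ln_increasing; lra. }
  assert (Lx0 : 0 <= ln x) by (rewrite <- ln_1; left; apply ln_increasing; lra).
  assert (G : (r - Re z0) * ln X + - (INR N * ln X) <= - (INR (q + 2) * ln x)).
  { rewrite plus_INR. replace (INR 2) with 2 by (cbn; ring). assert (Q := pos_INR q).
    assert ((INR q + 2) * ln x <= (INR q + 2) * ln X) by (apply Rmult_le_compat_l; lra).
    assert ((r - Re z0 + INR q + 2) * ln X <= INR N * ln X) by (apply Rmult_le_compat_r; lra). lra. }
  destruct (Req_dec ((r - Re z0) * ln X + - (INR N * ln X)) (- (INR (q + 2) * ln x))) as [->|Ne]; [lra|].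
  left. apply exp_increasing. lra.
Qed.

Lemma em_rem_tail h a b N q z0 r (E : C -> C) :
  1 <= h -> 0 <= a <= h -> is_bernoulli h a b -> 0 < r ->
  r - Re z0 + INR q + 2 <= INR N ->
  (forall z, Cmod (z - z0) <= r ->
     ccv (csum (fun i => em_rem h a b N z (h * INR (i + 2)))) (E z)) ->
  exists K, 0 <= K /\ forall t,
    amaj (fun z => E z - csum (fun i => em_rem h a b N z (h * INR (i + 2))) t)%C z0 r
      (K * (/ INR (t + 2)) ^ q).
Proof.
  intros Hh Ha Hb Hr HN HE.
  destruct (em_rem_bound h a b N q z0 r Hh Ha Hb Hr HN) as (K & K0 & HK).
  exists K. split; [easy|]. intros t.
  apply amaj_series with (f := fun i z => em_rem h a b N z (h * INR (t + i + 2)))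
    (M := fun i => K * (/ INR (t + i + 2)) ^ (q + 2)).
  - exact Hr.
  - intros i. apply HK.
  - intros n. rewrite rsum_scal. apply Rmult_le_compat_l; [easy|].
    apply Rle_trans with ((/ INR (t + 2)) ^ q * rsum (fun i => (/ INR (t + i + 2)) ^ 2) n).
    + rewrite <- rsum_scal. apply rsum_le. intros i _. rewrite pow_add.
      assert (P : 0 < / INR (t + i + 2)) by (apply Rinv_0_lt_compat, lt_0_INR; lia).
      apply Rmult_le_compat_r; [apply pow_le; lra|]. apply pow_incr. split; [lra|].
      apply Rinv_le_contravar; [apply lt_0_INR; lia|apply le_INR; lia].
    + rewrite <- (Rmult_1_r ((/ INR (t + 2)) ^ q)) at 2. apply Rmult_le_compat_l; [|apply rsum_inv_square].
      apply pow_le. left. apply Rinv_0_lt_compat, lt_0_INR. lia.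
  - intros z Hz. apply ccv_ext with
      (fun n => csum (fun i => em_rem h a b N z (h * INR (i + 2))) (n + t)
        - csum (fun i => em_rem h a b N z (h * INR (i + 2))) t)%C.
    + intros n. rewrite Nat.add_comm, csum_add. ring.
    + apply ccv_minus; [|apply ccv_const].
      apply -> (ccv_shift (csum (fun i => em_rem h a b N z (h * INR (i + 2)))) (E z) t). now apply HE.
Qed.

(** The sum starts at X = 2 h, the least value that the expansions allow. *)
Definition em_sum (h a : R) (b : nat -> R) (N : nat) (z : C) : C :=
  epsilon (inhabits (RtoC 0)) (fun l => ccv (csum (fun i => em_rem h a b N z (h * INR (i + 2)))) l).

Lemma em_sum_cv h a b N z :
  1 <= h -> 0 <= a <= h -> is_bernoulli h a b -> 3 - Re z <= INR N ->
  ccv (csum (fun i => em_rem h a b N z (h * INR (i + 2)))) (em_sum h a b N z).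
Proof.
  intros Hh Ha Hb HN. unfold em_sum.
  apply (epsilon_spec _ (fun l => ccv (csum (fun i => em_rem h a b N z (h * INR (i + 2)))) l)).
  (* Radius 1 and q = 0 turn the requirement on N into 3 - Re z <= N. *)
  destruct (em_rem_bound h a b N 0 z 1 Hh Ha Hb ltac:(lra) ltac:(cbn; lra)) as (K & K0 & HK).
  apply abs_cv with K. intros n.
  apply Rle_trans with (K * rsum (fun i => (/ INR (0 + i + 2)) ^ 2) n).
  - rewrite <- rsum_scal. apply rsum_le. intros i _.
    apply (amaj_bound _ z 1 _ z (HK i)). rewrite Cmod_center. lra.
  - assert (T := rsum_inv_square 0 n). nra.
Qed.

Lemma Re_ge_of_disc z z0 r : Cmod (z - z0) <= r -> Re z0 - r <= Re z.
Proof.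
  intros H. assert (T := re_le_Cmod (z - z0)).
  assert (E : Re (z - z0) = Re z - Re z0) by (unfold Re; cbn; ring).
  rewrite E in T. assert (T2 := Rabs_maj2 (Re z - Re z0)). lra.
Qed.

Lemma Cpower_cv0 h z :
  0 < h -> 0 < Re z -> ccv (fun t => Rpos_Cpower (h * INR (t + 2)) (- z)) 0.
Proof.
  intros Hh Hz. apply ccv_eps. intros eps He.
  destruct (INR_unbounded (exp (- ln eps / Re z) / h)) as [N HN]. exists N. intros t Ht.
  replace (Rpos_Cpower (h * INR (t + 2)) (- z) - 0)%C with (Rpos_Cpower (h * INR (t + 2)) (- z)) by ring.
  rewrite Cmod_Cpower. replace (Re (- z)) with (- Re z) by reflexivity.
  assert (L : INR N < INR (t + 2)) by (apply lt_INR; lia).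
  assert (L2 : exp (- ln eps / Re z) < h * INR (t + 2)).
  { apply Rlt_trans with (h * INR N); [|now apply Rmult_lt_compat_l].
    apply Rgt_lt in HN. apply Rlt_div_l in HN; lra. }
  apply ln_increasing in L2; [|apply exp_pos]. rewrite ln_exp in L2.
  rewrite <- (exp_ln eps) by easy. apply exp_increasing.
  apply Rlt_div_l in L2; [|lra]. lra.
Qed.

(** The terms l = 0 and l = 1, then Euler-Maclaurin from X = 2 h on, with [polar_term h z (2 * h)],
    the part singular at z = 1, left out. *)
Definition hurwitz_reg_N (h a : R) (b : nat -> R) (N : nat) (z : C) : C :=
  (Rpos_Cpower a (- z) + Rpos_Cpower (h + a) (- z) + em_poly b N z (2 * h) - em_sum h a b N z)%C.

(** Raising N adds to the remainder the differences of [em_term b N]. They telescope to its value at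
    2 h, because it vanishes at infinity when Re z + N > 0, and [em_poly] gains exactly that
    value. *)
Lemma hurwitz_reg_N_S h a b N z :
  1 <= h -> 0 <= a <= h -> is_bernoulli h a b -> 3 - Re z <= INR N ->
  hurwitz_reg_N h a b (S N) z = hurwitz_reg_N h a b N z.
Proof.
  intros Hh Ha Hb HN.
  assert (C1 := em_sum_cv h a b N z Hh Ha Hb HN).
  assert (C2 := em_sum_cv h a b (S N) z Hh Ha Hb ltac:(rewrite S_INR; lra)).
  assert (D : (em_sum h a b (S N) z - em_sum h a b N z)%C = em_term b N z (2 * h)).
  { apply (ccv_unique _ _ _ (ccv_minus _ _ _ _ C2 C1)).
    apply ccv_ext with (fun t => em_term b N z (2 * h) - em_term b N z (h * INR (t + 2)))%C.
    - intros t. rewrite <- csum_minus.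
      assert (T := csum_telescope (fun i => em_term b N z (h * INR (i + 2))) t).
      cbn beta in T. replace (h * INR (0 + 2)) with (2 * h) in T by (cbn; ring).
      rewrite <- T. apply csum_ext. intros i _. unfold em_rem, em_poly. cbn [csum].
      replace (h * INR (S i + 2)) with (h * INR (i + 2) + h) by (replace (S i + 2)%nat with (S (i + 2)) by lia; rewrite S_INR; ring).
      ring.
    - assert (Z : ccv (fun t => em_term b N z (h * INR (t + 2))) 0).
      { replace (RtoC 0) with (RtoC (b (S N)) * poch z N * 0)%C by ring.
        eapply ccv_ext; [|apply ccv_scal, (Cpower_cv0 h (z + RtoC (INR N)))].
        - intros t. unfold em_term. ring.
        - lra.
        - unfold Re in *. cbn. lra. }
      assert (G := ccv_minus _ _ _ _ (ccv_const (em_term b N z (2 * h))) Z).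
      replace (em_term b N z (2 * h) - 0)%C with (em_term b N z (2 * h)) in G by ring. exact G. }
  unfold hurwitz_reg_N, em_poly. cbn [csum]. rewrite <- D. ring.
Qed.

Definition nat_above (x : R) : nat := epsilon (inhabits O) (fun N => x <= INR N).

Lemma nat_above_spec x : x <= INR (nat_above x).
Proof.
  apply (epsilon_spec (inhabits O) (fun N => x <= INR N)).
  destruct (INR_unbounded x) as [N HN]. exists N. lra.
Qed.

(* sum_(l >= 0) (h l + a)^(-z) minus its polar part at z = 1, continued to C *)
Definition hurwitz_reg (h a : R) (b : nat -> R) (z : C) : C :=
  hurwitz_reg_N h a b (nat_above (3 - Re z)) z.

(** The N chosen in the definition varies with z; independence of N lets a single N serve a whole
    disc, as analyticity requires. *)
Lemma hurwitz_reg_eq h a b N z :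
  1 <= h -> 0 <= a <= h -> is_bernoulli h a b -> 3 - Re z <= INR N ->
  hurwitz_reg h a b z = hurwitz_reg_N h a b N z.
Proof.
  intros Hh Ha Hb HN. unfold hurwitz_reg. set (N0 := nat_above (3 - Re z)).
  assert (HN0 : 3 - Re z <= INR N0) by apply nat_above_spec.
  assert (Up : forall n k, 3 - Re z <= INR n -> hurwitz_reg_N h a b (n + k) z = hurwitz_reg_N h a b n z).
  { intros n k Hn. induction k as [|k IH]; [now rewrite Nat.add_0_r|].
    rewrite Nat.add_succ_r, hurwitz_reg_N_S; auto. rewrite plus_INR. assert (T := pos_INR k). lra. }
  destruct (Nat.le_ge_cases N0 N) as [L|L].
  - replace N with (N0 + (N - N0))%nat by lia. now rewrite Up.
  - replace N0 with (N + (N0 - N))%nat by lia. now rewrite Up.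
Qed.

Lemma amaj_em_term b k z0 r X :
  1 <= X -> 0 <= r -> exists M, amaj (fun z => em_term b k z X) z0 r M.
Proof.
  intros HX Hr. assert (A := amaj_poch _ z0 r _ k Hr (amaj_Cpower X z0 r HX Hr)).
  apply (amaj_scal (RtoC (b (S k)) * RtoC ((/ X) ^ k))%C) in A.
  eexists. eapply amaj_ext; [|exact A].
  intros z _. unfold em_term. cbn beta. rewrite Cpower_shift by lra. ring.
Qed.

Lemma amaj_em_poly b N z0 r X :
  1 <= X -> 0 <= r -> exists M, amaj (fun z => em_poly b N z X) z0 r M.
Proof.
  intros HX Hr. unfold em_poly. induction N as [|N [M IH]].
  - exists (Cmod 0). exact (amaj_const 0 z0 r).
  - destruct (amaj_em_term b N z0 r X HX Hr) as [M' H]. exists (M + M').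
    exact (amaj_plus _ _ _ _ _ _ Hr IH H).
Qed.

Lemma hurwitz_reg_entire h a b z0 :
  1 <= h -> 1 <= a <= h -> is_bernoulli h a b ->
  exists M, amaj (hurwitz_reg h a b) z0 1 M.
Proof.
  intros Hh Ha Hb. assert (Ha' : 0 <= a <= h) by lra.
  destruct (INR_unbounded (4 - Re z0)) as [N HN].
  assert (Disc : forall z, Cmod (z - z0) <= 1 -> 3 - Re z <= INR N).
  { intros z Hz. apply Re_ge_of_disc in Hz. lra. }
  destruct (em_rem_tail h a b N 0 z0 1 (em_sum h a b N) Hh Ha' Hb ltac:(lra) ltac:(cbn; lra)
    (fun z Hz => em_sum_cv h a b N z Hh Ha' Hb (Disc z Hz))) as (K & K0 & HK).
  specialize (HK O). cbn [csum] in HK. apply (amaj_scal (-(1))) in HK.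
  destruct (amaj_em_poly b N z0 1 (2 * h) ltac:(lra) ltac:(lra)) as [M HM].
  assert (P1 := amaj_Cpower a z0 1 ltac:(lra) ltac:(lra)).
  assert (P2 := amaj_Cpower (h + a) z0 1 ltac:(lra) ltac:(lra)).
  assert (S := amaj_plus _ _ _ _ _ _ Rle_0_1 (amaj_plus _ _ _ _ _ _ Rle_0_1
    (amaj_plus _ _ _ _ _ _ Rle_0_1 P1 P2) HM) HK).
  eexists. eapply amaj_ext; [|exact S]. intros z Hz.
  rewrite (hurwitz_reg_eq h a b N z) by auto. unfold hurwitz_reg_N. cbn. ring.
Qed.

Definition polar_term (h : R) (z : C) (X : R) : C :=
  (RtoC (/ h) * (Rpos_Cpower X (1 - z) / (z - 1)))%C.

(** Exact for finite t. Telescope [em_poly] + [polar_term] from 2 h in steps of h: each step gives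
    (X + a)^(-z) plus the remainder, since [power_quotient] over h is the difference of the polar
    terms. *)
Lemma em_identity h a b N (z : C) t :
  0 < h -> z <> 1%C ->
  csum (fun l => Rpos_Cpower (h * INR l + a) (- z)) (t + 2)
  = (Rpos_Cpower a (- z) + Rpos_Cpower (h + a) (- z) + em_poly b N z (2 * h) + polar_term h z (2 * h)
     - em_poly b N z (h * INR (t + 2)) - polar_term h z (h * INR (t + 2))
     - csum (fun i => em_rem h a b N z (h * INR (i + 2))) t)%C.
Proof.
  intros Hh Hz. assert (Nz : (z - 1)%C <> 0%C)
    by (intros E; apply Hz; now apply C_minus_eq0).
  rewrite Nat.add_comm, csum_add. cbn [csum]. rewrite Rmult_0_r, Rplus_0_l, Rmult_1_r.
  assert (T := csum_telescope (fun i => em_poly b N z (h * INR (i + 2)) + polar_term h z (h * INR (i + 2)))%C t).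
  cbn beta in T. replace (h * INR (0 + 2)) with (2 * h) in T by (cbn; ring).
  rewrite (csum_ext _ (fun i => Rpos_Cpower (h * INR (2 + i) + a) (- z)
     + em_rem h a b N z (h * INR (i + 2)))%C) in T.
  2:{ intros i _. unfold em_rem, polar_term.
      assert (L : 2 <= INR (i + 2)) by (apply (le_INR 2); lia).
      assert (P := power_quotient_spec h z (h * INR (i + 2)) Hh ltac:(nra)).
      replace (h * INR (S i + 2)) with (h * INR (i + 2) + h) by (replace (S i + 2)%nat with (S (i + 2)) by lia; rewrite S_INR; ring).
      replace (2 + i)%nat with (i + 2)%nat by lia.
      replace (power_quotient h z (h * INR (i + 2))) with
        ((Rpos_Cpower (h * INR (i + 2)) (1 - z) - Rpos_Cpower (h * INR (i + 2) + h) (1 - z)) / (z - 1))%C.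
      - field. exact Nz.
      - rewrite <- P. field. exact Nz. }
  rewrite csum_plus in T.
  rewrite (Nat.add_comm 2 t).
  replace (csum (fun i => Rpos_Cpower (h * INR (2 + i) + a) (- z)) t) with
    (csum (fun i => Rpos_Cpower (h * INR (2 + i) + a) (- z)) t
      + csum (fun i => em_rem h a b N z (h * INR (i + 2))) t
      - csum (fun i => em_rem h a b N z (h * INR (i + 2))) t)%C by ring.
  rewrite T. ring.
Qed.

(** [W t] is the tail of the remainder series, delivered as a majorized function so that the
    identity can be differentiated with control of the error. The second bound on N covers the whole
    disc, where Re z >= Re z0 - 1. *)
Lemma em_formula h a b N q (z0 : C) :
  1 <= h -> 0 <= a <= h -> is_bernoulli h a b ->
  INR q + 3 - Re z0 <= INR N -> 4 - Re z0 <= INR N ->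
  exists K W, 0 <= K /\ forall t,
    amaj (W t) z0 1 (K * (/ INR (t + 2)) ^ q) /\
    forall z : C, Cmod (z - z0) <= 1 -> z <> 1%C ->
    csum (fun l => Rpos_Cpower (h * INR l + a) (- z)) (t + 2)
    = (hurwitz_reg h a b z + polar_term h z (2 * h)
       - em_poly b N z (h * INR (t + 2)) - polar_term h z (h * INR (t + 2)) + W t z)%C.
Proof.
  intros Hh Ha Hb HN1 HN2.
  assert (Disc : forall z, Cmod (z - z0) <= 1 -> 3 - Re z <= INR N).
  { intros z Hz. apply Re_ge_of_disc in Hz. lra. }
  destruct (em_rem_tail h a b N q z0 1 (em_sum h a b N) Hh Ha Hb ltac:(lra) ltac:(lra)
    (fun z Hz => em_sum_cv h a b N z Hh Ha Hb (Disc z Hz))) as (K & K0 & HK).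
  exists K. eexists. split; [exact K0|]. intros t. split; [apply HK|].
  intros z Hz Nz. rewrite (em_identity h a b N z t) by (auto; lra).
  rewrite (hurwitz_reg_eq h a b N z) by auto. unfold hurwitz_reg_N. ring.
Qed.

(** * Asymptotic expansions *)

Lemma is_lim_seq_ln_over : is_lim_seq (fun s => ln (INR s) / INR s) 0.
Proof.
  apply (is_lim_comp_seq (fun y => ln y / y) INR p_infty 0).
  - apply is_lim_div_ln_p.
  - exists O. intros n _. discriminate.
  - apply is_lim_seq_INR.
Qed.

Lemma is_lim_seq_inv_INR : is_lim_seq (fun s => / INR s) 0.
Proof.
  apply (is_lim_seq_inv INR p_infty); [apply is_lim_seq_INR|discriminate].
Qed.

(** After division by s the two terms with j = 0 tend to zero, so the induction hypothesis kills all
    higher coefficients. What is left is A_0 ln s + C_0 -> 0, and comparing s with 2 s gives A_0 ln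
    2 = 0. *)
Lemma log_poly_zero K : forall A C : nat -> R,
  is_lim_seq (fun s => rsum (fun j => (A j * ln (INR s) + C j) * INR s ^ j) K) 0 ->
  forall j, (j < K)%nat -> A j = 0 /\ C j = 0.
Proof.
  induction K as [|K IH]; intros A C H j Hj; [lia|].
  assert (IH' : forall i, (i < K)%nat -> A (S i) = 0 /\ C (S i) = 0).
  { apply (IH (fun i => A (S i)) (fun i => C (S i))).
    apply (is_lim_seq_incr_1 (fun s => rsum _ K)).
    apply is_lim_seq_ext with (fun s =>
      (/ INR (S s)) * rsum (fun j => (A j * ln (INR (S s)) + C j) * INR (S s) ^ j) (S K)
      + ((- A O) * (ln (INR (S s)) / INR (S s)) + (- C O) * / INR (S s))).
    { intros s. assert (P : 0 < INR (S s)) by (apply lt_0_INR; lia).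
      rewrite rsum_S_l.
      rewrite (rsum_ext (fun i => (A (S i) * ln (INR (S s)) + C (S i)) * INR (S s) ^ S i)
        (fun i => INR (S s) * ((A (S i) * ln (INR (S s)) + C (S i)) * INR (S s) ^ i)))
        by (intros; cbn [pow]; ring).
      rewrite rsum_scal, pow_O. field. lra. }
    apply lim0_plus.
    - apply (is_lim_seq_incr_1 (fun s => rsum (fun j => (A j * ln (INR s) + C j) * INR s ^ j) (S K))) in H.
      assert (I := proj1 (is_lim_seq_incr_1 _ _) is_lim_seq_inv_INR).
      replace (Finite 0) with (Finite (0 * 0)) by (f_equal; ring).
      now apply is_lim_seq_mult'.
    - apply lim0_plus; apply lim0_scal.
      + exact (proj1 (is_lim_seq_incr_1 _ _) is_lim_seq_ln_over).
      + exact (proj1 (is_lim_seq_incr_1 _ _) is_lim_seq_inv_INR). }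
  destruct j as [|j]; [|apply IH'; lia].
  assert (H0 : is_lim_seq (fun s => A O * ln (INR s) + C O) 0).
  { eapply is_lim_seq_ext; [|exact H]. intros s. cbn beta. rewrite rsum_S_l, rsum_zero; [cbn; ring|].
    intros i Hi. destruct (IH' i Hi) as [-> ->]. ring. }
  apply (is_lim_seq_incr_1 (fun s => A O * ln (INR s) + C O)) in H0.
  (* S (2 s + 1) = 2 (S s), so this is the sequence at doubled arguments. *)
  assert (H1 : is_lim_seq (fun s => A O * ln (INR (S (2 * s + 1))) + C O) 0).
  { apply (is_lim_seq_subseq (fun s => A O * ln (INR (S s)) + C O) 0 (fun s => 2 * s + 1)%nat); [|exact H0].
    apply eventually_subseq. intros n. lia. }
  assert (H2 : is_lim_seq (fun _ : nat => A O * ln 2) (0 - 0)).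
  { eapply is_lim_seq_ext; [|apply (is_lim_seq_minus' _ _ _ _ H1 H0)]. intros s. cbn beta.
    replace (S (2 * s + 1)) with (2 * S s)%nat by lia.
    rewrite mult_INR, ln_mult; [|cbn; lra|apply lt_0_INR; lia].
    replace (INR 2) with 2 by (cbn; ring). ring. }
  apply is_lim_seq_unique in H2. rewrite Lim_seq_const in H2. injection H2 as H2.
  assert (L2 : 0 < ln 2) by (rewrite <- ln_1; apply ln_increasing; lra).
  assert (A0 : A O = 0) by nra. split; [exact A0|].
  rewrite A0 in H0. apply is_lim_seq_ext with (v := fun _ => C O) in H0; [|intros; ring].
  apply is_lim_seq_unique in H0. rewrite Lim_seq_const in H0. now injection H0.
Qed.

Lemma csum_rev f n : csum f n = csum (fun i => f (n - S i)%nat) n.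
Proof.
  induction n as [|n IH]; [easy|]. rewrite (csum_S_l (fun i => f (S n - S i)%nat)). cbn [csum].
  rewrite IH, Nat.sub_succ, Nat.sub_0_r. rewrite Cplus_comm. f_equal.
Qed.

Lemma csum_pad (f : nat -> C) n K :
  (n <= K)%nat -> csum f n = csum (fun j => if Nat.ltb j n then f j else 0%C) K.
Proof.
  intros L. replace K with (n + (K - n))%nat by lia. rewrite csum_add.
  rewrite (csum_zero _ (K - n)), Cplus_0_r.
  - apply csum_ext. intros i Hi. now rewrite (proj2 (Nat.ltb_lt i n) Hi).
  - intros i _. now rewrite (proj2 (Nat.ltb_ge (n + i) n)) by lia.
Qed.

(** Precision o(1), that is N = 0, keeps only the exponents j >= 0 and already determines the
    constant term. Padding up to [K] lets expansions with different [J] be subtracted. *)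
Lemma asymptotic_expansion_0 f J a c K :
  (J < K)%nat -> asymptotic_expansion f J a c ->
  ccv (fun s => f s - csum (fun j => (if Nat.ltb j (S J) then a j else 0) * RtoC (ln (INR s)) * RtoC (INR s ^ j)
     + (if Nat.ltb j (S J) then c (Z.of_nat j) else 0) * RtoC (INR s ^ j)) K)%C 0.
Proof.
  intros L H. specialize (H O). unfold ccv. eapply is_lim_seq_ext; [|exact H].
  intros s. cbn beta. rewrite pow_O, Rmult_1_l, Nat.add_0_r, !sum_n_csum. f_equal.
  rewrite csum_plus.
  assert (E : csum (fun k => let j := (Z.of_nat J - Z.of_nat k)%Z in
      c j * RtoC (powerRZ (INR s) j))%C (S J) = csum (fun j => c (Z.of_nat j) * RtoC (INR s ^ j))%C (S J)).
  { rewrite csum_rev. apply csum_ext. intros i Hi. cbn zeta.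
    replace (Z.of_nat J - Z.of_nat (S J - S i))%Z with (Z.of_nat i) by lia.
    now rewrite pow_powerRZ. }
  rewrite E.
  rewrite (csum_pad (fun j => a j * _)%C (S J) K L), (csum_pad (fun j => c _ * _)%C (S J) K L).
  rewrite (csum_ext (fun j => if (j <? S J)%nat then a j * RtoC (INR s ^ j * ln (INR s)) else 0)%C
    (fun j => (if Nat.ltb j (S J) then a j else 0) * RtoC (ln (INR s)) * RtoC (INR s ^ j))%C).
  2:{ intros i _. destruct (Nat.ltb i (S J)); [rewrite RtoC_mult|]; ring. }
  rewrite (csum_ext (fun j => if (j <? S J)%nat then c (Z.of_nat j) * RtoC (INR s ^ j) else 0)%C
    (fun j => (if Nat.ltb j (S J) then c (Z.of_nat j) else 0) * RtoC (INR s ^ j))%C).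
  2:{ intros i _. destruct (Nat.ltb i (S J)); ring. }
  ring.
Qed.

Lemma constant_term_unique f v w : is_constant_term f v -> is_constant_term f w -> v = w.
Proof.
  intros (J & a & c & H & <-) (J' & a' & c' & H' & <-).
  set (K := S (Nat.max J J')).
  assert (L : (J < K)%nat) by lia. assert (L' : (J' < K)%nat) by lia.
  assert (D := ccv_minus _ _ _ _ (asymptotic_expansion_0 _ _ _ _ K L' H') (asymptotic_expansion_0 _ _ _ _ K L H)).
  set (A := fun j => ((if Nat.ltb j (S J) then a j else 0) - (if Nat.ltb j (S J') then a' j else 0))%C).
  set (B := fun j => ((if Nat.ltb j (S J) then c (Z.of_nat j) else 0)
    - (if Nat.ltb j (S J') then c' (Z.of_nat j) else 0))%C).
  assert (D1 : ccv (fun s => csum (fun j => (A j * RtoC (ln (INR s)) + B j) * RtoC (INR s ^ j)) K)%C 0).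
  { replace (RtoC 0) with (0 - 0)%C by ring. eapply ccv_ext; [|exact D]. intros s. cbn beta.
    match goal with |- (_ - ?x - (_ - ?y))%C = _ => replace (f s - x - (f s - y))%C with (y - x)%C by ring end.
    rewrite <- csum_minus. apply csum_ext. intros j _. unfold A, B. ring. }
  apply ccv_components in D1. destruct D1 as [D1 D2].
  assert (R1 : fst (B O) = 0).
  { apply (log_poly_zero K (fun j => fst (A j)) (fun j => fst (B j))); [|lia].
    eapply is_lim_seq_ext; [|exact D1]. intros s. cbn beta. rewrite csum_fst. apply rsum_ext.
    intros j _. cbn. ring. }
  assert (R2 : snd (B O) = 0).
  { apply (log_poly_zero K (fun j => snd (A j)) (fun j => snd (B j))); [|lia].
    eapply is_lim_seq_ext; [|exact D2]. intros s. cbn beta. rewrite csum_snd. apply rsum_ext.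
    intros j _. cbn. ring. }
  apply C_minus_eq0. change (c 0%Z - c' 0%Z)%C with (B O). rewrite (surjective_pairing (B O)), R1, R2. reflexivity.
Qed.

Lemma constant_term_eq f v : is_constant_term f v -> constant_term f = v.
Proof.
  intros H. apply (constant_term_unique f); [|exact H].
  exact (epsilon_spec _ (is_constant_term f) (ex_intro _ v H)).
Qed.

Lemma asymptotic_expansion_plus f g J a b c d :
  asymptotic_expansion f J a c -> asymptotic_expansion g J b d ->
  asymptotic_expansion (fun s => f s + g s)%C J (fun j => a j + b j)%C (fun j => c j + d j)%C.
Proof.
  intros Hf Hg N. specialize (Hf N). specialize (Hg N).
  eapply is_lim_seq_le_le; [|apply is_lim_seq_const|apply (lim0_plus _ _ Hf Hg)]. intros s. cbn beta.
  rewrite !sum_n_csum. assert (P : 0 <= INR s ^ N) by (apply pow_le, pos_INR). split.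
  - apply Rmult_le_pos; [easy|apply Cmod_ge_0].
  - rewrite <- Rmult_plus_distr_l. apply Rmult_le_compat_l; [easy|].
    eapply Rle_trans; [|apply Cmod_triangle]. right. f_equal.
    rewrite (csum_ext (fun j => (a j + b j) * _)%C
      (fun j => a j * RtoC (INR s ^ j * ln (INR s)) + b j * RtoC (INR s ^ j * ln (INR s)))%C) by (intros; ring).
    rewrite (csum_ext (fun k => let j := (Z.of_nat J - Z.of_nat k)%Z in (c j + d j) * _)%C
      (fun k => (let j := (Z.of_nat J - Z.of_nat k)%Z in c j * RtoC (powerRZ (INR s) j))
       + (let j := (Z.of_nat J - Z.of_nat k)%Z in d j * RtoC (powerRZ (INR s) j)))%C) by (intros; cbn zeta; ring).
    rewrite !csum_plus. cbn zeta. ring.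
Qed.

Lemma asymptotic_expansion_scal y f J a c :
  asymptotic_expansion f J a c ->
  asymptotic_expansion (fun s => y * f s)%C J (fun j => y * a j)%C (fun j => y * c j)%C.
Proof.
  intros Hf N. specialize (Hf N). apply (lim0_scal (Cmod y)) in Hf.
  eapply is_lim_seq_ext; [|exact Hf]. intros s. cbn beta. rewrite !sum_n_csum.
  rewrite <- Rmult_assoc, (Rmult_comm (Cmod y)), Rmult_assoc, <- Cmod_mult. do 2 f_equal.
  rewrite (csum_ext (fun j => y * a j * _)%C (fun j => y * (a j * RtoC (INR s ^ j * ln (INR s))))%C)
    by (intros; ring).
  rewrite (csum_ext (fun k => let j := (Z.of_nat J - Z.of_nat k)%Z in (y * c j) * _)%C
      (fun k => y * (let j := (Z.of_nat J - Z.of_nat k)%Z in c j * RtoC (powerRZ (INR s) j)))%C)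
    by (intros; cbn zeta; ring).
  rewrite !csum_scal. cbn zeta. ring.
Qed.

Lemma asymptotic_expansion_zero J : asymptotic_expansion (fun _ => 0%C) J (fun _ => 0%C) (fun _ => 0%C).
Proof.
  intros N. eapply is_lim_seq_ext; [|apply is_lim_seq_const]. intros s. cbn beta. rewrite !sum_n_csum.
  rewrite !csum_zero by (intros; cbn zeta; ring). replace (0 - 0 - 0)%C with (RtoC 0) by ring.
  rewrite Cmod_0. ring.
Qed.

Lemma asymptotic_expansion_csum (f : nat -> nat -> C) J (v : nat -> C) m :
  (forall i, (i < m)%nat -> exists a c, asymptotic_expansion (f i) J a c /\ c 0%Z = v i) ->
  exists a c, asymptotic_expansion (fun s => csum (fun i => f i s) m) J a c /\ c 0%Z = csum v m.
Proof.
  induction m as [|m IH]; intros H.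
  - exists (fun _ => 0%C), (fun _ => 0%C). split; [apply asymptotic_expansion_zero|reflexivity].
  - destruct IH as (a & c & Hac & E); [intros; apply H; lia|].
    destruct (H m ltac:(lia)) as (b & d & Hbd & E').
    exists (fun j => a j + b j)%C, (fun j => c j + d j)%C. split.
    + now apply asymptotic_expansion_plus.
    + cbn. now rewrite E, E'.
Qed.

(** * Values at z = -n and differentiation of the expansion *)

Fixpoint dpoch (z : C) (k : nat) : C :=
  match k with O => 0%C | S j => (dpoch z j * (z + RtoC (INR j)) + poch z j)%C end.

Lemma cder_poch z0 k : cder (fun z => poch z k) z0 (dpoch z0 k).
Proof.
  induction k as [|k IH]; [exact (cder_const 1 z0)|].
  assert (H := cder_mult _ _ _ _ _ IH (cder_shift (RtoC (INR k)) z0)).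
  replace (dpoch z0 (S k)) with (dpoch z0 k * (z0 + RtoC (INR k)) + poch z0 k * 1)%C
    by (cbn -[INR]; ring). exact H.
Qed.

Lemma dpoch_S_l z k : dpoch z (S k) = (poch (z + 1) k + z * dpoch (z + 1) k)%C.
Proof.
  induction k as [|k IH]; [cbn; ring|].
  change (dpoch z (S (S k))) with (dpoch z (S k) * (z + RtoC (INR (S k))) + poch z (S k))%C.
  rewrite IH, poch_S_l. change (poch (z + 1) (S k)) with (poch (z + 1) k * (z + 1 + RtoC (INR k)))%C.
  change (dpoch (z + 1) (S k)) with (dpoch (z + 1) k * (z + 1 + RtoC (INR k)) + poch (z + 1) k)%C.
  rewrite S_INR, RtoC_plus. ring.
Qed.

Lemma opp_INR_S n : (RtoC (- INR (S n)) + 1)%C = RtoC (- INR n).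
Proof. rewrite <- RtoC_plus, S_INR. f_equal. ring. Qed.

Lemma poch_neg_full n : poch (RtoC (- INR n)) n = (RtoC (-1) ^ n * RtoC (INR (fact n)))%C.
Proof.
  induction n as [|n IH]; [cbn; ring|].
  rewrite poch_S_l, opp_INR_S, IH, fact_simpl, mult_INR, RtoC_opp, RtoC_mult. cbn [Cpow].
  change (-1) with (- (1)). rewrite RtoC_opp. ring.
Qed.

(** Makes the coefficient of s^(n+1-k) log s vanish for k > n + 1, so that log s never multiplies a
    negative power of s. *)
Lemma poch_neg_zero n k : (n < k)%nat -> poch (RtoC (- INR n)) k = 0%C.
Proof.
  intros L. replace k with (S n + (k - S n))%nat by lia. rewrite poch_add. cbn [poch].
  rewrite <- RtoC_plus. replace (- INR n + INR n) with 0 by ring. ring.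
Qed.

Lemma harmonic_S n : harmonic (S n) = harmonic n + / INR (S n).
Proof. unfold harmonic. rewrite !sum_1_rsum. reflexivity. Qed.

(** With D_n the left side, [dpoch_S_l] gives D_(n+1) = (-n)_n - (n+1) D_n; after division by (-1)^n
    (n+1)! the first term contributes the new summand 1/(n+1) of the harmonic number. *)
Lemma dpoch_neg_full n :
  dpoch (RtoC (- INR n)) n
  = (RtoC (-1) ^ (n + 1) * RtoC (INR (fact n)) * RtoC (harmonic n))%C.
Proof.
  induction n as [|n IH].
  - unfold harmonic. rewrite sum_1_rsum. cbn. ring.
  - rewrite dpoch_S_l, opp_INR_S, IH, poch_neg_full, fact_simpl, mult_INR, harmonic_S.
    assert (N : RtoC (INR (S n)) <> 0%C) by (intros E; apply RtoC_inj in E; now apply (not_0_INR (S n))).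
    rewrite RtoC_plus, RtoC_inv by now apply not_0_INR.
    rewrite RtoC_opp, RtoC_mult, !Nat.add_1_r. cbn [Cpow]. change (-1) with (- (1)). rewrite RtoC_opp.
    field. exact N.
Qed.

(** That 1 / (z - c) has some derivative follows from its power series; the value follows from
    differentiating (z - c) (1 / (z - c)) = 1. *)
Lemma cder_div_linear f z0 d c :
  z0 <> c -> cder f z0 d ->
  cder (fun z => f z / (z - c))%C z0 (d / (z0 - c) - f z0 / ((z0 - c) * (z0 - c)))%C.
Proof.
  intros Nc Hf.
  assert (N : (z0 - c)%C <> 0%C) by (intros E; apply Nc; now apply C_minus_eq0).
  assert (P : 0 < Cmod (z0 - c)) by now apply Cmod_gt_0.
  assert (A := amaj_div_linear _ z0 (Cmod (z0 - c) / 2) _ c ltac:(lra) (amaj_const 1 z0 (Cmod (z0 - c) / 2))).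
  apply amaj_cder in A; [|lra]. destruct A as (e & He & _).
  assert (E : (1 * (1 / (z0 - c)) + (z0 - c) * e)%C = 0%C).
  { apply (cder_unique (fun z => (z + - c) * (1 / (z - c)))%C z0).
    - apply (cder_mult (fun z => z + - c)%C (fun z => 1 / (z - c))%C); [apply cder_shift|exact He].
    - apply (cder_ext_loc (fun _ => 1%C)) with (rho := Cmod (z0 - c)); [easy| |apply cder_const].
      intros z Hz. assert (Nz : (z - c)%C <> 0%C).
      { intros F. apply C_minus_eq0 in F. subst z. rewrite Cmod_minus_sym in Hz. lra. }
      change (z + - c)%C with (z - c)%C. field. exact Nz. }
  assert (Ee : e = (- (1) / ((z0 - c) * (z0 - c)))%C).
  { apply C_minus_eq0.
    replace (e - - (1) / ((z0 - c) * (z0 - c)))%C with ((1 * (1 / (z0 - c)) + (z0 - c) * e) / (z0 - c))%C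
      by (field; exact N). rewrite E. field. exact N. }
  assert (M := cder_mult _ _ _ _ _ Hf He). rewrite Ee in M.
  replace (d / (z0 - c) - f z0 / ((z0 - c) * (z0 - c)))%C with
    (d * (1 / (z0 - c)) + f z0 * (- (1) / ((z0 - c) * (z0 - c))))%C by (field; exact N).
  eapply cder_ext; [|exact M]. intros z. cbn beta. unfold Cdiv. ring.
Qed.

Lemma cder_em_term b k X z0 :
  0 < X ->
  cder (fun z => em_term b k z X) z0
    (RtoC (b (S k)) * (dpoch z0 k - poch z0 k * RtoC (ln X)) * (Rpos_Cpower X (- z0) * RtoC ((/ X) ^ k)))%C.
Proof.
  intros HX.
  assert (M := cder_scal (RtoC (b (S k)) * RtoC ((/ X) ^ k))%C _ _ _
    (cder_mult _ _ _ _ _ (cder_poch z0 k) (cder_Cpower X z0))).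
  match type of M with cder _ _ ?d => replace (_ * _ * _)%C with d end.
  - eapply cder_ext; [|exact M]. intros z. unfold em_term. rewrite Cpower_shift by easy. ring.
  - rewrite RtoC_opp. ring.
Qed.

Lemma Cpower_1_minus X z : 0 < X -> Rpos_Cpower X (1 - z) = (RtoC X * Rpos_Cpower X (- z))%C.
Proof.
  intros HX. unfold Cminus. rewrite Cpower_plus. f_equal. rewrite <- (pow_1 X) at 2.
  rewrite <- Cpower_nat by easy. reflexivity.
Qed.

Lemma cder_polar_term h X (z0 : C) :
  0 < X -> z0 <> 1%C ->
  cder (fun z => polar_term h z X) z0
    (RtoC (/ h) * (- RtoC (ln X) / (z0 - 1) - 1 / ((z0 - 1) * (z0 - 1))) * (RtoC X * Rpos_Cpower X (- z0)))%C.
Proof.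
  intros HX N.
  assert (Nz : (z0 - 1)%C <> 0%C) by (intros E; apply N; now apply C_minus_eq0).
  assert (M := cder_scal (RtoC (/ h)) _ _ _ (cder_div_linear _ _ _ 1 N (cder_scal (RtoC X) _ _ _ (cder_Cpower X z0)))).
  match type of M with cder _ _ ?d => replace (_ * _ * _)%C with d end.
  - eapply cder_ext; [|exact M]. intros z. unfold polar_term. now rewrite Cpower_1_minus.
  - rewrite RtoC_opp. field. exact Nz.
Qed.

Lemma Cpower_neg_arg X n : 0 < X -> Rpos_Cpower X (- RtoC (- INR n)) = RtoC (X ^ n).
Proof. intros HX. rewrite <- RtoC_opp, Ropp_involutive. now apply Cpower_nat. Qed.

Lemma csum_single (f : nat -> C) k n :
  (k < n)%nat -> (forall i, i <> k -> f i = 0%C) -> csum f n = f k.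
Proof.
  intros L H. replace n with (k + S (n - S k))%nat by lia.
  rewrite csum_add, csum_zero, csum_S_l, csum_zero, Nat.add_0_r; [ring| |]; intros; apply H; lia.
Qed.

Lemma pow_inv_cancel x i j : 0 < x -> (i <= j)%nat -> x ^ (j - i) = x ^ j * (/ x) ^ i.
Proof.
  intros Hx L. replace (x ^ j) with (x ^ (j - i) * x ^ i) by (rewrite <- pow_add; f_equal; lia).
  rewrite Rmult_assoc, <- Rpow_mult_distr, Rinv_r, pow1 by lra. ring.
Qed.

Lemma powerRZ_sub x i j : 0 < x -> powerRZ x (Z.of_nat j - Z.of_nat i) = x ^ j * (/ x) ^ i.
Proof.
  intros Hx. unfold Z.sub. rewrite powerRZ_add by lra. rewrite powerRZ_neg', <- !pow_powerRZ by lra.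
  now rewrite pow_inv.
Qed.

Lemma opp_INR_ne_1 n : RtoC (- INR n) <> 1%C.
Proof. intros E. apply RtoC_inj in E. assert (T := pos_INR n). lra. Qed.

(* Coefficients of s^(n+1-k) log s and of s^(n+1-k) in the expansion of
   sum_(l < s) (h l + a)^n log (h l + a); the index 0 is the polar term. *)
Definition log_coef (h : R) (b : nat -> R) (n k : nat) : C :=
  match k with
  | O => (RtoC (/ h) * RtoC (h ^ (n + 1)) / RtoC (INR (n + 1)))%C
  | S k => (- RtoC (b (S k)) * poch (RtoC (- INR n)) k * RtoC (h ^ n * (/ h) ^ k))%C
  end.

Definition pow_coef (h : R) (b : nat -> R) (n k : nat) : C :=
  match k with
  | O => (RtoC (/ h) * (RtoC (ln h) / RtoC (INR (n + 1)) - 1 / (RtoC (INR (n + 1)) * RtoC (INR (n + 1))))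
          * RtoC (h ^ (n + 1)))%C
  | S k => (RtoC (b (S k)) * (dpoch (RtoC (- INR n)) k - poch (RtoC (- INR n)) k * RtoC (ln h))
          * RtoC (h ^ n * (/ h) ^ k))%C
  end.

(** Differentiate [em_formula] at z = -n. The derivative of X^(-z) is - ln X X^(-z), so all signs
    flip; [w] is the derivative of the tail at the centre, bounded through [amaj_cder]. *)
Lemma log_sum_formula h a b n d N q :
  1 <= h -> 1 <= a <= h -> is_bernoulli h a b ->
  cder (fun z => hurwitz_reg h a b z + polar_term h z (2 * h))%C (RtoC (- INR n)) d ->
  INR q + 3 + INR n <= INR N -> 4 + INR n <= INR N ->
  exists K, 0 <= K /\ forall t, exists w : C, Cmod w <= K * (/ INR (t + 2)) ^ q /\
    csum (fun l => RtoC ((h * INR l + a) ^ n * ln (h * INR l + a))) (t + 2)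
    = (- d + csum (fun k => (log_coef h b n k * RtoC (ln (INR (t + 2))) + pow_coef h b n k)
         * RtoC (INR (t + 2) ^ (n + 1) * (/ INR (t + 2)) ^ k)) (S N) - w)%C.
Proof.
  intros Hh Ha Hb Hd HN1 HN2. set (z0 := RtoC (- INR n)) in *.
  assert (Rz0 : Re z0 = - INR n) by reflexivity.
  destruct (em_formula h a b N q z0 Hh ltac:(lra) Hb ltac:(lra) ltac:(lra)) as (K & W & K0 & HW).
  exists K. split; [easy|]. intros t. destruct (HW t) as [AW EW].
  destruct (amaj_cder _ _ _ _ Rlt_0_1 AW) as (w & Hw & Bw). exists w.
  split; [rewrite Rdiv_1_r in Bw; exact Bw|].
  set (s := INR (t + 2)) in *. assert (s2 : 2 <= s) by (apply (le_INR 2); lia).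
  set (X := h * s) in *. assert (X0 : 0 < X) by (unfold X; nra).
  assert (D1 : cder (fun z => csum (fun l => Rpos_Cpower (h * INR l + a) (- z)) (t + 2)) z0
    (csum (fun l => RtoC (- ln (h * INR l + a)) * Rpos_Cpower (h * INR l + a) (- z0))%C (t + 2))).
  { apply (cder_csum (fun l z => Rpos_Cpower (h * INR l + a) (- z))). intros i _. apply cder_Cpower. }
  assert (D2 := cder_plus _ _ _ _ _ (cder_minus _ _ _ _ _ (cder_minus _ _ _ _ _ Hd
    (cder_csum (fun k z => em_term b k z X) z0 _ N (fun k _ => cder_em_term b k X z0 X0)))
    (cder_polar_term h X z0 X0 (opp_INR_ne_1 n))) Hw).
  apply (cder_ext_loc _ (fun z => csum (fun l => Rpos_Cpower (h * INR l + a) (- z)) (t + 2)) _ _ 1 Rlt_0_1) in D2.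
  (* The point 1, at distance n + 1 >= 1 from -n, lies outside the open unit disc. *)
  2:{ intros z Hz. symmetry. apply EW; [lra|]. intros ->.
      assert (T := re_le_Cmod (1 - z0)). assert (E : Re (1 - z0) = 1 + INR n) by (cbn; ring).
      rewrite E in T. assert (P := pos_INR n). rewrite Rabs_pos_eq in T by lra. lra. }
  assert (E := cder_unique _ _ _ _ D1 D2). clear D1 D2.
  assert (E1 : csum (fun l => RtoC ((h * INR l + a) ^ n * ln (h * INR l + a))) (t + 2)
    = (- csum (fun l => RtoC (- ln (h * INR l + a)) * Rpos_Cpower (h * INR l + a) (- z0)) (t + 2))%C).
  { replace (- csum _ _)%C with (- (1) * csum (fun l => RtoC (- ln (h * INR l + a)) * Rpos_Cpower (h * INR l + a) (- z0)) (t + 2))%C by ring.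
    rewrite <- csum_scal. apply csum_ext. intros l _.
    assert (0 < h * INR l + a) by (assert (P := pos_INR l); nra).
    unfold z0. rewrite Cpower_neg_arg by easy. rewrite RtoC_mult, RtoC_opp. ring. }
  rewrite E1, E. clear E1 E. assert (EX : Rpos_Cpower X (- z0) = RtoC (X ^ n)) by now apply Cpower_neg_arg.
  rewrite EX.
  assert (LX : RtoC (ln X) = (RtoC (ln h) + RtoC (ln s))%C).
  { unfold X. rewrite ln_mult, RtoC_plus by lra. reflexivity. }
  assert (N1 : RtoC (INR (n + 1)) <> 0%C).
  { intros F. apply RtoC_inj in F. apply (not_0_INR (n + 1)); [lia|exact F]. }
  rewrite csum_S_l.
  match goal with |- (- (d - ?x - ?y + w))%C = (- d + (?u + ?v) - w)%C =>
    assert (Ex : x = v); [|assert (Ey : y = u); [|rewrite Ex, Ey; ring]] end.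
  - apply csum_ext. intros k _. cbn [log_coef pow_coef]. fold z0. rewrite LX.
    replace (RtoC (X ^ n) * RtoC ((/ X) ^ k))%C
      with (RtoC (h ^ n * (/ h) ^ k) * RtoC (s ^ (n + 1) * (/ s) ^ S k))%C; [ring|].
    rewrite <- !RtoC_mult. f_equal. unfold X. rewrite Rinv_mult, !Rpow_mult_distr, pow_add.
    cbn [pow]. field. lra.
  - cbn [log_coef pow_coef]. rewrite LX.
    replace (RtoC X * RtoC (X ^ n))%C with (RtoC (h ^ (n + 1)) * RtoC (s ^ (n + 1) * (/ s) ^ 0))%C.
    2:{ rewrite <- !RtoC_mult. f_equal. unfold X. rewrite Rpow_mult_distr, !pow_add. cbn [pow]. ring. }
    replace (z0 - 1)%C with (- RtoC (INR (n + 1)))%C.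
    2:{ unfold z0. rewrite plus_INR, !RtoC_opp, RtoC_plus. cbn. ring. }
    field. exact N1.
Qed.

(** The constant term collects - d, which carries no power of s, and the entry of [pow_coef] at
    index n + 1, where the powers of h cancel. *)
Lemma log_sum_expansion h a b n d :
  1 <= h -> 1 <= a <= h -> is_bernoulli h a b ->
  cder (fun z => hurwitz_reg h a b z + polar_term h z (2 * h))%C (RtoC (- INR n)) d ->
  exists A c,
    asymptotic_expansion
      (fun s => csum (fun l => RtoC ((h * INR l + a) ^ n * ln (h * INR l + a))) s) (n + 1) A c /\
    c 0%Z = (- d + RtoC (b (S n)) * (dpoch (RtoC (- INR n)) n - poch (RtoC (- INR n)) n * RtoC (ln h)))%C.
Proof.
  intros Hh Ha Hb Hd.
  exists (fun j => log_coef h b n (n + 1 - j)),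
    (fun j => pow_coef h b n (Z.to_nat (Z.of_nat (n + 1) - j)) + (if Z.eqb j 0 then - d else 0))%C.
  split.
  2:{ rewrite Z.sub_0_r, Nat2Z.id, Nat.add_1_r. cbn [pow_coef]. rewrite <- Rpow_mult_distr, Rinv_r, pow1 by lra.
      cbn. ring. }
  (* One power beyond the required precision makes the tail O(1/s) after multiplication by s^Nd. [M]
     is slack that meets both lower bounds on N; the M surplus powers go into [B]. *)
  intros Nd. set (q := S Nd). set (M := 8%nat). set (N := (n + 1 + Nd + M)%nat).
  destruct (log_sum_formula h a b n d N q Hh Ha Hb Hd) as (K & K0 & HK).
  { unfold q, N, M. rewrite S_INR, !plus_INR. assert (P := pos_INR n). cbn. lra. }
  { unfold N, M. rewrite !plus_INR. assert (P := pos_INR Nd). cbn. lra. }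
  set (L := (n + 1 + Nd + 1)%nat).
  set (B := rsum (fun i => Cmod (pow_coef h b n (L + i))) M).
  (* The formula is available for t + 2 terms, hence the shift by 2. *)
  apply (is_lim_seq_incr_n _ 2).
  apply is_lim_seq_le_le with (u := fun _ => 0) (w := fun t => (B + K) * / INR (t + 2)).
  2: apply is_lim_seq_const.
  2:{ apply lim0_scal. exact (proj1 (is_lim_seq_incr_n _ 2 _) is_lim_seq_inv_INR). }
  intros t. destruct (HK t) as (w & Bw & Ew). set (s := INR (t + 2)) in *.
  assert (s2 : 2 <= s) by (apply (le_INR 2); lia).
  assert (P1 : 0 <= s ^ Nd) by (apply pow_le; lra).
  split; [apply Rmult_le_pos; [easy|apply Cmod_ge_0]|].
  rewrite !sum_n_csum, Ew.
  assert (S1 : csum (fun j => log_coef h b n (n + 1 - j) * RtoC (s ^ j * ln s))%C (S (n + 1))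
    = csum (fun k => log_coef h b n k * RtoC (ln s) * RtoC (s ^ (n + 1) * (/ s) ^ k))%C (S (n + 1))).
  { rewrite csum_rev. apply csum_ext. intros i Hi.
    replace (n + 1 - (S (n + 1) - S i))%nat with i by lia.
    replace (S (n + 1) - S i)%nat with (n + 1 - i)%nat by lia.
    rewrite (pow_inv_cancel s i (n + 1)) by (lra || lia). rewrite RtoC_mult. ring. }
  assert (S2 : csum (fun k => let j := (Z.of_nat (n + 1) - Z.of_nat k)%Z in
      (pow_coef h b n (Z.to_nat (Z.of_nat (n + 1) - j)) + (if Z.eqb j 0 then - d else 0))
      * RtoC (powerRZ s j))%C L
    = (csum (fun k => pow_coef h b n k * RtoC (s ^ (n + 1) * (/ s) ^ k)) L - d)%C).
  { replace (csum (fun k => pow_coef h b n k * RtoC (s ^ (n + 1) * (/ s) ^ k)) L - d)%C with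
      (csum (fun k => pow_coef h b n k * RtoC (s ^ (n + 1) * (/ s) ^ k)) L
       + csum (fun k => if Nat.eqb k (n + 1) then - d else 0) L)%C.
    - rewrite <- csum_plus. apply csum_ext. intros k _. cbn zeta.
      replace (Z.of_nat (n + 1) - (Z.of_nat (n + 1) - Z.of_nat k))%Z with (Z.of_nat k) by lia.
      rewrite Nat2Z.id, <- powerRZ_sub by lra.
      destruct (Nat.eqb_spec k (n + 1)) as [->|Nk].
      + rewrite Z.sub_diag. cbn. ring.
      + rewrite (proj2 (Z.eqb_neq _ 0)) by lia. ring.
    - rewrite (csum_single (fun k => if Nat.eqb k (n + 1) then - d else 0)%C (n + 1)).
      + rewrite Nat.eqb_refl. ring.
      + unfold L. lia.
      + intros i Hi. now rewrite (proj2 (Nat.eqb_neq i (n + 1)) Hi). }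
  rewrite S1. replace (S (n + 1 + Nd)) with L by (unfold L; lia). rewrite S2. clear S1 S2.
  replace (S N) with (L + M)%nat by (unfold N, L; lia).
  rewrite (csum_ext (fun k => (log_coef h b n k * RtoC (ln s) + pow_coef h b n k) * RtoC (s ^ (n + 1) * (/ s) ^ k))%C
    (fun k => log_coef h b n k * RtoC (ln s) * RtoC (s ^ (n + 1) * (/ s) ^ k)
      + pow_coef h b n k * RtoC (s ^ (n + 1) * (/ s) ^ k))%C) by (intros; ring).
  rewrite csum_plus, (csum_add (fun k => pow_coef h b n k * _)%C L M).
  replace (csum (fun k => log_coef h b n k * RtoC (ln s) * RtoC (s ^ (n + 1) * (/ s) ^ k))%C (L + M))
    with (csum (fun k => log_coef h b n k * RtoC (ln s) * RtoC (s ^ (n + 1) * (/ s) ^ k))%C (S (n + 1))).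
  2:{ replace (L + M)%nat with (S (n + 1) + (Nd + M))%nat by (unfold L; lia).
      rewrite (csum_add _ (S (n + 1))), (csum_zero _ (Nd + M)); [ring|].
      intros i _. cbn [Nat.add log_coef]. rewrite poch_neg_zero by lia. ring. }
  match goal with |- _ * Cmod (- d + (?u + (?v + ?x)) - w - ?u - (?v - d)) <= _ =>
    replace (- d + (u + (v + x)) - w - u - (v - d))%C with (x + - w)%C by ring end.
  apply Rle_trans with (s ^ Nd * (B * (/ s) ^ (Nd + 1) + K * (/ s) ^ q)).
  - apply Rmult_le_compat_l; [easy|]. eapply Rle_trans; [apply Cmod_triangle|]. rewrite Cmod_opp.
    apply Rplus_le_compat; [|exact Bw]. eapply Rle_trans; [apply Cmod_csum|].
    unfold B. rewrite Rmult_comm, <- rsum_scal. apply rsum_le. intros i _.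
    rewrite Cmod_mult, Cmod_R.
    assert (Is : 0 < / s <= 1).
    { split; [apply Rinv_0_lt_compat; lra|]. rewrite <- Rinv_1. apply Rinv_le_contravar; lra. }
    replace (s ^ (n + 1) * (/ s) ^ (L + i)) with ((/ s) ^ (Nd + 1 + i)).
    2:{ replace (L + i)%nat with (n + 1 + (Nd + 1 + i))%nat by (unfold L; lia).
        rewrite (pow_add (/ s) (n + 1)), <- Rmult_assoc, <- Rpow_mult_distr, Rinv_r, pow1 by lra. ring. }
    rewrite Rabs_pos_eq by (apply pow_le; lra). rewrite Rmult_comm.
    apply Rmult_le_compat_r; [apply Cmod_ge_0|]. rewrite (pow_add _ (Nd + 1)).
    assert (0 <= (/ s) ^ (Nd + 1)) by (apply pow_le; lra).
    assert ((/ s) ^ i <= 1) by (rewrite <- (pow1 i); apply pow_incr; lra). nra.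
  - right. unfold q. rewrite Nat.add_1_r. cbn [pow].
    replace (s ^ Nd * (B * (/ s * (/ s) ^ Nd) + K * (/ s * (/ s) ^ Nd)))
      with ((s ^ Nd * (/ s) ^ Nd) * ((B + K) * / s)) by ring.
    rewrite <- Rpow_mult_distr, Rinv_r, pow1 by lra. ring.
Qed.

(** * The L-function *)

(** Lets partial sums be taken over complete periods plus r < m further terms; there are finitely
    many r, so a common threshold exists. *)
Lemma ccv_residues (u : nat -> C) l m :
  (0 < m)%nat -> (forall r, (r < m)%nat -> ccv (fun s => u (m * s + r)%nat) l) -> ccv u l.
Proof.
  intros Hm H. apply ccv_eps. intros eps He.
  assert (X : exists N, forall r s, (r < m)%nat -> (N <= s)%nat -> Cmod (u (m * s + r)%nat - l) < eps).
  { clear Hm. revert H. generalize m at 1 3 as k. intros k. induction k as [|k IH]; intros H.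
    - exists O. intros r s L. lia.
    - destruct IH as [N1 HN1]; [intros; apply H; lia|].
      assert (Hk := H k ltac:(lia)). rewrite ccv_eps in Hk. destruct (Hk eps He) as [N2 HN2].
      exists (Nat.max N1 N2). intros r s L1 L2. destruct (Nat.eq_dec r k) as [->|Nr].
      + apply HN2. lia.
      + apply HN1; lia. }
  destruct X as [N HN]. exists (m * N)%nat. intros k Hk.
  rewrite (Nat.div_mod_eq k m). apply HN.
  - apply Nat.mod_upper_bound. lia.
  - apply Nat.div_le_lower_bound; lia.
Qed.

Lemma hurwitz_cv h a b z :
  1 <= h -> 0 <= a <= h -> is_bernoulli h a b -> 1 < Re z ->
  ccv (csum (fun l => Rpos_Cpower (h * INR l + a) (- z))) (hurwitz_reg h a b z + polar_term h z (2 * h)).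
Proof.
  intros Hh Ha Hb Hz.
  (* With q = 1 both bounds on N read 4 - Re z <= N, so N = 4 serves when Re z > 1. *)
  destruct (em_formula h a b 4 1 z Hh Ha Hb) as (K & W & K0 & HW); [cbn; lra|cbn; lra|].
  apply (proj2 (ccv_shift _ _ 2)).
  assert (Nz : z <> 1%C) by (intros ->; cbn in Hz; lra).
  replace (hurwitz_reg h a b z + polar_term h z (2 * h))%C
    with (hurwitz_reg h a b z + polar_term h z (2 * h) - 0 - 0 + 0)%C by ring.
  eapply ccv_ext; [intros t; symmetry; apply (proj2 (HW t)); [rewrite Cmod_center; lra|exact Nz]|].
  apply ccv_plus; [apply ccv_minus; [apply ccv_minus; [apply ccv_const|]|]|].
  - unfold em_poly. rewrite <- (csum_zero (fun _ => 0%C) 4) by easy.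
    apply (ccv_csum (fun k t => em_term b k z (h * INR (t + 2)))). intros k _.
    replace (RtoC 0) with (RtoC (b (S k)) * poch z k * 0)%C by ring.
    eapply ccv_ext; [|apply ccv_scal, (Cpower_cv0 h (z + RtoC (INR k)))]; [|lra|].
    + intros t. unfold em_term. ring.
    + unfold Re in *. cbn. assert (P := pos_INR k). lra.
  - replace (RtoC 0) with (RtoC (/ h) * / (z - 1) * 0)%C by ring.
    eapply ccv_ext; [|apply ccv_scal, (Cpower_cv0 h (z - 1))]; [|lra|].
    + intros t. unfold polar_term, Cdiv. replace (- (z - 1))%C with (1 - z)%C by ring. ring.
    + unfold Re in *. cbn. lra.
  - apply ccv_squeeze with (v := fun t => K * / INR (t + 2)).
    + intros t. replace (W t z - 0)%C with (W t z) by ring.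
      replace (K * / INR (t + 2)) with (K * (/ INR (t + 2)) ^ 1) by ring.
      apply (amaj_bound _ z 1 _ z (proj1 (HW t))). rewrite Cmod_center. lra.
    + apply lim0_scal. exact (proj1 (is_lim_seq_incr_n _ 2 _) is_lim_seq_inv_INR).
Qed.

Definition bernoulli_coef (h a : R) : nat -> R :=
  epsilon (inhabits (fun _ : nat => 0)) (is_bernoulli h a).

Lemma bernoulli_coef_spec h a : 0 < h -> is_bernoulli h a (bernoulli_coef h a).
Proof. intros Hh. exact (epsilon_spec _ (is_bernoulli h a) (bernoulli_exists h a Hh)). Qed.

Definition L_reg (m : nat) (chi : Z -> C) (z : C) : C :=
  csum (fun i => chi (Z.of_nat (S i)) *
    hurwitz_reg (INR m) (INR (S i)) (bernoulli_coef (INR m) (INR (S i))) z)%C m.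

Definition L_cont (m : nat) (chi : Z -> C) (z : C) : C :=
  csum (fun i => chi (Z.of_nat (S i)) *
    (hurwitz_reg (INR m) (INR (S i)) (bernoulli_coef (INR m) (INR (S i))) z
     + polar_term (INR m) z (2 * INR m)))%C m.

(** [polar_term] is the same for all residue classes, so only sum_a chi(a) weights it. *)
Lemma L_cont_split m chi z :
  L_cont m chi z
  = (L_reg m chi z + csum (fun i => chi (Z.of_nat (S i))) m * polar_term (INR m) z (2 * INR m))%C.
Proof.
  unfold L_cont, L_reg. rewrite Cmult_comm, <- csum_scal, <- csum_plus. apply csum_ext. intros; ring.
Qed.

Lemma INR_ge_1 m : (0 < m)%nat -> 1 <= INR m.
Proof. intros H. apply (le_INR 1). lia. Qed.

Lemma L_reg_entire m chi z0 : (0 < m)%nat -> exists M, amaj (L_reg m chi) z0 1 M.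
Proof.
  intros Hm. assert (Hh := INR_ge_1 m Hm). unfold L_reg.
  assert (X : forall k, (k <= m)%nat -> exists M, amaj (fun z => csum (fun i => chi (Z.of_nat (S i)) *
    hurwitz_reg (INR m) (INR (S i)) (bernoulli_coef (INR m) (INR (S i))) z)%C k) z0 1 M).
  { induction k as [|k IH]; intros L.
    - exists (Cmod 0). exact (amaj_const 0 z0 1).
    - destruct IH as [M IH]; [lia|].
      destruct (hurwitz_reg_entire (INR m) (INR (S k)) (bernoulli_coef (INR m) (INR (S k))) z0) as [M' H].
      + exact Hh.
      + split; [apply INR_ge_1; lia|now apply le_INR].
      + apply bernoulli_coef_spec. lra.
      + eexists. exact (amaj_plus _ _ _ _ _ _ Rle_0_1 IH (amaj_scal _ _ _ _ _ H)). }
  apply X. lia.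
Qed.

Lemma amaj_1_minus_power X z0 r :
  1 <= X -> 0 <= r -> exists M, amaj (fun z => Rpos_Cpower X (1 - z)) z0 r M.
Proof.
  intros HX Hr. eexists. eapply amaj_ext; [|apply (amaj_scal (RtoC X)), (amaj_Cpower X z0 r HX Hr)].
  intros z _. cbn beta. rewrite Cpower_1_minus by lra. reflexivity.
Qed.

Lemma L_cont_analytic m chi (z0 : C) : (0 < m)%nat -> z0 <> 1%C -> analytic_at (L_cont m chi) z0.
Proof.
  intros Hm N. assert (Hh := INR_ge_1 m Hm).
  assert (P : 0 < Cmod (z0 - 1)) by (apply Cmod_gt_0; intros E; apply N; now apply C_minus_eq0).
  set (r := Rmin 1 (Cmod (z0 - 1) / 2)).
  assert (R1 : r <= 1) by apply Rmin_l. assert (R2 : r <= Cmod (z0 - 1) / 2) by apply Rmin_r.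
  assert (Hr : 0 < r) by (apply Rmin_pos; lra).
  destruct (L_reg_entire m chi z0 Hm) as [M1 H1].
  assert (H1' : amaj (L_reg m chi) z0 r M1) by (apply amaj_shrink with 1; [lra|easy]).
  destruct (amaj_1_minus_power (2 * INR m) z0 r ltac:(lra) ltac:(lra)) as [M2 H2].
  assert (H3 := amaj_div_linear _ z0 r M2 1 ltac:(lra) H2).
  assert (H4 := amaj_plus _ _ _ _ _ _ (Rlt_le _ _ Hr) H1'
    (amaj_scal (csum (fun i => chi (Z.of_nat (S i))) m * RtoC (/ INR m))%C _ _ _ _ H3)).
  eapply amaj_analytic; [exact Hr|]. eapply amaj_ext; [|exact H4].
  intros z _. cbn beta. rewrite L_cont_split. unfold polar_term. ring.
Qed.

(** At z = 1 all depends on c = sum_a chi(a). If c = 0 the polar term drops out, also at 1 itself;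
    otherwise the numerator takes the value c / m there, because X^0 = 1, and the pole is simple. *)
Lemma L_cont_meromorphic m chi : (0 < m)%nat -> meromorphic (L_cont m chi).
Proof.
  intros Hm z0. assert (Hh := INR_ge_1 m Hm).
  destruct (classic (z0 = 1%C)) as [->|N]; [|left; now apply L_cont_analytic].
  destruct (L_reg_entire m chi 1 Hm) as [M1 H1].
  set (c := csum (fun i => chi (Z.of_nat (S i))) m).
  assert (Nh : RtoC (INR m) <> 0%C) by (intros E; apply RtoC_inj in E; lra).
  destruct (classic (c = 0%C)) as [Ec|Nc].
  - left. eapply amaj_analytic; [apply Rlt_0_1|]. eapply amaj_ext; [|exact H1].
    intros z _. rewrite L_cont_split. fold c. rewrite Ec. ring.
  - right. destruct (amaj_1_minus_power (2 * INR m) 1 1 ltac:(lra) ltac:(lra)) as [M2 H2].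
    assert (G := amaj_plus _ _ _ _ _ _ Rle_0_1 (amaj_scal (c * RtoC (/ INR m))%C _ _ _ _ H2)
      (amaj_mul_linear _ 1 1 M1 1 Rle_0_1 H1)).
    exists 1%nat. eexists. exists 1.
    split; [lia|]. split; [apply (amaj_analytic _ _ _ _ Rlt_0_1 G)|].
    split; [|split; [lra|]].
    + cbn beta. replace (1 - 1)%C with (RtoC (INR 0)) by (cbn; ring).
      rewrite Cpower_nat by lra. cbn [pow INR]. rewrite RtoC_inv by lra.
      intros E. apply Nc. replace c with (RtoC (INR m) * (c * / RtoC (INR m) * 1 + 0 * L_reg m chi 1))%C
        by (field; exact Nh). rewrite E. ring.
    + intros z Hz. assert (Nz := C_minus_nz z 1 (proj1 Hz)). rewrite L_cont_split. fold c.
      unfold polar_term. cbn [Cpow]. field. exact Nz.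
Qed.

Lemma chi_periodic m (chi : Z -> C) l i :
  (forall a : Z, chi (a + Z.of_nat m)%Z = chi a) ->
  chi (Z.of_nat (S (m * l + i))) = chi (Z.of_nat (S i)).
Proof.
  intros H. induction l as [|l IH]; [now rewrite Nat.mul_0_r|].
  rewrite <- IH, <- (H (Z.of_nat (S (m * l + i)))). f_equal. lia.
Qed.

Lemma INR_block m l i : INR (S (m * l + i)) = INR m * INR l + INR (S i).
Proof. rewrite <- mult_INR, <- plus_INR. f_equal. lia. Qed.

(** For Re z > 1 the complete periods split, class by class, into convergent Hurwitz series; the r
    extra terms tend to zero as terms of those series. *)
Lemma L_cont_is_L_function m chi :
  (0 < m)%nat -> (forall a : Z, chi (a + Z.of_nat m)%Z = chi a) -> is_L_function chi (L_cont m chi).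
Proof.
  intros Hm Hper. split; [now apply L_cont_meromorphic|]. intros z Hz. apply is_series_ccv.
  assert (Hh := INR_ge_1 m Hm).
  assert (Hur : forall i, (i < m)%nat ->
    ccv (csum (fun l => Rpos_Cpower (INR m * INR l + INR (S i)) (- z)))
      (hurwitz_reg (INR m) (INR (S i)) (bernoulli_coef (INR m) (INR (S i))) z
       + polar_term (INR m) z (2 * INR m))).
  { intros i Hi. apply hurwitz_cv; auto.
    - split; [apply pos_INR|now apply le_INR].
    - apply bernoulli_coef_spec. lra. }
  set (f := fun k => (chi (Z.of_nat (S k)) * Rpos_Cpower (INR (S k)) (- z))%C).
  assert (Ef : forall l i, f (m * l + i)%nat
    = (chi (Z.of_nat (S i)) * Rpos_Cpower (INR m * INR l + INR (S i)) (- z))%C).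
  { intros l i. unfold f. rewrite chi_periodic by easy. now rewrite INR_block. }
  apply ccv_residues with m; [exact Hm|]. intros r Lr.
  replace (L_cont m chi z) with (L_cont m chi z + csum (fun _ => 0%C) r)%C
    by (rewrite csum_zero by easy; ring).
  eapply ccv_ext with (u := fun s => (csum f (m * s) + csum (fun j => f (m * s + j)%nat) r)%C).
  { intros s. now rewrite csum_add. }
  apply ccv_plus.
  - eapply ccv_ext; [intros s; symmetry; apply csum_blocks|].
    apply (ccv_csum (fun i s => csum (fun l => f (m * l + i)%nat) s)). intros i Hi.
    eapply ccv_ext; [|apply ccv_scal, (Hur i Hi)]. intros s. cbn beta. rewrite <- csum_scal.
    apply csum_ext. intros l _. now rewrite Ef.
  - apply (ccv_csum (fun j s => f (m * s + j)%nat)). intros j Hj.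
    replace (RtoC 0) with (chi (Z.of_nat (S j)) * 0)%C by ring.
    eapply ccv_ext; [|apply ccv_scal, (ccv_sum_term _ _ (Hur j ltac:(lia)))].
    intros s. cbn beta. now rewrite Ef.
Qed.

(** * Bernoulli numbers and polynomials expressed through [bernoulli_coef] *)

Lemma is_pseries_R_ccv (a : nat -> R) t l :
  is_pseries a t l -> ccv (csum (fun k => RtoC (a k) * RtoC t ^ k)%C) (RtoC l).
Proof.
  intros H. apply is_pseries_R in H.
  apply (proj2 (ccv_shift _ _ 1)). apply ccv_components. cbn [fst snd RtoC]. split.
  - apply is_lim_seq_ext with (sum_n (fun n => a n * t ^ n)); [|exact H].
    intros n. rewrite sum_n_rsum, Nat.add_1_r, csum_fst. apply rsum_ext. intros i _.
    rewrite <- RtoC_pow. cbn. ring.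
  - eapply is_lim_seq_ext; [|apply is_lim_seq_const]. intros n. cbn beta. rewrite csum_snd.
    symmetry. apply rsum_zero. intros i _. rewrite <- RtoC_pow. cbn. ring.
Qed.

Lemma exp_ne_1 x : x <> 0 -> 1 - exp x <> 0.
Proof. intros N E. apply N. apply exp_inv. rewrite exp_0. lra. Qed.

(** Divide the generating function of [bernoulli_coef 1 w] by t; since b_0 = 1, the polar part is
    1/t. *)
Lemma modified_bernoulli_exists w : exists b, is_modified_bernoulli w b.
Proof.
  set (be := bernoulli_coef 1 w).
  assert (Hbe : is_bernoulli 1 w be) by (apply bernoulli_coef_spec; lra).
  destruct (bernoulli_generating 1 w be Rlt_0_1 Hbe) as (r & Hr & H).
  exists (fun k => be (S k)), r. split; [easy|]. intros t Ht. specialize (H t Ht).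
  assert (Nt : t <> 0) by (intros ->; rewrite Rabs_R0 in Ht; lra).
  apply (is_pseries_decr_1 _ _ (/ t)) in H; [|unfold mult, one; cbn; field; exact Nt].
  unfold PS_decr_1 in H.
  match type of H with is_pseries _ _ ?l => replace (exp (- w * t) / (1 - exp (- t)) - 1 / t) with l; [exact H|] end.
  rewrite (is_bernoulli_0 1 w be Rlt_0_1 Hbe). unfold scal, plus, opp. cbn. unfold mult. cbn.
  replace (- (1) * t) with (- t) by ring.
  assert (N1 : 1 - exp (- t) <> 0) by (apply exp_ne_1; lra). field. auto.
Qed.

(** Put h t for t in the generating function of the b_k(a/h) and multiply by t: this is the function
    that generates [bernoulli_coef h a]. The polar part 1/(h t) becomes the constant coefficient
    1/h, and the others move up by one index. *)
Lemma modified_bernoulli_eq h a n :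
  0 < h -> modified_bernoulli (a / h) n * h ^ n = bernoulli_coef h a (S n).
Proof.
  intros Hh. set (be := bernoulli_coef h a).
  assert (Hbe : is_bernoulli h a be) by now apply bernoulli_coef_spec.
  destruct (bernoulli_generating h a be Hh Hbe) as (r1 & Hr1 & H1).
  assert (Hmb : is_modified_bernoulli (a / h) (modified_bernoulli (a / h))).
  { exact (epsilon_spec _ (is_modified_bernoulli (a / h)) (modified_bernoulli_exists (a / h))). }
  destruct Hmb as (r2 & Hr2 & H2). set (mb := modified_bernoulli (a / h)) in *.
  set (g := fun k => match k with O => / h | S j => mb j * h ^ j end).
  change (g (S n) = be (S n)). apply RtoC_inj.
  apply (pseries_unique (fun k => RtoC (g k)) (fun k => RtoC (be k)) (Rmin r1 (r2 / h))).
  { apply Rmin_pos; [easy|]. now apply Rdiv_lt_0_compat. }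
  intros t Ht. assert (T1 := Rmin_l r1 (r2 / h)). assert (T2 := Rmin_r r1 (r2 / h)).
  assert (Tr2 : t * h < r2) by (apply Rlt_div_r; lra).
  specialize (H1 t). rewrite Rabs_pos_eq in H1 by lra. specialize (H1 ltac:(lra)).
  specialize (H2 (t * h)). rewrite Rabs_pos_eq in H2 by nra. specialize (H2 ltac:(nra)).
  exists (RtoC (t * exp (- a * t) / (1 - exp (- h * t)))). split; [|now apply is_pseries_R_ccv].
  apply is_pseries_R_ccv in H2. apply (ccv_scal (RtoC t)) in H2.
  apply (ccv_plus _ _ _ _ (ccv_const (RtoC (/ h)))) in H2.
  apply (proj2 (ccv_shift _ _ 1)).
  match type of H2 with ccv _ ?l => replace (RtoC (t * exp (- a * t) / (1 - exp (- h * t)))) with l end.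
  - eapply ccv_ext; [|exact H2]. intros k. cbn beta. rewrite Nat.add_1_r, csum_S_l.
    cbn [g Cpow]. rewrite <- csum_scal, Cmult_1_r. f_equal. apply csum_ext. intros i _.
    rewrite <- !RtoC_pow, !RtoC_mult, !RtoC_pow, RtoC_mult, Cpow_mult_l. ring.
  - rewrite <- RtoC_mult, <- RtoC_plus. f_equal.
    replace (- (a / h) * (t * h)) with (- a * t) by (field; lra).
    replace (- (t * h)) with (- h * t) by ring.
    assert (N1 : 1 - exp (- h * t) <> 0) by (apply exp_ne_1; nra). field. repeat split; lra.
Qed.

(** The least of finitely many radii serves all residue classes. *)
Lemma bernoulli_generating_uniform m :
  (0 < m)%nat -> exists r, 0 < r /\ forall i t, (i < m)%nat -> 0 < Rabs t < r ->
    is_pseries (bernoulli_coef (INR m) (INR (S i))) t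
      (t * exp (- INR (S i) * t) / (1 - exp (- INR m * t))).
Proof.
  intros Hm. assert (Hh := INR_ge_1 m Hm).
  assert (X : forall k, exists r, 0 < r /\ forall i t, (i < k)%nat -> 0 < Rabs t < r ->
    is_pseries (bernoulli_coef (INR m) (INR (S i))) t
      (t * exp (- INR (S i) * t) / (1 - exp (- INR m * t)))).
  { induction k as [|k (r & Hr & IH)].
    - exists 1. split; [lra|]. intros i t L. lia.
    - destruct (bernoulli_generating (INR m) (INR (S k)) _ ltac:(lra)
        (bernoulli_coef_spec (INR m) (INR (S k)) ltac:(lra))) as (r' & Hr' & H).
      exists (Rmin r r'). split; [now apply Rmin_pos|]. intros i t L Ht.
      assert (T1 := Rmin_l r r'). assert (T2 := Rmin_r r r').
      destruct (Nat.eq_dec i k) as [->|N]; [apply H; lra|apply IH; [lia|lra]]. }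
  apply X.
Qed.

(** This is B_(chi,k) / k!. The sign comes from t e^(at) / (e^(mt) - 1) = u e^(-au) / (1 - e^(-mu))
    with u = -t. *)
Definition chi_bernoulli_coef (m : nat) (chi : Z -> C) (k : nat) : C :=
  (RtoC (-1) ^ k * csum (fun i => chi (Z.of_nat (S i)) * RtoC (bernoulli_coef (INR m) (INR (S i)) k))%C m)%C.

Lemma chi_bernoulli_coef_generating m chi :
  (0 < m)%nat -> exists r, 0 < r /\ forall t, 0 < Rabs t < r ->
    ccv (csum (fun k => chi_bernoulli_coef m chi k * RtoC t ^ k)%C)
      (sum_n_m (fun a : nat => chi (Z.of_nat a)
           * RtoC (t * exp (INR a * t) / (exp (INR m * t) - 1)))%C 1 m).
Proof.
  intros Hm. assert (Hh := INR_ge_1 m Hm).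
  destruct (bernoulli_generating_uniform m Hm) as (r & Hr & H).
  exists r. split; [easy|]. intros t Ht. rewrite sum_1_csum.
  assert (Nt : t <> 0) by (intros ->; rewrite Rabs_R0 in Ht; lra).
  eapply ccv_ext; [|apply (ccv_csum (fun i n => chi (Z.of_nat (S i)) *
    csum (fun k => RtoC (bernoulli_coef (INR m) (INR (S i)) k) * RtoC (- t) ^ k) n)%C)].
  - intros n. cbn beta.
    rewrite (csum_ext _ (fun i => csum (fun k => chi (Z.of_nat (S i)) *
      (RtoC (bernoulli_coef (INR m) (INR (S i)) k) * RtoC (- t) ^ k))%C n)).
    2:{ intros i _. now rewrite csum_scal. }
    rewrite csum_exchange. apply csum_ext. intros k _. unfold chi_bernoulli_coef.
    replace (- t) with (-1 * t) by ring. rewrite RtoC_mult, Cpow_mult_l.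
    match goal with |- _ = (?x * ?y * ?z)%C => replace (x * y * z)%C with (x * z * y)%C by ring end.
    rewrite <- csum_scal.
    apply csum_ext. intros; ring.
  - intros i Hi. apply ccv_scal.
    specialize (H i (- t) Hi ltac:(rewrite Rabs_Ropp; exact Ht)). apply is_pseries_R_ccv in H.
    replace (t * exp (INR (S i) * t) / (exp (INR m * t) - 1))
      with (- t * exp (- INR (S i) * - t) / (1 - exp (- INR m * - t))); [exact H|].
    replace (- INR (S i) * - t) with (INR (S i) * t) by ring.
    replace (- INR m * - t) with (INR m * t) by ring.
    assert (N1 : 1 - exp (INR m * t) <> 0).
    { apply exp_ne_1. intros E. destruct (Rmult_integral _ _ E); lra. }
    field. split; lra.
Qed.

Lemma chi_bernoulli_eq m chi k :
  (0 < m)%nat -> (chi_bernoulli m chi k / RtoC (INR (fact k)))%C = chi_bernoulli_coef m chi k.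
Proof.
  intros Hm. destruct (chi_bernoulli_coef_generating m chi Hm) as (r1 & Hr1 & H1).
  assert (F : forall j, RtoC (INR (fact j)) <> 0%C)
    by (intros j E; apply RtoC_inj in E; now apply (INR_fact_neq_0 j)).
  assert (HB : is_chi_bernoulli m chi (chi_bernoulli m chi)).
  { apply (epsilon_spec (inhabits (fun _ : nat => RtoC 0)) (is_chi_bernoulli m chi)).
    exists (fun k => RtoC (INR (fact k)) * chi_bernoulli_coef m chi k)%C, r1. split; [easy|].
    intros t Ht. apply is_pseries_ccv. eapply ccv_ext; [|apply (H1 t Ht)]. intros n. apply csum_ext.
    intros j _. field. apply F. }
  destruct HB as (r2 & Hr2 & H2).
  apply (pseries_unique (fun k => chi_bernoulli m chi k / RtoC (INR (fact k)))%C
    (chi_bernoulli_coef m chi) (Rmin r1 r2)); [now apply Rmin_pos|].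
  intros t Ht. assert (T1 := Rmin_l r1 r2). assert (T2 := Rmin_r r1 r2).
  specialize (H1 t). specialize (H2 t). rewrite Rabs_pos_eq in H1, H2 by lra.
  eexists. split; [|apply H1; lra]. apply is_pseries_ccv. apply H2. lra.
Qed.

Theorem theorem1p20 (m : nat) (chi : Z -> C) (Hchi : dirichlet_character m chi)
    (n : nat) :
  (S_hat m chi n
   = - C_derive (L_function chi) (RtoC (- INR n))
     + RtoC (-1) ^ (n + 1) * RtoC (INR (fact n)) * RtoC (INR m) ^ n
       * sum_n_m (fun a : nat =>
                    chi (Z.of_nat a)
                    * RtoC (modified_bernoulli (INR a / INR m) n)) 1 m
       * RtoC (harmonic n)
     + chi_bernoulli m chi (n + 1) / RtoC (INR (n + 1)) * RtoC (ln (INR m)))%C.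
Proof.
  destruct Hchi as (Hm & Hper & _ & _). assert (Hh := INR_ge_1 m Hm).
  set (z0 := RtoC (- INR n)).
  set (be := fun i => bernoulli_coef (INR m) (INR (S i))).
  assert (Hd : exists d : nat -> C, forall i, (i < m)%nat ->
    cder (fun z => hurwitz_reg (INR m) (INR (S i)) (be i) z + polar_term (INR m) z (2 * INR m))%C z0 (d i)).
  { assert (X : forall i, exists d, (i < m)%nat ->
      cder (fun z => hurwitz_reg (INR m) (INR (S i)) (be i) z + polar_term (INR m) z (2 * INR m))%C z0 d).
    { intros i. destruct (Nat.lt_ge_cases i m) as [L|L]; [|exists 0%C; intros; lia].
      destruct (hurwitz_reg_entire (INR m) (INR (S i)) (be i) z0 Hh) as [M HM].
      - split; [apply INR_ge_1; lia|now apply le_INR].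
      - apply bernoulli_coef_spec. lra.
      - destruct (amaj_cder _ _ _ _ Rlt_0_1 HM) as (d & Hd & _).
        eexists. intros _. apply cder_plus; [exact Hd|].
        apply cder_polar_term; [lra|apply opp_INR_ne_1]. }
    exists (fun i => proj1_sig (constructive_indefinite_description _ (X i))).
    intros i. exact (proj2_sig (constructive_indefinite_description _ (X i))). }
  destruct Hd as [d Hd].
  assert (EL : C_derive (L_function chi) z0 = csum (fun i => chi (Z.of_nat (S i)) * d i)%C m).
  { apply (C_derive_L_function chi (L_cont m chi)).
    - now apply L_cont_is_L_function.
    - apply L_cont_analytic; [exact Hm|apply opp_INR_ne_1].
    - apply (cder_csum (fun i z => chi (Z.of_nat (S i)) *
        (hurwitz_reg (INR m) (INR (S i)) (be i) z + polar_term (INR m) z (2 * INR m)))%C).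
      intros i Hi. apply cder_scal. now apply Hd. }
  (* Summation up to m s runs over s complete periods, so the expansion is the chi-weighted sum of
     those of the residue classes. *)
  assert (ES : S_hat m chi n = csum (fun i => chi (Z.of_nat (S i)) *
    (- d i + RtoC (be i (S n)) * (dpoch z0 n - poch z0 n * RtoC (ln (INR m)))))%C m).
  { apply constant_term_eq.
    destruct (asymptotic_expansion_csum
      (fun i s => chi (Z.of_nat (S i)) * csum (fun l =>
         RtoC ((INR m * INR l + INR (S i)) ^ n * ln (INR m * INR l + INR (S i)))) s)%C (n + 1)
      (fun i => chi (Z.of_nat (S i)) *
        (- d i + RtoC (be i (S n)) * (dpoch z0 n - poch z0 n * RtoC (ln (INR m)))))%C m)
      as (A & c & HA & Hc).
    - intros i Hi.
      destruct (log_sum_expansion (INR m) (INR (S i)) (be i) n (d i) Hh) as (A & c & HA & Hc).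
      + split; [apply INR_ge_1; lia|now apply le_INR].
      + apply bernoulli_coef_spec. lra.
      + now apply Hd.
      + exists (fun j => chi (Z.of_nat (S i)) * A j)%C, (fun j => chi (Z.of_nat (S i)) * c j)%C.
        split; [now apply asymptotic_expansion_scal|]. now rewrite Hc.
    - exists (n + 1)%nat, A, c. split; [|exact Hc].
      intros N. specialize (HA N). eapply is_lim_seq_ext; [|exact HA]. intros s. cbn beta.
      do 4 f_equal. rewrite sum_1_csum, csum_blocks. apply csum_ext. intros i _.
      rewrite <- csum_scal. apply csum_ext. intros l _. now rewrite chi_periodic, INR_block. }
  rewrite ES, EL. unfold z0. rewrite dpoch_neg_full, poch_neg_full.
  (* Index k = n + 1 of [chi_bernoulli_eq], with (n+1)! / (n+1) = n!. *)
  assert (EB : (chi_bernoulli m chi (n + 1) / RtoC (INR (n + 1)))%C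
    = (RtoC (INR (fact n)) * RtoC (-1) ^ (n + 1) * csum (fun i => chi (Z.of_nat (S i)) * RtoC (be i (S n)))%C m)%C).
  { assert (N1 : RtoC (INR (S n)) <> 0%C)
      by (intros E; apply RtoC_inj in E; now apply (not_0_INR (S n))).
    assert (F : RtoC (INR (fact n)) <> 0%C)
      by (intros E; apply RtoC_inj in E; now apply (INR_fact_neq_0 n)).
    assert (E := chi_bernoulli_eq m chi (S n) Hm). unfold chi_bernoulli_coef in E. fold be in E.
    rewrite fact_simpl, mult_INR, RtoC_mult in E. rewrite Nat.add_1_r.
    rewrite <- Cmult_assoc. unfold be. rewrite <- E. field. auto. }
  rewrite EB.
  assert (EM : (RtoC (INR m) ^ n * sum_n_m (fun a : nat => chi (Z.of_nat a)
        * RtoC (modified_bernoulli (INR a / INR m) n)) 1 m)%C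
    = csum (fun i => chi (Z.of_nat (S i)) * RtoC (be i (S n)))%C m).
  { rewrite sum_1_csum, <- csum_scal. apply csum_ext. intros i _.
    unfold be. rewrite <- modified_bernoulli_eq by lra. rewrite RtoC_mult, RtoC_pow. ring. }
  rewrite <- (Cmult_assoc _ (RtoC (INR m) ^ n)), EM.
  set (T := csum (fun i => chi (Z.of_nat (S i)) * RtoC (be i (S n)))%C m).
  (* Both corrections are now multiples of [T], and - (-1)^n = (-1)^(n+1) matches the sign of the
     log m term. *)
  rewrite (csum_ext _ (fun i => (- (1)) * (chi (Z.of_nat (S i)) * d i) +
    (RtoC (-1) ^ (n + 1) * RtoC (INR (fact n)) * RtoC (harmonic n)
      - RtoC (-1) ^ n * RtoC (INR (fact n)) * RtoC (ln (INR m))) * (chi (Z.of_nat (S i)) * RtoC (be i (S n))))%C)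
    by (intros; ring).
  rewrite csum_plus, !csum_scal. fold T. rewrite Nat.add_1_r. cbn [Cpow].
  change (-1) with (- (1)). rewrite RtoC_opp. ring.
Qed.
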